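(* Let $d\ge3$, $r\ge s\ge0$, $n$ with $dn$ an integer and $nd\ge(d+r+1)^2$, and let $\nu$ be a Marcinkiewicz–Zygmund measure of order $2(d+2)n$. Then $$\sup_{\mathbf{x}\in\mathbb{S}^d}\int_{\mathbb{S}^d}|\widetilde{\Phi}_{d;n,r}(\mathbf{x}\cdot\mathbf{y})|(1-\mathbf{x}\cdot\mathbf{y})^{s/2}d|\nu|(\mathbf{y})=\sup_{\mathbf{x}\in\mathbb{S}^d}\int_{\mathbb{S}^d}|\Phi_{d;n,r}(\mathbf{x}\cdot\mathbf{y})|(1-\mathbf{x}\cdot\mathbf{y})^{s/2}\left(\frac{1+\mathbf{x}\cdot\mathbf{y}}{2}\right)^{-n}d|\nu|(\mathbf{y})\lesssim\frac{d^{1/6}}{n^s}|\!|\!|\nu|\!|\!|_{d;2(d+2)n}.$$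
   Context: $\mathbb{S}^d$ is the unit sphere of $\mathbb{R}^{d+1}$ and $\mu_d^*$ the rotation-invariant surface measure with $\mu_d^*(\mathbb{S}^d)=1$. For real $m>0$, $\Pi_m^d$ is the space of restrictions to $\mathbb{S}^d$ of algebraic polynomials in $d+1$ variables of total degree $<m$. For $\alpha,\beta>-1$, $p_\ell^{(\alpha,\beta)}$ is the Jacobi polynomial of degree $\ell$ with positive leading coefficient, orthonormal with respect to $(1-x)^\alpha(1+x)^\beta dx$ on $[-1,1]$. Let $\omega_d=2\pi^{(d+1)/2}/\Gamma((d+1)/2)$, $K_{d;m}(t)=\frac{\omega_d}{\omega_{d-1}}\sum_{0\le\ell<m}p_\ell^{(d/2-1,d/2-1)}(1)p_\ell^{(d/2-1,d/2-1)}(t)$, $$\widetilde{\Phi}_{d;n,r}(t)=K_{d;(d+2)n}(t)\frac{p_{dn}^{(d/2+r,d/2-2)}(t)}{p_{dn}^{(d/2+r,d/2-2)}(1)},\qquad\Phi_{d;n,r}(t)=\widetilde{\Phi}_{d;n,r}(t)\left(\frac{1+t}{2}\right)^n.$$ A signed Borel measure $\nu$ of bounded total variation on $\mathbb{S}^d$ is a Marcinkiewicz–Zygmund measure of order $m$ if there is $c>0$ with $\int|P|^2d|\nu|\le c\int|P|^2d\mu_d^*$ for all $P\in\Pi_{m/2}^d$; $|\!|\!|\nu|\!|\!|_{d;m}$ is the infimum of such $c$. Convention: $A\lesssim B$ means $A\le cB$ for a positive constant $c$ that may depend on $r$ (and $s$) but is independent of $d$, $n$, $\nu$ and points. *)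

(* Defs.v *)
From HB Require Import structures.
From mathcomp Require Import all_boot all_order all_algebra.
From mathcomp Require Import all_classical all_reals all_analysis.
Set Implicit Arguments. Unset Strict Implicit. Unset Printing Implicit Defensive.
Import Order.TTheory GRing.Theory Num.Theory.
Import numFieldNormedType.Exports.
Local Open Scope classical_set_scope.
Local Open Scope ring_scope.

Section Defs.
Variable R : realType.

Definition Rd (d : nat) := g_sigma_algebraType (@open 'rV[R]_d.+1).

Definition dotv (d : nat) (x y : 'rV[R]_d.+1) : R :=
  \sum_(i < d.+1) x ord0 i * y ord0 i.

Definition Ssphere (d : nat) : set (Rd d) := [set x | dotv x x = 1].
Arguments Ssphere : clear implicits.

Definition is_normalized_surface_measure (d : nat)
    (mu : {measure set (Rd d) -> \bar R}) : Prop :=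
  [/\ mu (Ssphere d) = 1%E, mu (~` Ssphere d) = 0%E &
      forall Q : 'M[R]_d.+1, Q *m Q^T = 1%:M -> \det Q = 1 ->
      forall A : set (Rd d), measurable A ->
        mu ((fun x : Rd d => (x *m Q : 'rV[R]_d.+1)) @^-1` A) = mu A].

Definition poly_deg_lt (d : nat) (m : R) (f : Rd d -> R) : Prop :=
  exists s : seq (R * (d.+1).-tuple nat),
    all (fun c => ((\sum_(i < d.+1) tnth c.2 i)%:R < m)) s /\
    forall x : Rd d,
      f x = \sum_(c <- s) c.1 * \prod_(i < d.+1) (x ord0 i) ^+ tnth c.2 i.

(* The Marcinkiewicz--Zygmund inequality of order m with constant c, for a
   (positive) measure nuv playing the role of |nu|. *)
Definition MZ_ineq (d : nat) (mu nuv : {measure set (Rd d) -> \bar R})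
    (m c : R) : Prop :=
  forall P : Rd d -> R, poly_deg_lt (m / 2) P ->
    (\int[nuv]_(y in Ssphere d) ((P y) ^+ 2)%:E <=
     c%:E * \int[mu]_(y in Ssphere d) ((P y) ^+ 2)%:E)%E.

Definition is_MZ (d : nat) (mu nuv : {measure set (Rd d) -> \bar R})
    (m : R) : Prop :=
  exists c : R, 0 < c /\ MZ_ineq mu nuv m c.

Definition MZ_norm (d : nat) (mu nuv : {measure set (Rd d) -> \bar R})
    (m : R) : R :=
  inf [set c : R | 0 < c /\ MZ_ineq mu nuv m c].

Definition jacobi_weight (a b x : R) : R := (1 - x) `^ a * (1 + x) `^ b.

Definition jacobi_spec (a b : R) (P : nat -> {poly R}) : Prop :=
  (forall l, size (P l) = l.+1 /\ 0 < lead_coef (P l)) /\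
  (forall l1 l2,
    (\int[lebesgue_measure]_(x in `[(-1)%R, 1%R]%classic)
       ((P l1).[x] * (P l2).[x] * jacobi_weight a b x)%:E =
     ((l1 == l2)%:R)%:E)%E).

Definition jacobi_seq (a b : R) : nat -> {poly R} :=
  xget (fun=> 0) [set P | jacobi_spec a b P].
Definition jacobi (a b : R) (l : nat) (t : R) : R := (jacobi_seq a b l).[t].

(* Gamma(k/2) for k >= 1, via Gamma(1/2) = sqrt pi, Gamma(1) = 1,
   Gamma(x+1) = x Gamma(x). *)
Fixpoint gamma_half (k : nat) : R :=
  match k with
  | 0 => 0
  | 1 => Num.sqrt pi
  | 2 => 1
  | (k'.+2) as k2 => (k'%:R / 2) * gamma_half k'
  end.

Definition omega (d : nat) : R :=
  2 * pi `^ (d.+1%:R / 2) / gamma_half d.+1.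

Definition Kdm (d : nat) (m t : R) : R :=
  omega d / omega d.-1 *
  \sum_(l < (Num.truncn m).+1 | l%:R < m)
     jacobi (d%:R / 2 - 1) (d%:R / 2 - 1) l 1 *
     jacobi (d%:R / 2 - 1) (d%:R / 2 - 1) l t.

(* tilde Phi_{d;n,r}(t), where k = dn (a natural number) *)
Definition Phit (d k : nat) (n r t : R) : R :=
  Kdm d ((d%:R + 2) * n) t *
  (jacobi (d%:R / 2 + r) (d%:R / 2 - 2) k t /
   jacobi (d%:R / 2 + r) (d%:R / 2 - 2) k 1).

Definition Phi (d k : nat) (n r t : R) : R :=
  Phit d k n r t * ((1 + t) / 2) `^ n.

End Defs.
Arguments Ssphere : clear implicits.

(* Main.v *)
(** Idea. On the sphere [u = 1 - x.y] is half the squared chord length, hence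
    [u^N q(x.y)^2] is a sum of squares of polynomials and the
    Marcinkiewicz-Zygmund inequality replaces [|nu|] by [mu] in its integral.
    Zonal [mu]-integrals are normalized Jacobi integrals with weight
    [(1 - t^2)^(d/2 - 1)]: infinitesimal rotations give both the same moment
    recursion. With [K] the kernel and [P] the normalized Jacobi polynomial,
    AM-GM gives [2 |K P| u^(s/2) <= eta K^2 + P^2 u^s / eta], where
    [u^s <= n^(-2 s) (1 + n^(2 r) u^r)]. The power [u^r] is majorized up to
    [n^(-2 r)] by a combination of terms [u^N q(t)^2], built from the iterates
    of the tripling map [v (3 - 4 v)^2 = sin^2 (3 theta)], [v = u / 2 = sin^2 theta].
    It remains to bound the integrals of [K^2] and of [P^2 u^j]: the first is
    a sum of inverse norms of Jacobi polynomials; the second is controlled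
    through the Jacobi differential equation and a Hardy-type inequality. The
    products of Pochhammer ratios that appear are bounded uniformly in [d], so
    the factor [d^(1/6)] is only used as a number at least 1. *)

Require Import Defs.
From HB Require Import structures.
From mathcomp Require Import all_boot all_order all_algebra.
From mathcomp Require Import all_classical all_reals all_analysis.
From mathcomp Require Import measurable_realfun ring lra zify.
Import Order.TTheory GRing.Theory Num.Theory.
Import numFieldNormedType.Exports.
Local Open Scope classical_set_scope.
Local Open Scope ring_scope.

(** * Integrals against Jacobi weights *)

(** The powers of [n] balance as follows. Parseval turns the integral of [K^2] into the sum of the
    inverse norms [jnorm], and [P^2] carries the factor [jnorm] of the polynomial of degree [dn];
    the product of these two is of order [n^(- (2 r + 1))]. The squared orthonormal polynomial of
    degree [dn] has integral at most of order [n] with the weight [u^r] and at most of order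
    [n^(2 r + 1)] without it. So the product of the two means is of order [n^(- 2 s)], and the [eta]
    that balances the two terms of AM-GM gives [n^(- s)]. The degree budget [(d + 2) n] of the
    Marcinkiewicz-Zygmund inequality decides where the weight goes. [K] may use it up, so no power
    of [u] can accompany [K^2]; [P] has degree [dn], which leaves [2 n] for [N] plus the degree of
    [q]. Hence the majorant of [u^r] has degree of order [n], and with it an error [n^(- 2 r)].
    Uniformity in [d] rests on [k = d n]: the Pochhammer ratios start at arguments comparable to
    [d], so each quotient [(x + r) / (x + r + k)] is of order [1 / n]. The hypothesis on [n d] also
    gives [n >= d + 2 r + 2], which absorbs the lower-order terms. *)

Section ImproperFTC.
Variable R : realType.
Local Notation leb := (@lebesgue_measure R).
Local Notation Ioo := (`](-1 : R), (1 : R)[%classic : set R).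
Local Notation Icc := (`[(-1 : R), (1 : R)]%classic : set R).
Implicit Types g h : R -> R.

Definition eps (n : nat) : R := (n.+2%:R)^-1.

Lemma eps_gt0 n : 0 < eps n.
Proof. by rewrite invr_gt0 ltr0n. Qed.

Lemma eps_lt1 n : eps n < 1.
Proof. by rewrite invf_lt1 ?ltr0n // ltr1n. Qed.

(** Jacobi weights with a negative exponent blow up at an endpoint ([d / 2 - 2 < 0] for [d = 3]), so
    the fundamental theorem is applied on these compact intervals, which exhaust the open one. *)
Definition shrunk (n : nat) : set R := `[- (1 - eps n), 1 - eps n]%classic.

Lemma shrunk_sub n : shrunk n `<=` Ioo.
Proof.
move=> x; rewrite /shrunk /= !in_itv /= => /andP[h1 h2].
have e0 := eps_gt0 n; by apply/andP; split; lra.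
Qed.

Lemma shrunk_nd : nondecreasing_seq shrunk.
Proof.
move=> m n mn; apply/subsetPset => x; rewrite /shrunk /= !in_itv /=.
have : eps n <= eps m.
  by rewrite lef_pV2 ?posrE ?ltr0n // ler_nat !ltnS.
by move=> h /andP[h1 h2]; apply/andP; split; lra.
Qed.

Lemma bigcup_shrunk : \bigcup_n shrunk n = Ioo.
Proof.
apply/seteqP; split => [x [n _]|x]; first exact: shrunk_sub.
rewrite /= in_itv /= => /andP[h1 h2].
pose e := Num.min (1 - x) (1 + x).
have e0 : 0 < e by rewrite lt_min; apply/andP; split; lra.
have [m _ hm] := near_infty_natSinv_lt (PosNum e0).
exists m => //; rewrite /shrunk /= in_itv /=.
have := hm m (leqnn m); rewrite /= lt_min => /andP[k1 k2].
have : eps m <= (m.+1%:R)^-1.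
  by rewrite lef_pV2 ?posrE ?ltr0n // ler_nat.
by move: k1 k2; set e' := (m.+1%:R)^-1 => k1 k2 h; apply/andP; split; lra.
Qed.

Lemma measurable_shrunk n : measurable (shrunk n).
Proof. exact: measurable_itv. Qed.

Lemma integral_cc_oo h : measurable_fun Ioo h ->
  (\int[leb]_(x in Icc) (h x)%:E = \int[leb]_(x in Ioo) (h x)%:E)%E.
Proof.
move=> mh; rewrite -integral_itv_obnd_cbnd; last first.
  by apply/measurable_EFinP/measurable_fun_itv_bndo_bndcP.
by rewrite integral_itv_bndo_bndc //; exact/measurable_EFinP.
Qed.

Lemma FTC_shrunk g h n :
  (forall x : R, x \in `]-1, 1[ -> is_derive x 1 g (h x)) ->
  (forall x : R, x \in `]-1, 1[ -> {for x, continuous h}) ->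
  (\int[leb]_(x in shrunk n) (h x)%:E =
    (g (1 - eps n))%:E - (g (- (1 - eps n)))%:E)%E.
Proof.
move=> dg ch.
have e1 := eps_lt1 n.
have sub x : x \in `[- (1 - eps n), 1 - eps n] -> x \in (`]-1, 1[ : interval R).
  by move=> xi; have := @shrunk_sub n x; rewrite /shrunk /= => ->.
have cg : {within shrunk n, continuous g}.
  apply: derivable_within_continuous => x xi.
  by have [] := dg _ (sub _ xi).
have lt : - (1 - eps n) < 1 - eps n :> R by lra.
apply: (@continuous_FTC2 R h g) => //.
- apply: continuous_in_subspaceT => x; rewrite inE /= => xi.
  exact/ch/sub.
- have /(continuous_within_itvP _ lt)[c1 c2 c3] := cg.
  split => // x xi; have [] // := dg x.
  by apply: sub; apply: subset_itv_oo_cc xi.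
- move=> x xi; have hx := dg x (sub x (subset_itv_oo_cc xi)).
  by rewrite derive1E derive_val.
Qed.

(** Monotone convergence: the integrals over [shrunk n] increase to [gb - ga], so finite boundary
    limits of the antiderivative give integrability without a majorant. *)
Lemma ge0_improper_FTC g h (ga gb : R) :
  (forall x : R, x \in `]-1, 1[ -> is_derive x 1 g (h x)) ->
  (forall x : R, x \in `]-1, 1[ -> {for x, continuous h}) ->
  (forall x : R, x \in `]-1, 1[ -> 0 <= h x) ->
  g (1 - eps n) @[n --> \oo] --> gb ->
  g (- (1 - eps n)) @[n --> \oo] --> ga ->
  leb.-integrable Icc (EFin \o h).
Proof.
move=> dg ch h0 cb ca.
have mh : measurable_fun Ioo h.
  apply: open_continuous_measurable_fun => // x; rewrite inE; exact: ch.
have mhc : measurable_fun Icc h.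
  apply/measurable_fun_itv_bndo_bndcP.
  by apply/measurable_fun_itv_obnd_cbndP.
have key : (\int[leb]_(x in Ioo) (h x)%:E)%E = (gb - ga)%:E.
  have h1 : (\int[leb]_(x in shrunk n) (h x)%:E)%E @[n --> \oo] -->
      (\int[leb]_(x in \bigcup_n shrunk n) (h x)%:E)%E.
    apply: ge0_nondecreasing_set_cvg_integral.
    - exact: shrunk_nd.
    - exact: measurable_shrunk.
    - by move=> i; apply/measurable_EFinP; apply: measurable_funS mh => //; exact: shrunk_sub.
    - by move=> i x xi; rewrite lee_fin; apply: h0; apply: (@shrunk_sub i).
  have h2 : (\int[leb]_(x in shrunk n) (h x)%:E)%E @[n --> \oo] --> (gb - ga)%:E.
    under eq_cvg do rewrite (FTC_shrunk g h _ dg ch) -EFinB.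
    by apply: cvg_EFin; [exact: nearW|apply: cvgB].
  by rewrite bigcup_shrunk in h1; exact: cvg_unique h1 h2.
apply/integrableP; split; first exact/measurable_EFinP.
rewrite -[X in (X < _)%E]/(\int[leb]_(x in Icc) (((fun y : R => `|y|) \o h) x)%:E)%E.
rewrite integral_cc_oo; last exact: measurableT_comp.
have -> : (\int[leb]_(x in Ioo) (((fun y : R => `|y|) \o h) x)%:E =
    \int[leb]_(x in Ioo) (h x)%:E)%E.
  by apply: eq_integral => x; rewrite inE => xi /=; rewrite ger0_norm // h0.
by rewrite /= key ltry.
Qed.

(** Here [h] may change sign, so dominated convergence replaces monotone convergence, with [|h|] as
    dominating function. *)
Lemma improper_FTC g h (ga gb : R) :
  (forall x : R, x \in `]-1, 1[ -> is_derive x 1 g (h x)) ->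
  (forall x : R, x \in `]-1, 1[ -> {for x, continuous h}) ->
  leb.-integrable Icc (EFin \o h) ->
  g (1 - eps n) @[n --> \oo] --> gb ->
  g (- (1 - eps n)) @[n --> \oo] --> ga ->
  \int[leb]_(x in Icc) h x = gb - ga.
Proof.
move=> dg ch ih cb ca.
have mh : measurable_fun Ioo h.
  apply: open_continuous_measurable_fun => // x; rewrite inE; exact: ch.
have iho : leb.-integrable Ioo (EFin \o h).
  by apply: integrableS ih => //; exact: subset_itv_oo_cc.
rewrite /Rintegral integral_cc_oo; last exact: mh.
have -> : (\int[leb]_(x in Ioo) (h x)%:E)%E = (gb - ga)%:E; last by [].
have h1 : (\int[leb]_(x in Ioo) ((EFin \o h) \_ (shrunk n)) x)%E
    @[n --> \oo] --> (\int[leb]_(x in Ioo) (h x)%:E)%E.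
  have [|||||_ _ hh] := @dominated_convergence _ _ R leb Ioo
    (measurable_itv _) (fun n => (EFin \o h) \_ (shrunk n)) (EFin \o h)
    (abse \o (EFin \o h)).
  - move=> n; apply/measurable_restrict ; [exact: measurable_shrunk|exact: measurable_itv|].
    apply/measurable_EFinP; apply: measurable_funS mh => //; exact: subIsetl.
  - exact/measurable_EFinP.
  - apply: aeW => x; rewrite -bigcup_shrunk => -[m _ xm].
    apply: cvg_near_cst; exists m => // n /= mn.
    rewrite patchE mem_set //.
    by have /subsetPset := shrunk_nd _ _ mn; exact.
  - exact: integrable_abse.
  - apply: aeW => x n _; rewrite patchE; case: ifP => _ //=.
    by rewrite normr0 lee_fin.
  exact: hh.
have h2 : (\int[leb]_(x in Ioo) ((EFin \o h) \_ (shrunk n)) x)%E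
    @[n --> \oo] --> (gb - ga)%:E.
  have e n : (\int[leb]_(x in Ioo) ((EFin \o h) \_ (shrunk n)) x)%E
     = (g (1 - eps n) - g (- (1 - eps n)))%:E.
    rewrite EFinB -(FTC_shrunk g h n) //.
    rewrite -integral_mkcondr (_ : Ioo `&` shrunk n = shrunk n) //.
    by apply/setIidPr; exact: shrunk_sub.
  under eq_cvg do rewrite e.
  by apply: cvg_EFin; [exact: nearW|apply: cvgB].
exact: cvg_unique h1 h2.
Qed.
End ImproperFTC.

Section JacobiWeight.
Variable R : realType.
Local Notation leb := (@lebesgue_measure R).
Local Notation Icc := (`[(-1 : R), (1 : R)]%classic : set R).
Local Notation jw := (@jacobi_weight R).
Implicit Types (a b x : R) (F : {poly R}).

Lemma is_derive_powR_onemr a x : x < 1 ->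
  is_derive x 1 (fun t : R => (1 - t) `^ a) (- (a * (1 - x) `^ (a - 1))).
Proof.
move=> x1.
have d := is_deriveB (is_derive_cst (1 : R) x 1) (is_derive_id x (1 : R)).
have x0 : 0 < 1 - x by lra.
have := @is_derive1_comp R (fun y => y `^ a) (cst 1 - id) x _ _ (is_derive1_powR a x0) d.
by rewrite sub0r mulrN1.
Qed.

Lemma is_derive_powR_oneDr b x : -1 < x ->
  is_derive x 1 (fun t : R => (1 + t) `^ b) (b * (1 + x) `^ (b - 1)).
Proof.
move=> x1.
have d := is_deriveD (is_derive_cst (1 : R) x 1) (is_derive_id x (1 : R)).
have x0 : 0 < 1 + x by lra.
have := @is_derive1_comp R (fun y => y `^ b) (cst 1 + id) x _ _ (is_derive1_powR b x0) d.
by rewrite add0r mulr1.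
Qed.

Lemma continuous_powR_onemr a x : x < 1 -> {for x, continuous (fun t : R => (1 - t) `^ a)}.
Proof.
move=> x1; have [h _] := is_derive_powR_onemr a x x1.
by apply: differentiable_continuous; apply/derivable1_diffP.
Qed.

Lemma continuous_powR_oneDr b x : -1 < x -> {for x, continuous (fun t : R => (1 + t) `^ b)}.
Proof.
move=> x1; have [h _] := is_derive_powR_oneDr b x x1.
by apply: differentiable_continuous; apply/derivable1_diffP.
Qed.

Lemma cvg_eps : eps R n @[n --> \oo] --> (0 : R).
Proof.
by have := @cvg_harmonic R; rewrite -cvg_shiftS.
Qed.

Lemma cvg_eps1 : 1 - eps R n @[n --> \oo] --> (1 : R).
Proof. by rewrite -[X in _ --> X]subr0; apply: cvgB cvg_eps; exact: cvg_cst. Qed.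

Lemma cvg_Neps1 : - (1 - eps R n) @[n --> \oo] --> (-1 : R).
Proof. exact: cvgN cvg_eps1. Qed.

Lemma cvg_eps_powR a : 0 < a -> (eps R n) `^ a @[n --> \oo] --> (0 : R).
Proof.
move=> a0.
have /cvg_at_rightP h := powR_cvg0 a0.
by apply: h; split; [exact: eps_gt0|exact: cvg_eps].
Qed.

Lemma integrable_powR_onemr a : -1 < a -> leb.-integrable Icc (EFin \o (fun t => (1 - t) `^ a)).
Proof.
move=> a1.
apply: (@ge0_improper_FTC R (fun t => - (a + 1)^-1 * (1 - t) `^ (a + 1)) _ (- (a + 1)^-1 * 2 `^ (a + 1)) (- (a + 1)^-1 * 0)).
- move=> x; rewrite in_itv /= => /andP[x1 x2].
  have := is_derive_powR_onemr (a + 1) x x2; rewrite addrK => d.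
  apply: is_derive_eq.
  by rewrite /GRing.scale /= mulNr mulrN opprK mulrA mulVf ?mul1r //; lra.
- by move=> x; rewrite in_itv /= => /andP[x1 x2]; exact: continuous_powR_onemr.
- by move=> x _; exact: powR_ge0.
- apply: cvgMl_tmp.
  under eq_cvg do rewrite opprB addrC subrK.
  by apply: cvg_eps_powR; lra.
- apply: cvgMl_tmp.
  have <- : 1 - -1 = 2 :> R by rewrite opprK.
  have hc : {for -1, continuous (fun t : R => (1 - t) `^ (a + 1))}.
    by apply: continuous_powR_onemr; lra.
  exact: (continuous_cvg _ hc cvg_Neps1).
Qed.

Lemma integrable_powR_oneDr b : -1 < b -> leb.-integrable Icc (EFin \o (fun t => (1 + t) `^ b)).
Proof.
move=> b1.
apply: (@ge0_improper_FTC R (fun t => (b + 1)^-1 * (1 + t) `^ (b + 1)) _ ((b + 1)^-1 * 0) ((b + 1)^-1 * 2 `^ (b + 1))).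
- move=> x; rewrite in_itv /= => /andP[x1 x2].
  have := is_derive_powR_oneDr (b + 1) x x1; rewrite addrK => d.
  apply: is_derive_eq.
  by rewrite /GRing.scale /= mulrA mulVf ?mul1r //; lra.
- by move=> x; rewrite in_itv /= => /andP[x1 x2]; exact: continuous_powR_oneDr.
- by move=> x _; exact: powR_ge0.
- apply: cvgMl_tmp.
  have hc : {for 1, continuous (fun t : R => (1 + t) `^ (b + 1))}.
    by apply: continuous_powR_oneDr; lra.
  exact: (continuous_cvg _ hc cvg_eps1).
- apply: cvgMl_tmp.
  under eq_cvg do rewrite opprB addrC subrK.
  by apply: cvg_eps_powR; lra.
Qed.

Lemma ler_powR_le2 a x : 1 <= x -> x <= 2 -> x `^ a <= 2 `^ `|a|.
Proof.
move=> x1 x2; apply: (@le_trans _ _ (x `^ `|a|)).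
  by apply: ler_powR => //; exact: ler_norm.
by apply: ge0_ler_powR; rewrite ?nnegrE //; lra.
Qed.

Lemma jacobi_weight_ge0 a b x : 0 <= jw a b x.
Proof. by rewrite mulr_ge0 ?powR_ge0. Qed.

Lemma measurable_jacobi_weight a b : measurable_fun [set: R] (jw a b).
Proof.
apply: measurable_funM.
  apply: (@measurableT_comp _ _ _ _ _ _ (fun y : R => y `^ a) _ (fun x => 1 - x)).
    exact: measurable_powR.
  exact: measurable_funB.
apply: (@measurableT_comp _ _ _ _ _ _ (fun y : R => y `^ b) _ (fun x => 1 + x)).
  exact: measurable_powR.
exact: measurable_funD.
Qed.

(** Each half of the interval contains one endpoint, and there the factor attached to the other
    endpoint has its base in [[1, 2]]. Hence the sum of two one-sided powers dominates the
    weight. *)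
Lemma integrable_jacobi_weight a b : -1 < a -> -1 < b ->
  leb.-integrable Icc (EFin \o jw a b).
Proof.
move=> a1 b1.
have mI : measurable Icc by exact: measurable_itv.
have ia := @integrableZl _ _ _ leb _ mI (2 `^ `|b|) _ (integrable_powR_onemr a a1).
have ib := @integrableZl _ _ _ leb _ mI (2 `^ `|a|) _ (integrable_powR_oneDr b b1).
have iab := @integrableD _ _ _ leb _ mI _ _ ia ib.
apply: (@le_integrable _ _ _ leb _ mI _ _ _ _ iab).
  apply/measurable_EFinP; apply: measurable_funS (measurable_jacobi_weight a b) => //.
move=> t /=; rewrite in_itv /= => /andP[t1 t2].
rewrite lee_fin (ger0_norm (jacobi_weight_ge0 a b t)) [leRHS]ger0_norm; last first.
  by rewrite addr_ge0 ?mulr_ge0 ?powR_ge0.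
have [t0|t0] := leP 0 t.
  rewrite /jw mulrC -[leLHS]addr0 lerD ?mulr_ge0 ?powR_ge0 // ler_wpM2r ?powR_ge0 //.
  by apply: ler_powR_le2; lra.
rewrite /jw -[leLHS]add0r lerD ?mulr_ge0 ?powR_ge0 // ler_wpM2r ?powR_ge0 //.
by apply: ler_powR_le2; lra.
Qed.

Lemma horner_le_sum F x : `|x| <= 1 -> `|F.[x]| <= \sum_(i < size F) `|F`_i|.
Proof.
move=> x1; rewrite horner_coef; apply: le_trans (ler_norm_sum _ _ _) _.
apply: ler_sum => i _; rewrite normrM normrX ler_piMr // exprn_ile1 //.
Qed.

Lemma integrable_poly_weight a b F : -1 < a -> -1 < b ->
  leb.-integrable Icc (EFin \o (fun x => F.[x] * jw a b x)).
Proof.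
move=> a1 b1.
have mI : measurable Icc by exact: measurable_itv.
have ia := @integrableZl _ _ _ leb _ mI (\sum_(i < size F) `|F`_i|) _
  (integrable_jacobi_weight a b a1 b1).
apply: (@le_integrable _ _ _ leb _ mI _ _ _ _ ia).
  apply/measurable_EFinP; apply: measurable_funM.
    by apply: measurable_funTS; apply: continuous_measurable_fun; exact: continuous_horner.
  by apply: measurable_funTS; exact: measurable_jacobi_weight.
move=> t /=; rewrite in_itv /= => /andP[t1 t2].
rewrite lee_fin !normrM ler_wpM2r //.
rewrite (le_trans (horner_le_sum F t _)) ?ler_norm // ler_norml; lra.
Qed.

End JacobiWeight.

Section WeightedIntegral.
Variable R : realType.
Local Notation leb := (@lebesgue_measure R).
Local Notation Icc := (`[(-1 : R), (1 : R)]%classic : set R).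
Local Notation jw := (@jacobi_weight R).
Implicit Types (a b x c : R) (F G : {poly R}).

Definition wint a b F : R := \int[leb]_(x in Icc) (F.[x] * jw a b x).

Lemma wintD a b F G : -1 < a -> -1 < b -> wint a b (F + G) = wint a b F + wint a b G.
Proof.
move=> a1 b1; rewrite /wint -RintegralD //; try exact: integrable_poly_weight.
by apply: eq_Rintegral => x _; rewrite hornerD mulrDl.
Qed.

Lemma wintZ a b c F : -1 < a -> -1 < b -> wint a b (c *: F) = c * wint a b F.
Proof.
move=> a1 b1; rewrite /wint -RintegralZl //; try exact: integrable_poly_weight.
by apply: eq_Rintegral => x _; rewrite hornerZ -mulrA.
Qed.

Lemma wintN a b F : -1 < a -> -1 < b -> wint a b (- F) = - wint a b F.
Proof. by move=> a1 b1; rewrite -scaleN1r wintZ // mulN1r. Qed.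

Lemma wintB a b F G : -1 < a -> -1 < b -> wint a b (F - G) = wint a b F - wint a b G.
Proof. by move=> a1 b1; rewrite wintD // wintN. Qed.

Lemma wint_sum a b (I : Type) (r : seq I) (P : pred I) (f : I -> {poly R}) :
  -1 < a -> -1 < b ->
  wint a b (\sum_(i <- r | P i) f i) = \sum_(i <- r | P i) wint a b (f i).
Proof.
move=> a1 b1; elim/big_rec2: _ => [|i y x _ <-]; last by rewrite wintD.
by rewrite -(scale0r 0) wintZ // mul0r.
Qed.

Lemma wint_ge0 a b F : (forall x, -1 <= x <= 1 -> 0 <= F.[x]) -> 0 <= wint a b F.
Proof.
move=> h; apply: Rintegral_ge0 => x; rewrite /= in_itv => /h h0.
by rewrite mulr_ge0 // jacobi_weight_ge0.
Qed.

Lemma wint_eq_weight a b a' b' F G :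
  (forall x, -1 <= x <= 1 -> F.[x] * jw a b x = G.[x] * jw a' b' x) ->
  wint a b F = wint a' b' G.
Proof.
move=> h; apply: eq_Rintegral => x; rewrite inE /= in_itv; exact: h.
Qed.

Lemma wint_le_weight a b a' b' F G : -1 < a -> -1 < b -> -1 < a' -> -1 < b' ->
  (forall x, -1 <= x <= 1 -> F.[x] * jw a b x <= G.[x] * jw a' b' x) ->
  wint a b F <= wint a' b' G.
Proof.
move=> a1 b1 a2 b2 h; apply: le_Rintegral => //; exact: integrable_poly_weight.
Qed.

(** Since [0] to the power [0] is [1], the condition [-1 < c] is what makes the identity hold at
    [x = 0]. *)
Lemma powRD1 c x : 0 <= x -> -1 < c -> x `^ (c + 1) = x * x `^ c.
Proof.
move=> x0 c1; have [->|x1] := eqVneq x 0.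
  by rewrite powR0 ?mul0r //; lra.
by rewrite powRD ?x1 ?implybT // powRr1 // mulrC.
Qed.

Lemma jacobi_weightSl a b x : x <= 1 -> -1 < a -> jw (a + 1) b x = (1 - x) * jw a b x.
Proof.
move=> x1 a1; rewrite /jacobi_weight (@powRD1 a (1 - x)) ?subr_ge0 //.
exact: esym (mulrA _ _ _).
Qed.

Lemma jacobi_weightSr a b x : -1 <= x -> -1 < b -> jw a (b + 1) x = (1 + x) * jw a b x.
Proof.
move=> x1 b1; rewrite /jacobi_weight (@powRD1 b (1 + x)) //; last by lra.
exact: mulrCA.
Qed.

Lemma wintSl a b F : -1 < a -> wint (a + 1) b F = wint a b ((1 - 'X) * F).
Proof.
move=> a1; apply: wint_eq_weight => x /andP[x1 x2].
by rewrite jacobi_weightSl // !hornerE /=; ring.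
Qed.

Lemma wintSr a b F : -1 < b -> wint a (b + 1) F = wint a b ((1 + 'X) * F).
Proof.
move=> a1; apply: wint_eq_weight => x /andP[x1 x2].
by rewrite jacobi_weightSr // !hornerE /=; ring.
Qed.

Lemma is_derive_horner F x : is_derive x 1 (horner F) F^`().[x].
Proof. by split; [exact: derivable_horner|rewrite -derive1E -derivE]. Qed.

Lemma is_derive_jacobi_weight a b x : -1 < a -> -1 < b -> -1 < x -> x < 1 ->
  is_derive x 1 (jw (a + 1) (b + 1))
    (((b + 1) * (1 - x) - (a + 1) * (1 + x)) * jw a b x).
Proof.
move=> a1 b1 x1 x2.
have da := is_derive_powR_onemr R (a + 1) x x2.
have db := is_derive_powR_oneDr R (b + 1) x x1.
have := is_deriveM da db.
rewrite /GRing.scale /= !addrK => d; apply: (is_derive_eq d).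
rewrite /jacobi_weight (@powRD1 a (1 - x)) ?(@powRD1 b (1 + x)); lra.
Qed.

Lemma continuous_jacobi_weight a b x : -1 < x -> x < 1 -> {for x, continuous (jw a b)}.
Proof.
move=> x1 x2.
exact: (cvgM (continuous_powR_onemr R a x x2) (continuous_powR_oneDr R b x x1)).
Qed.

(** Integrate the derivative of [F] times the weight of exponents [a + 1], [b + 1], which vanishes
    at both endpoints. All later moment relations come from this identity. *)
Lemma wint_parts a b F : -1 < a -> -1 < b ->
  wint a b ((1 - 'X) * (1 + 'X) * F^`()) =
    (a + 1) * wint a b ((1 + 'X) * F) - (b + 1) * wint a b ((1 - 'X) * F).
Proof.
move=> a1 b1; apply/eqP; rewrite -subr_eq0 -!wintZ // -!wintB //.
set H := _ - _; rewrite /wint.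
have dg x : x \in `]-1, 1[ ->
    is_derive x 1 (fun t => F.[t] * jw (a + 1) (b + 1) t) (H.[x] * jw a b x).
  rewrite in_itv /= => /andP[x1 x2].
  have := is_deriveM (is_derive_horner F x) (is_derive_jacobi_weight a b x a1 b1 x1 x2).
  move=> d; apply: (is_derive_eq d).
  rewrite /GRing.scale /= jacobi_weightSl ?jacobi_weightSr //; try lra.
  by move: (jw a b x) => w; rewrite /H !hornerE /=; ring.
rewrite (@improper_FTC R _ _ (F.[-1] * (2 `^ (a + 1) * 0)) (F.[1] * (0 * 2 `^ (b + 1))) dg).
- by rewrite mulr0 mul0r !mulr0 subrr.
- move=> x; rewrite in_itv /= => /andP[x1 x2].
  have c1 : horner H t @[t --> x] --> H.[x] by exact: continuous_horner.
  have c2 : jw a b t @[t --> x] --> jw a b x by exact: continuous_jacobi_weight.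
  by apply: cvgM c1 c2.
- exact: integrable_poly_weight.
- apply: cvgM; first by apply: continuous_cvg; [exact: continuous_horner|exact: cvg_eps1].
  apply: cvgM.
    by under eq_cvg do rewrite opprB addrC subrK; apply: cvg_eps_powR; lra.
  have hc : {for 1, continuous (fun t : R => (1 + t) `^ (b + 1))}.
    by apply: continuous_powR_oneDr; lra.
  exact: (continuous_cvg _ hc (cvg_eps1 R)).
- apply: cvgM; first by apply: continuous_cvg; [exact: continuous_horner|exact: cvg_Neps1].
  apply: cvgM.
    have <- : 1 - -1 = 2 :> R by rewrite opprK.
    have hc : {for -1, continuous (fun t : R => (1 - t) `^ (a + 1))}.
      by apply: continuous_powR_onemr; lra.
    exact: (continuous_cvg _ hc (cvg_Neps1 R)).
  by under eq_cvg do rewrite opprB addrC subrK; apply: cvg_eps_powR; lra.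
Qed.

Lemma EFin_wint a b F : -1 < a -> -1 < b ->
  ((wint a b F)%:E = \int[leb]_(x in Icc) (F.[x] * jw a b x)%:E)%E.
Proof.
move=> a1 b1; rewrite /wint /Rintegral fineK //.
by apply: integrable_fin_num => //; exact: integrable_poly_weight.
Qed.

Lemma powR_ge_half c y : 2^-1 <= y -> y <= 2 -> 2 `^ (- `|c|) <= y `^ c.
Proof.
move=> y1 y2; rewrite /powR !gt_eqF ?ler_expR //; last by lra.
have [c0|c0] := leP 0 c.
  rewrite ger0_norm // mulNr lerNl -mulrN ler_wpM2l // -lnV ?posrE; last by lra.
  by rewrite ler_ln ?posrE ?invr_gt0; [rewrite invf_ple ?posrE|..]; lra.
rewrite ltr0_norm // opprK ler_wnM2l //; first exact: ltW.
by rewrite ler_ln ?posrE; lra.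
Qed.

Lemma horner1 x : (1 : {poly R}).[x] = 1.
Proof. by rewrite hornerE. Qed.

Lemma wint_gt0 a b : -1 < a -> -1 < b -> 0 < wint a b 1.
Proof.
move=> a1 b1; rewrite -lte_fin EFin_wint //.
pose J : set R := `[(0 : R), 2^-1]%classic.
pose m : R := 2 `^ (- `|a|) * 2 `^ (- `|b|).
have m0 : 0 < m by rewrite mulr_gt0 // powR_gt0.
apply: (@lt_le_trans _ _ (\int[leb]_(x in J) m%:E)%E).
  rewrite integral_cst /=; last exact: measurable_itv.
  rewrite lebesgue_measure_itv /= lte_fin invr_gt0 ltr0n /= -EFinD -EFinM lte_fin.
  by rewrite mulr_gt0 //; lra.
apply: (@le_trans _ _ (\int[leb]_(x in J) ((1 : {poly R}).[x] * jw a b x)%:E)%E).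
  apply: ge0_le_integral => //=.
  - exact: measurable_itv.
  - by move=> x _; rewrite lee_fin ltW.
  - apply/measurable_EFinP; apply: measurable_funM.
      by apply: measurable_funTS; apply: continuous_measurable_fun; exact: continuous_horner.
    by apply: measurable_funTS; exact: measurable_jacobi_weight.
  - move=> x; rewrite /J /= in_itv /= lee_fin horner1 mul1r => /andP[x0 x1].
    by apply: ler_pM; rewrite ?powR_ge0 //; apply: powR_ge_half; lra.
apply: ge0_subset_integral => //=.
- exact: measurable_itv.
- apply/measurable_EFinP; apply: measurable_funM.
    by apply: measurable_funTS; apply: continuous_measurable_fun; exact: continuous_horner.
  by apply: measurable_funTS; exact: measurable_jacobi_weight.
- by move=> x _; rewrite lee_fin horner1 mul1r jacobi_weight_ge0.
- by move=> x; rewrite /J /= !in_itv /= => /andP[x0 x1]; apply/andP; split; lra.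
Qed.

End WeightedIntegral.

(** * Jacobi polynomials *)

Section JacobiODE.
Variable R : realType.
Local Notation wint := (@wint R).
Implicit Types (a b x c lam : R) (F G y f g q : {poly R}).

(** The Jacobi operator [(1 - x^2) y'' + (b - a - (a + b + 2) x) y'], which is the derivative of
    [(1 - x^2) w y'] divided by the weight [w]; the two first-order terms are kept apart to match
    [wint_parts]. *)
Definition jop a b y : {poly R} :=
  (1 - 'X) * (1 + 'X) * y^`()^`() + (b + 1)%:P * (1 - 'X) * y^`()
  - (a + 1)%:P * (1 + 'X) * y^`().

Definition jeig a b (l : nat) : R := l%:R * (l%:R + a + b + 1).

Lemma wintC a b c F : -1 < a -> -1 < b -> wint a b (c%:P * F) = c * wint a b F.
Proof. by move=> a1 b1; rewrite mul_polyC wintZ. Qed.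

(** This is [wint_parts] with [F = f' g]. The right side is symmetric in [f] and [g]; for [f = g] an
    eigenfunction, it relates the norms of [y'] and [y]. *)
Lemma wint_jop a b f g : -1 < a -> -1 < b ->
  wint a b (jop a b f * g) = - wint a b ((1 - 'X) * (1 + 'X) * (f^`() * g^`())).
Proof.
move=> a1 b1; have := wint_parts R a b (f^`() * g) a1 b1.
rewrite derivM mulrDr wintD // -!wintC // => h.
have -> : jop a b f * g = (1 - 'X) * (1 + 'X) * (f^`()^`() * g)
   + ((b + 1)%:P * ((1 - 'X) * (f^`() * g)) - (a + 1)%:P * ((1 + 'X) * (f^`() * g))).
  by rewrite /jop; ring.
rewrite wintD // wintB //; lra.
Qed.

Lemma jop_sym a b f g : -1 < a -> -1 < b ->
  wint a b (jop a b f * g) = wint a b (f * jop a b g).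
Proof.
move=> a1 b1; rewrite [f * _]mulrC !wint_jop //.
by rewrite [f^`() * _]mulrC.
Qed.

Lemma coef_jop a b y k : (size y <= k.+1)%N ->
  (jop a b y)`_k = - jeig a b k * y`_k.
Proof.
move=> sy.
have -> : jop a b y = y^`()^`() - 'X^2 * y^`()^`()
   + ((b - a)%:P * y^`() - (a + b + 2)%:P * ('X * y^`())).
  have -> : a + b + 2 = (a + 1) + (b + 1) by ring.
  by rewrite /jop polyCB !polyCD polyC1; ring.
have e1 : y`_k.+1 = 0 by rewrite nth_default.
have e2 : y`_k.+2 = 0 by rewrite nth_default // (leq_trans sy).
have cd q i : (q^`())`_i = i.+1%:R * q`_i.+1 by rewrite coef_deriv mulr_natl.
rewrite !(coefD, coefB, coefN, coefCM, coefXM, coefXnM, cd) /jeig.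
case: k {sy} e1 e2 => [|[|k]] e1 e2 /=; rewrite ?subn2 /= ?e1 ?e2.
- by ring.
- by ring.
- by rewrite -!natr1; ring.
Qed.

Lemma size_jop a b y k : (size y <= k.+1)%N -> (size (jop a b y) <= k.+1)%N.
Proof.
move=> sy; apply/leq_sizeP => m km.
by rewrite coef_jop ?nth_default ?mulr0 // (leq_trans sy) // ltnW.
Qed.

Lemma size_jop_eig a b y k : (size y <= k.+1)%N ->
  (size (jop a b y + (jeig a b k)%:P * y)%R <= k)%N.
Proof.
move=> sy; apply/leq_sizeP => m; rewrite leq_eqVlt => /predU1P[<-|km].
  by rewrite coefD coefCM coef_jop // mulNr addNr.
rewrite coefD coefCM coef_jop ?(leq_trans sy) 1?ltnW //.
by rewrite !nth_default ?mulr0 ?addr0 // (leq_trans sy).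
Qed.

Section Orthonormal.
Variables (a b : R) (P : nat -> {poly R}).
Hypotheses (a1 : -1 < a) (b1 : -1 < b).
Hypothesis sizeP : forall l, size (P l) = l.+1.
Hypothesis orthP : forall l m, wint a b (P l * P m) = (l == m)%:R.

Lemma size_elim q n : (size q <= n.+1)%N ->
  (size (q - (q`_n / (P n)`_n)%:P * P n)%R <= n)%N.
Proof.
move=> sq; apply/leq_sizeP => m; rewrite leq_eqVlt => /predU1P[<-|nm].
  rewrite coefB coefCM mulfVK ?subrr //.
  by have := lead_coef_eq0 (P n); rewrite lead_coefE sizeP -size_poly_eq0 sizeP => ->.
rewrite coefB coefCM [q`_m]nth_default ?(leq_trans sq) //.
by rewrite [(P n)`_m]nth_default ?sizeP // mulr0 subr0.
Qed.

Lemma orth_low q k : (size q <= k)%N -> wint a b (q * P k) = 0.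
Proof.
suff h n : (n <= k)%N -> (size q <= n)%N -> wint a b (q * P k) = 0 by exact: h.
elim: n q => [|n IH] q nk sq.
  by move: sq; rewrite leqn0 size_poly_eq0 => /eqP ->; rewrite mul0r -(scale0r 0) wintZ // mul0r.
have := IH _ (ltnW nk) (size_elim q n sq).
by rewrite mulrBl wintB // -mulrA wintC // orthP (ltn_eqF nk) mulr0 subr0.
Qed.

Lemma orth_eq0 q k : (size q <= k)%N -> (forall l, (l < k)%N -> wint a b (q * P l) = 0) -> q = 0.
Proof.
elim: k q => [|k IH] q sq h.
  by move: sq; rewrite leqn0 size_poly_eq0 => /eqP.
have sq' := size_elim q k sq.
have := orth_low _ k sq'.
rewrite mulrBl wintB // h // -mulrA wintC // orthP eqxx mulr1 sub0r => /eqP.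
rewrite oppr_eq0 => /eqP c0; move: sq'; rewrite c0 polyC0 mul0r subr0 => sq'.
by apply: IH => // l lk; apply: h; exact: ltnW.
Qed.

(** Adding the eigenvalue term cancels the coefficient of degree [k], so the remainder has lower
    degree. It is orthogonal to every [P l] with [l < k], because [jop] is symmetric and does not
    raise degrees; hence it is zero. *)
Lemma orth_ode k : jop a b (P k) = - ((jeig a b k)%:P * P k).
Proof.
apply/eqP; rewrite -addr_eq0; apply/eqP.
apply: (orth_eq0 _ k); first by apply: size_jop_eig; rewrite sizeP.
move=> l lk; rewrite mulrDl wintD // jop_sym // -mulrA wintC // orthP (gtn_eqF lk) mulr0 addr0.
rewrite mulrC orth_low //; have : (size (jop a b (P l)) <= l.+1)%N by apply: size_jop; rewrite sizeP.
by move=> h; exact: leq_trans h lk.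
Qed.

(** [(1 + x) (P k)' - k (P k)] has degree below [k], hence is orthogonal to [P k]. *)
Lemma orth_wint_deriv k : wint a b ((1 + 'X) * (P k * (P k)^`())) = k%:R.
Proof.
have h : (size ((1 + 'X) * (P k)^`() - k%:R%:P * P k)%R <= k)%N.
  apply/leq_sizeP => m km; rewrite coefB coefCM mulrDl mul1r coefD coefXM !coef_deriv.
  have y0 i : (k < i)%N -> (P k)`_i = 0 by move=> ki; rewrite nth_default // sizeP.
  rewrite (y0 m.+1) ?ltnS // mul0rn add0r.
  case: m km => [|m] km /=; first by move: km; rewrite leqn0 => /eqP ->; rewrite mul0r subr0.
  move: km; rewrite leq_eqVlt => /predU1P[->|km]; first by rewrite mulr_natl subrr.
  by rewrite y0 // mul0rn mulr0 subr0.
have := orth_low _ k h.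
rewrite mulrBl wintB // -mulrA -mulrA wintC // orthP eqxx mulr1 => /eqP.
by rewrite subr_eq0 => /eqP <-; congr wint; ring.
Qed.

End Orthonormal.
End JacobiODE.

(** * Norms of Jacobi polynomials relative to their value at 1 *)

Section Norm.
Variable R : realType.
Local Notation wint := (@wint R).
Implicit Types (a b x c lam : R) (F G y f g q : {poly R}).

Definition poch x n : R := \prod_(i < n) (x + i%:R).

Lemma pochSr x n : poch x n.+1 = poch x n * (x + n%:R).
Proof. by rewrite /poch big_ord_recr. Qed.

Lemma pochSl x n : poch x n.+1 = x * poch (x + 1) n.
Proof.
rewrite /poch big_ord_recl addr0; congr (_ * _); apply: eq_bigr => i _.
by rewrite lift0 -natr1; ring.
Qed.

Lemma poch_gt0 x n : 0 < x -> 0 < poch x n.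
Proof. by move=> x0; apply: prodr_gt0 => i _; rewrite ltr_wpDr. Qed.

(* For the Jacobi polynomial [y] of degree [n], [jnorm a b n] is the integral
   of [(y / y(1))^2], see [wint_sqr_jnorm]. *)
Definition jnorm a b n : R :=
  wint a b 1 * (poch (b + 1) n * poch 1 n / (poch (a + 1) n * poch (a + b + 2) n)) *
  ((a + b + 1 + n%:R) / (a + b + 1 + n%:R *+ 2)).

(** With a constant [F], [wint_parts] says that the integrals of [1 + x] and [1 - x] are in the
    ratio [b + 1] to [a + 1]; their sum is twice the total mass. *)
Lemma wint_oneSl a b : -1 < a -> -1 < b ->
  wint (a + 1) b 1 = 2 * (a + 1) / (a + b + 2) * wint a b 1.
Proof.
move=> a1 b1; rewrite wintSl //.
have := wint_parts R a b 1 a1 b1; rewrite derivC mulr0 !mulr1.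
have -> : wint a b 0 = 0 by rewrite -(scale0r 0) wintZ // mul0r.
rewrite wintD // wintB // => h.
rewrite mulrAC; apply: (canRL (mulfK _)); first by apply/eqP; lra.
lra.
Qed.

Lemma wint_oneSr a b : -1 < a -> -1 < b ->
  wint a (b + 1) 1 = 2 * (b + 1) / (a + b + 2) * wint a b 1.
Proof.
move=> a1 b1; rewrite wintSr //.
have := wint_parts R a b 1 a1 b1; rewrite derivC mulr0 !mulr1.
have -> : wint a b 0 = 0 by rewrite -(scale0r 0) wintZ // mul0r.
rewrite wintD // wintB // => h.
rewrite mulrAC; apply: (canRL (mulfK _)); first by apply/eqP; lra.
lra.
Qed.

Lemma wint_oneSS a b : -1 < a -> -1 < b ->
  wint (a + 1) (b + 1) 1 = 4 * (a + 1) * (b + 1) / ((a + b + 2) * (a + b + 3)) * wint a b 1.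
Proof.
move=> a1 b1; rewrite wint_oneSl ?wint_oneSr //; last by lra.
field; apply/andP; split; apply/eqP; lra.
Qed.

(** The recursion that matches the passage from [y] to [y'] in [wint_sqr_jnorm]: the eigenvalue
    comes from the integral, the square of [2 (a + 1)] from the value at 1. *)
Lemma jnormS a b n : -1 < a -> -1 < b -> 0 < a + b + 1 ->
  jnorm a b n.+1 = jeig R a b n.+1 / (4 * (a + 1) ^+ 2) * jnorm (a + 1) (b + 1) n.
Proof.
move=> a1 b1 ab; rewrite /jnorm wint_oneSS // !(pochSl _ n) (_ : poch (1 + 1) n = poch 1 n * (1 + n%:R)); last first.
  by rewrite -pochSr pochSl mul1r.
have pa : 0 < poch (a + 1 + 1) n by apply: poch_gt0; lra.
have pb : 0 < poch (b + 1 + 1) n by apply: poch_gt0; lra.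
have ps1 : 0 < poch (a + b + 2 + 1) n by apply: poch_gt0; lra.
have ps2 : 0 < poch (a + 1 + (b + 1) + 2) n by apply: poch_gt0; lra.
have rel : (a + b + 3) * poch (a + 1 + (b + 1) + 2) n = poch (a + b + 2 + 1) n * (a + b + 3 + n%:R).
  have -> : a + b + 2 + 1 = a + b + 3 by ring.
  by rewrite -pochSr pochSl; congr (_ * poch _ _); ring.
have n0 : 0 <= n%:R :> R by [].
rewrite /jeig -natr1.
have -> : poch (a + b + 2 + 1) n = (a + b + 3) * poch (a + 1 + (b + 1) + 2) n / (a + b + 3 + n%:R).
  by rewrite rel mulfK //; apply/eqP; lra.
field.
do !(apply/andP; split); apply/eqP; lra.
Qed.

Lemma jop_deriv a b y n : jop R a b y = - ((jeig R a b n.+1)%:P * y) ->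
  jop R (a + 1) (b + 1) y^`() = - ((jeig R (a + 1) (b + 1) n)%:P * y^`()).
Proof.
move=> /(congr1 (@deriv R)).
rewrite derivN derivM derivC mul0r add0r /jop.
have d1 : ('X : {poly R})^`() = 1 by exact: derivX.
have d2 : (1 : {poly R})^`() = 0 by exact: derivC.
rewrite !(derivD, derivN, derivM, derivC) d1.
have -> : jeig R (a + 1) (b + 1) n = jeig R a b n.+1 - ((a + 1) + (b + 1)).
  by rewrite /jeig -natr1; ring.
rewrite polyCB !polyCD polyC1.
move: (jeig R a b n.+1)%:P a%:P b%:P => L A B h.
transitivity (- (L * y^`()) + (A + 1 + (B + 1)) * y^`()); last by ring.
by rewrite -h; ring.
Qed.

(** At 1 the coefficients of [y''] and of the [b] term vanish, so the equation ties [y'(1)] to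
    [y(1)]. *)
Lemma deriv_at1 a b y n : -1 < a -> jop R a b y = - ((jeig R a b n)%:P * y) ->
  y^`().[1] = jeig R a b n / (2 * (a + 1)) * y.[1].
Proof.
move=> a1 /(congr1 (fun p => p.[1])); rewrite /jop !hornerE /= => h.
rewrite mulrAC; apply: (canRL (mulfK _)); first by apply/eqP; lra.
lra.
Qed.

(** Induction along derivatives, which avoids any closed form of the polynomials: [y'] solves the
    equation with both exponents raised and the degree lowered by one, [wint_jop] relates the two
    integrals of squares, and [deriv_at1] the two values at 1. The condition [0 < a + b + 1] keeps
    the eigenvalues nonzero. *)
Lemma wint_sqr_jnorm a b n y : -1 < a -> -1 < b -> 0 < a + b + 1 ->
  (size y <= n.+1)%N -> jop R a b y = - ((jeig R a b n)%:P * y) ->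
  wint a b (y * y) = y.[1] ^+ 2 * jnorm a b n.
Proof.
elim: n a b y => [|n IH] a b y a1 b1 ab sy ode.
  rewrite (size1_polyC sy) -polyCM hornerC -[_%:P]mulr1 wintC //.
  rewrite /jnorm /poch !big_ord0 mulr0n mul0rn !addr0 !mulr1 !divff ?oner_eq0 //.
    by rewrite !mulr1 expr2.
  by apply/eqP; lra.
have lam0 : jeig R a b n.+1 != 0.
  rewrite /jeig mulf_eq0 pnatr_eq0 /=; apply/eqP.
  by have n0 : 0 <= n.+1%:R :> R := ler0n _ _; lra.
have h : wint (a + 1) (b + 1) (y^`() * y^`()) = jeig R a b n.+1 * wint a b (y * y).
  rewrite wintSl ?wintSr; try lra.
  have := wint_jop R a b y y a1 b1; rewrite ode mulNr wintN // -[_ * y * y]mulrA wintC //.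
  by move=> /oppr_inj ->; congr wint; ring.
have := IH (a + 1) (b + 1) y^`(); rewrite h.
rewrite (deriv_at1 a b y n.+1) // => {}h.
have sy' : (size y^`() <= n.+1)%N.
  apply/leq_sizeP => m nm; rewrite coef_deriv nth_default ?mul0rn //.
  exact: leq_trans sy _.
have a2 : -1 < a + 1 by lra.
have b2 : -1 < b + 1 by lra.
have ab2 : 0 < a + 1 + (b + 1) + 1 by lra.
apply: (mulfI lam0); rewrite (h a2 b2 ab2 sy' (jop_deriv _ _ _ _ ode)).
by rewrite jnormS //; field; apply/eqP; lra.
Qed.

End Norm.

(** * Second moments of Jacobi polynomials under lowered weights *)

Section Moments.
Variable R : realType.
Local Notation wint := (@wint R).
Implicit Types (a b x c lam tau : R) (F G y f g q : {poly R}).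

(* Expand the integral of [(1 + t) ((1 - t) y' - (a / 2) y)^2 >= 0] against the
   weight [(a - 1, b)] and eliminate [y'] with the differential equation. *)
Lemma jacobi_hardy a b tau lam y : 0 < a -> -1 < b ->
  jop R (a + tau) b y = - (lam%:P * y) ->
  (a ^+ 2 / 4 + tau * a / 2) * wint (a - 1) (b + 1) (y * y) <=
  (lam + (tau + a) * (b + 1) / 2) * wint a b (y * y).
Proof.
move=> a0 b1 ode.
have a1 : -1 < a - 1 by lra.
have -> : wint a b (y * y) = wint (a - 1) b ((1 - 'X) * (y * y)).
  by rewrite -wintSl // subrK.
rewrite wintSr //.
set L := wint (a - 1) b.
set X := L _; set Y := L _.
pose T := L ((1 - 'X) * (1 + 'X) * (y * y^`())).
pose A := L ((1 - 'X) * (1 - 'X) * (1 + 'X) * (y^`() * y^`())).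
have e1 : 2 * T = a * X - (b + 1) * Y.
  have := wint_parts R (a - 1) b (y * y) a1 b1; rewrite subrK -/L => <-.
  by rewrite /T -wintC //; congr (L _); rewrite derivM; ring.
have e2 : A + tau * T = lam * Y.
  have := wint_parts R (a - 1) b ((1 - 'X) * (y * y^`())) a1 b1; rewrite subrK -/L.
  have -> : (1 - 'X) * (1 + 'X) * ((1 - 'X) * (y * y^`()))^`() =
     (1 - 'X) * (1 - 'X) * (1 + 'X) * (y^`() * y^`())
     + ((- 1)%:P * ((1 - 'X) * (1 + 'X) * (y * y^`()))
     + (1 - 'X) * y * ((1 - 'X) * (1 + 'X) * y^`()^`())).
    by rewrite !derivM derivB derivX derivC polyCN; ring.
  have -> : (1 - 'X) * (1 + 'X) * y^`()^`() = - (lam%:P * y)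
      - (b + 1)%:P * (1 - 'X) * y^`() + (a + tau + 1)%:P * (1 + 'X) * y^`().
    by rewrite -ode /jop; ring.
  rewrite -!(wintC, wintB, wintD, wintN) // => h.
  have : L ((1 - 'X) * (1 - 'X) * (1 + 'X) * (y^`() * y^`())
     + tau%:P * ((1 - 'X) * (1 + 'X) * (y * y^`())) - lam%:P * ((1 - 'X) * (y * y))) = 0.
    move/eqP: h; rewrite -subr_eq0 -wintB // => /eqP h.
    by rewrite /L -h; congr wint; rewrite !polyCD; ring.
  by rewrite {1}/L wintB // wintD // !wintC // => /eqP; rewrite subr_eq0 => /eqP.
have e3 : 0 <= A - a * T + a ^+ 2 / 4 * X.
  have -> : A - a * T + a ^+ 2 / 4 * X =
     L ((1 + 'X) * (((1 - 'X) * y^`() - (a / 2)%:P * y) * ((1 - 'X) * y^`() - (a / 2)%:P * y))).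
    rewrite /A /T /X -!wintC // -wintB // -wintD //; congr (L _).
    have -> : a%:P = (a / 2)%:P + (a / 2)%:P by rewrite -polyCD; congr polyC; field.
    have -> : (a ^+ 2 / 4)%:P = (a / 2)%:P * (a / 2)%:P by rewrite -polyCM; congr polyC; field.
    by ring.
  apply: wint_ge0 => x /andP[x1 x2]; rewrite hornerM mulr_ge0 //.
    by rewrite !hornerE /=; lra.
  by rewrite hornerM -expr2 sqr_ge0.
nra.
Qed.

Section Iterate.
Variables (al b lam E : R) (y : {poly R}) (J : nat).
Hypotheses (J0 : J%:R < al) (b1 : -1 < b) (E1 : 1 <= E).
Hypothesis ode : jop R al b y = - (lam%:P * y).
Hypothesis HE : lam + al * (b + 1) / 2 <= (al - J%:R) ^+ 2 / 4 * E.

(** The polynomial solves the equation with exponent [al] throughout, while the weight loses [j]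
    powers of [1 - t]; in [X j] one further power has moved from [1 - t] to [1 + t]. *)
Let Y j := wint (al - j%:R) b (y * y).
Let X j := wint (al - j%:R - 1) (b + 1) (y * y).

Lemma sqr_wint_ge0 a c : 0 <= wint a c (y * y).
Proof. by apply: wint_ge0 => x _; rewrite hornerM -expr2 sqr_ge0. Qed.

(** [jacobi_hardy] with [tau = j], whose nonnegative [tau] term on the left is dropped. Since
    [tau + a = al], the right-hand constant does not depend on [j], and [HE] at the last index [J]
    is the most demanding case. *)
Lemma moment_step j : (j <= J)%N -> X j <= E * Y j.
Proof.
move=> jJ.
have jJ' : j%:R <= J%:R :> R by rewrite ler_nat.
have a0 : 0 < al - j%:R by have J0' := J0; lra.
have j0 : 0 <= j%:R :> R by [].
have := @jacobi_hardy (al - j%:R) b j%:R lam y a0 b1.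
rewrite subrK => /(_ ode); rewrite -/(X j) -/(Y j) => h.
have X0 : 0 <= X j by exact: sqr_wint_ge0.
have Y0 : 0 <= Y j by exact: sqr_wint_ge0.
have q : (al - J%:R) ^+ 2 <= (al - j%:R) ^+ 2.
  have J0' := J0; rewrite ler_sqr ?nnegrE; lra.
have p0 : 0 < (al - j%:R) ^+ 2 / 4 :> R by rewrite divr_gt0 // exprn_gt0.
rewrite -(ler_pM2l p0).
apply: (@le_trans _ _ (((al - j%:R) ^+ 2 / 4 + j%:R * (al - j%:R) / 2) * X j)).
  by rewrite ler_wpM2r // lerDl !mulr_ge0 // ltW.
apply: le_trans h _.
rewrite mulrA ler_wpM2r //.
have -> : j%:R + (al - j%:R) = al by ring.
apply: le_trans HE _; rewrite ler_wpM2r //; first by have E1' := E1; lra.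
by rewrite ler_wpM2r // invr_ge0.
Qed.

Lemma moment_half j : (j <= J)%N -> Y j.+1 = (X j + Y j) / 2.
Proof.
move=> jJ.
have jJ' : j%:R <= J%:R :> R by rewrite ler_nat.
have a1 : -1 < al - j%:R - 1 by have J0' := J0; lra.
rewrite /X /Y -natr1 opprD addrA.
rewrite -[in wint (al - j%:R) b _](subrK 1 (al - j%:R)) wintSl // wintSr //.
rewrite -wintD // -mulrDl.
have -> : (1 + 'X + (1 - 'X)) * (y * y) = 2%:P * (y * y) by rewrite -[2]/(1 + 1) polyCD polyC1; ring.
by rewrite wintC //; field.
Qed.

(** By [moment_half], [Y j.+1] is the mean of [X j] and [Y j]. As [E >= 1], lowering the exponent by
    one costs at most a factor [E]. *)
Lemma moment_bound j : (j <= J)%N -> X j <= E ^+ j * (X 0 + Y 0).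
Proof.
have X0 i : 0 <= X i by exact: sqr_wint_ge0.
have Y0 i : 0 <= Y i by exact: sqr_wint_ge0.
have E0 : 0 <= E := le_trans ler01 E1.
have h i : (i <= J)%N -> Y i.+1 <= E ^+ i * (X 0 + Y 0).
  elim: i => [|i IH] iJ.
    by rewrite moment_half // expr0 mul1r; have := X0 0%N; have := Y0 0%N; lra.
  rewrite moment_half //; have s1 := moment_step _ iJ.
  have s2 := IH (ltnW iJ).
  have : Y i.+1 <= E * Y i.+1 by rewrite ler_peMl.
  have : E * Y i.+1 <= E ^+ i.+1 * (X 0 + Y 0) by rewrite exprS -mulrA ler_wpM2l.
  lra.
case: j => [|j] jJ; first by rewrite expr0 mul1r lerDl.
apply: (le_trans (moment_step _ jJ)).
by rewrite exprS -mulrA ler_wpM2l // h // ltnW.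
Qed.

End Iterate.

(** The starting value [X 0] of the iteration is explicit: [wint_parts] expresses it through the
    normalization and [orth_wint_deriv]. *)
Lemma first_moment a b (P : nat -> {poly R}) k : 0 < a -> -1 < b ->
  (forall l, size (P l) = l.+1) ->
  (forall l m, wint a b (P l * P m) = (l == m)%:R) ->
  wint (a - 1) (b + 1) (P k * P k) = (2 * k%:R + b + 1) / a.
Proof.
move=> a0 b1 sP oP.
have a1 : -1 < a by lra.
have a2 : -1 < a - 1 by lra.
have h0 := orth_wint_deriv R a b P a1 b1 sP oP k.
have h := wint_parts R (a - 1) b (P k * P k) a2 b1.
have e1 : wint (a - 1) b ((1 - 'X) * (P k * P k)) = 1.
  by rewrite -wintSl // subrK oP eqxx.
have e2 : wint (a - 1) b ((1 - 'X) * (1 + 'X) * (P k * P k)^`()) = 2 * k%:R.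
  rewrite -h0 -mulrA -wintSl // subrK -wintC //; congr wint.
  by rewrite derivM -[2]/(1 + 1) polyCD polyC1; ring.
apply: (canRL (mulfK _)); first by apply/eqP; lra.
by rewrite wintSr //; move: h; rewrite e1 e2 subrK; lra.
Qed.

(** With [v = m u], after division by [u^e], this reads [1 <= v^r + v^(r - j)]: the first term
    suffices for [v >= 1], the second for [v < 1] because [r <= j]. It is needed since the Hardy
    steps remove only whole powers, whereas [r] is real. *)
Lemma powR_interp (u m e r : R) (j : nat) : 0 <= u -> 0 < m -> 0 < e -> 0 <= r -> r <= j%:R ->
  u `^ e <= m `^ r * (u `^ (e + r) + m ^- j * u `^ (e + r - j%:R)).
Proof.
move=> u0 m0 e0 r0 rj.
have [->|un0] := eqVneq u 0.
  by rewrite powR0 ?mulr_ge0 ?addr_ge0 ?mulr_ge0 ?powR_ge0 ?invr_ge0 ?exprn_ge0 ?ltW //; lra.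
have up : 0 < u by rewrite lt_neqAle eq_sym un0.
have -> : u `^ (e + r) = u `^ e * u `^ r by rewrite powRD // un0 implybT.
have -> : u `^ (e + r - j%:R) = u `^ e * u `^ r * u ^- j.
  by rewrite powRB ?un0 ?implybT // powRD ?un0 ?implybT // powR_mulrn.
have -> : m `^ r * (u `^ e * u `^ r + m ^- j * (u `^ e * u `^ r * u ^- j)) =
   u `^ e * ((m * u) `^ r * (1 + (m * u) ^- j)).
  by rewrite powRM // ?ltW // exprMn invfM; ring.
rewrite ler_peMr ?powR_ge0 //.
set v := m * u; have v0 : 0 < v by rewrite mulr_gt0.
have [v1|v1] := leP 1 v.
  apply: (@le_trans _ _ (v `^ r)); first by rewrite -(powRr0 v); exact: ler_powR.
  by rewrite ler_peMr ?powR_ge0 // lerDl invr_ge0 exprn_ge0 // ltW.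
apply: (@le_trans _ _ (v `^ r * v ^- j)); last by rewrite ler_wpM2l ?powR_ge0 // lerDr.
rewrite ler_pdivlMr ?exprn_gt0 // mul1r -powR_mulrn ?(ltW v0) //.
by apply: (@ger_powR R v) => //; rewrite v0 ltW.
Qed.

End Moments.

Local Ltac nonzero := repeat (apply/andP; split); apply: lt0r_neq0; lra.
Local Ltac positive := repeat first [assumption | apply: mulr_gt0 | rewrite invr_gt0]; lra.

(** * Bounds uniform in the dimension *)

Section Ratio.
Variable R : realType.
Local Notation wint := (@wint R).
Local Notation poch := (@poch R).
Local Notation jnorm := (@jnorm R).
Implicit Types (a b x y c r d n : R).

(** The left side is [1 - r / (y + r) <= exp (- r / (y + r))], and [1 + z <= exp z] with
    [z = 1 / (y + r)] compares this with the right side. In this form the bounds telescope in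
    [pochratio]. *)
Lemma pochratio_step y r : 0 < y -> 0 <= r ->
  y / (y + r) <= ((y + r) / (y + r + 1)) `^ r.
Proof.
move=> y0 r0; have yr0 : 0 < y + r by lra.
apply: (@le_trans _ _ (expR (- (r / (y + r))))).
  have -> : y / (y + r) = 1 + - (r / (y + r)) by field; nonzero.
  exact: expR_ge1Dx.
have -> : (y + r) / (y + r + 1) = (1 + (y + r)^-1)^-1.
  by field; nonzero.
have z0 : 0 < (y + r)^-1 by rewrite invr_gt0.
rewrite -[(1 + _)^-1]powR_inv1; last by lra.
rewrite -powRrM mulN1r powRN expRN lef_pV2 ?posrE ?expR_gt0 ?powR_gt0 //; last by lra.
rewrite /powR gt_eqF; last by lra.
rewrite ler_expR ler_wpM2l // -ler_expR lnK ?posrE; last by lra.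
exact: expR_ge1Dx.
Qed.

Lemma pochratio x r k : 0 < x -> 0 <= r ->
  poch x k / poch (x + r) k <= ((x + r) / (x + r + k%:R)) `^ r.
Proof.
move=> x0 r0; elim: k => [|k IH].
  by rewrite /poch !big_ord0 addr0 !divff ?oner_eq0 ?powR1 //; apply/eqP; lra.
have k0 : 0 <= k%:R :> R by [].
have p1 : 0 < poch (x + r) k by apply: poch_gt0; lra.
have -> : poch x k.+1 / poch (x + r) k.+1 = poch x k / poch (x + r) k * ((x + k%:R) / (x + k%:R + r)).
  rewrite !pochSr; field; nonzero.
have -> : (x + r) / (x + r + k.+1%:R) = (x + r) / (x + r + k%:R) * ((x + k%:R + r) / (x + k%:R + r + 1)).
  by rewrite -natr1; field; nonzero.
rewrite powRM; [|by rewrite divr_ge0; lra|by rewrite divr_ge0; lra].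
apply: ler_pM => //.
- by rewrite divr_ge0 // ltW // poch_gt0.
- by rewrite divr_ge0; lra.
- by apply: pochratio_step; lra.
Qed.

(** The hockey-stick identity for rising factorials. *)
Lemma sum_pochratio d L : 0 < d ->
  \sum_(l < L.+1) poch d l / poch 1 l = poch (d + 1) L / poch 1 L.
Proof.
move=> d0; elim: L => [|L IH].
  by rewrite big_ord_recl big_ord0 /poch !big_ord0 addr0.
rewrite big_ord_recr IH /= pochSl !pochSr.
have p1 : 0 < poch 1 L by exact: poch_gt0.
have k0 : 0 <= L%:R :> R by [].
field; nonzero.
Qed.

(** Each extra factor is at most [1 + d / k <= exp (d / k)]. The kernel sum runs past [k = d n] by
    [m <= 2 n] indices, so the total cost is at most [exp 2]. *)
Lemma pochratio_growth d (k m : nat) : 0 < d -> (0 < k)%N ->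
  poch (d + 1) (k + m) / poch 1 (k + m) <=
  poch (d + 1) k / poch 1 k * expR (d * m%:R / k%:R).
Proof.
move=> d0 k0; elim: m => [|m IH].
  by rewrite addn0 mulr0 mul0r expR0 mulr1.
rewrite addnS !pochSr.
have kr : 0 < k%:R :> R by rewrite ltr0n.
have m0 : 0 <= m%:R :> R by [].
have kmE : (k + m)%:R = k%:R + m%:R :> R by rewrite natrD.
have p1 : 0 < poch 1 (k + m) by exact: poch_gt0.
have -> : poch (d + 1) (k + m) * (d + 1 + (k + m)%:R) / (poch 1 (k + m) * (1 + (k + m)%:R)) =
  poch (d + 1) (k + m) / poch 1 (k + m) * (1 + d / (1 + (k + m)%:R)).
  by field; nonzero.
have -> : d * m.+1%:R / k%:R = d * m%:R / k%:R + d / k%:R.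
  by rewrite -natr1; field; nonzero.
rewrite expRD mulrA; apply: ler_pM => //.
- by rewrite divr_ge0 // ltW // poch_gt0 //; lra.
- by rewrite addr_ge0 // divr_ge0; lra.
apply: le_trans (expR_ge1Dx _); rewrite lerD2l ler_wpM2l ?(ltW d0) //.
by rewrite lef_pV2 ?posrE; lra.
Qed.

Lemma sum_jnorm_inv (d : R) (k m : nat) : 1 < d -> (0 < k)%N -> d * m%:R <= 2 * k%:R ->
  \sum_(l < (k + m).+1) (jnorm (d / 2 - 1) (d / 2 - 1) l)^-1 <=
  2 * expR 2 / wint (d / 2 - 1) (d / 2 - 1) 1 * (poch d k / poch 1 k) * ((d + k%:R) / d).
Proof.
move=> d1 k0 dm.
have kr : 0 < k%:R :> R by rewrite ltr0n.
set a := d / 2 - 1; have a1 : -1 < a by rewrite /a; lra.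
set Z := wint a a 1; have Z0 : 0 < Z by exact: wint_gt0.
apply: (@le_trans _ _ (\sum_(l < (k + m).+1) 2 / Z * (poch d l / poch 1 l))).
  apply: ler_sum => l _.
  have l0 : 0 <= l%:R :> R by [].
  have p1 : 0 < poch 1 l by exact: poch_gt0.
  have pd : 0 < poch d l by apply: poch_gt0; lra.
  have pa : 0 < poch (a + 1) l by apply: poch_gt0; lra.
  rewrite /jnorm -/Z.
  have -> : a + a + 2 = d by rewrite /a; field.
  have -> : a + a + 1 = d - 1 by rewrite /a; field.
  have -> : (Z * (poch (a + 1) l * poch 1 l / (poch (a + 1) l * poch d l)) *
      ((d - 1 + l%:R) / (d - 1 + l%:R *+ 2)))^-1 =
      1 / Z * (poch d l / poch 1 l) * ((d - 1 + l%:R *+ 2) / (d - 1 + l%:R)).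
    field; nonzero.
  have -> : 2 / Z * (poch d l / poch 1 l) = 1 / Z * (poch d l / poch 1 l) * 2.
    by field; nonzero.
  have c0 : 0 <= 1 / Z * (poch d l / poch 1 l) by rewrite mulr_ge0 // divr_ge0 // ltW.
  by rewrite ler_wpM2l // ler_pdivrMr; lra.
rewrite -mulr_sumr sum_pochratio; last by lra.
have -> : 2 * expR 2 / Z * (poch d k / poch 1 k) * ((d + k%:R) / d) =
   2 / Z * (poch (d + 1) k / poch 1 k * expR 2).
  have p1 : 0 < poch 1 k by exact: poch_gt0.
  have -> : poch (d + 1) k = poch d k * (d + k%:R) / d.
    by rewrite -pochSr pochSl mulrC mulKf //; apply/eqP; lra.
  by field; nonzero.
rewrite ler_wpM2l ?divr_ge0 // ?(ltW Z0) //.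
apply: le_trans (pochratio_growth _ _ _ _ k0) _; first by lra.
apply: ler_wpM2l; last by rewrite ler_expR ler_pdivrMr.
by rewrite divr_ge0 // ltW // poch_gt0 //; lra.
Qed.

(** The bound [1 - x <= 2] removes [r + 1] powers at a cost of [2^(r + 1)]; restoring one power of
    [1 + x] costs [(d - 1) / (d - 2) <= 2]. *)
Lemma weight_ratio d r : 3 <= d -> 0 <= r ->
  wint (d / 2 + r) (d / 2 - 2) 1 <= 2 `^ (r + 2) * wint (d / 2 - 1) (d / 2 - 1) 1.
Proof.
move=> d3 r0.
apply: (@le_trans _ _ (2 `^ (r + 1) * wint (d / 2 - 1) (d / 2 - 2) 1)).
  rewrite -wintC; [|lra|lra].
  apply: wint_le_weight; try lra.
  move=> x /andP[x1 x2]; rewrite hornerM !hornerC mulr1 mul1r.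
  rewrite /jacobi_weight mulrA ler_wpM2r ?powR_ge0 //.
  have -> : d / 2 + r = (r + 1) + (d / 2 - 1) by ring.
  rewrite powRD; last by apply/implyP => /eqP; lra.
  rewrite ler_wpM2r ?powR_ge0 //.
  by apply: ge0_ler_powR; rewrite ?nnegrE; lra.
have -> : wint (d / 2 - 1) (d / 2 - 1) 1 = (d - 2) / (d - 1) * wint (d / 2 - 1) (d / 2 - 2) 1.
  have e : d / 2 - 1 = (d / 2 - 2) + 1 by ring.
  rewrite [X in wint _ X _ = _]e wint_oneSr; [|lra|lra].
  by congr (_ * _); field; nonzero.
set W := wint _ _ 1; have W0 : 0 < W by apply: wint_gt0; lra.
have -> : 2 `^ (r + 2) = 2 `^ (r + 1) * 2 :> R.
  have -> : r + 2 = r + 1 + 1 by ring.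
  by rewrite [LHS]powRD ?powRr1 //; apply/implyP => /eqP; lra.
rewrite -mulrA ler_wpM2l ?powR_ge0 // mulrA ler_peMl ?(ltW W0) //.
by rewrite mulrA ler_pdivlMr; lra.
Qed.

Lemma ler_pM4 (c x1 y1 x2 y2 x3 y3 x4 y4 : R) :
  0 <= c -> 0 <= x1 -> 0 <= x2 -> 0 <= x3 -> 0 <= x4 ->
  x1 <= y1 -> x2 <= y2 -> x3 <= y3 -> x4 <= y4 ->
  c * x1 * x2 * (x3 * x4) <= c * y1 * y2 * (y3 * y4) :> R.
Proof.
move=> c0 p1 p2 p3 p4 h1 h2 h3 h4.
apply: ler_pM (mulr_ge0 (mulr_ge0 c0 p1) p2) (mulr_ge0 p3 p4) _ (ler_pM p3 p4 h3 h4).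
exact: ler_pM (mulr_ge0 c0 p1) p2 (ler_wpM2l c0 h1) h2.
Qed.

(** In the product [poch 1 k] cancels. The ratio starting at [d] contributes [n^(- r)], the one
    starting at [d / 2 - 1] contributes [n^(- (r + 2))], and [(d + k) / d = 1 + n] gives back one
    power of [n]. *)
Lemma christoffel_ratio (d k m : nat) n r : (3 <= d)%N -> 0 <= r ->
  1 <= n -> d%:R * n = k%:R -> m%:R <= 2 * n ->
  (\sum_(l < (k + m).+1) (jnorm (d%:R / 2 - 1) (d%:R / 2 - 1) l)^-1) *
    jnorm (d%:R / 2 + r) (d%:R / 2 - 2) k <=
  4 * expR 2 * 2 `^ (r + 2) * (1 + r) `^ r * (r + 2) `^ (r + 2) * n `^ (- (2 * r + 1)).
Proof.
move=> d3 r0 n1 dn mn.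
have dr : 3 <= d%:R :> R by rewrite (ler_nat R 3).
have kd : d%:R <= k%:R :> R by rewrite -dn ler_peMr //; lra.
have k0 : (0 < k)%N by rewrite -(ltr0n R); lra.
have H : \sum_(l < (k + m).+1) (jnorm (d%:R / 2 - 1) (d%:R / 2 - 1) l)^-1 <=
  2 * expR 2 / wint (d%:R / 2 - 1) (d%:R / 2 - 1) 1 * (poch d%:R k / poch 1 k) *
  ((d%:R + k%:R) / d%:R).
  apply: sum_jnorm_inv => //; first by lra.
  by rewrite -dn mulrCA ler_wpM2l //; lra.
move: H dr dn kd; set S := \sum_(l < _) _.
set D : R := d%:R; set K : R := k%:R => H dr dn kd.
have WZ : wint (D / 2 + r) (D / 2 - 2) 1 <= 2 `^ (r + 2) * wint (D / 2 - 1) (D / 2 - 1) 1.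
  exact: weight_ratio.
rewrite /jnorm -/K; move: H WZ.
have : 0 < wint (D / 2 - 1) (D / 2 - 1) 1 by apply: wint_gt0; lra.
have : 0 < wint (D / 2 + r) (D / 2 - 2) 1 by apply: wint_gt0; lra.
move: (wint (D / 2 - 1) _ 1) (wint (D / 2 + r) _ 1) => Z W W0 Z0 H WZ.
have -> : D / 2 + r + (D / 2 - 2) + 2 = D + r by field.
have -> : D / 2 + r + (D / 2 - 2) + 1 = D + r - 1 by field.
set b1 := D / 2 - 2 + 1.
have -> : D / 2 + r + 1 = b1 + (r + 2) by rewrite /b1; ring.
have b10 : 0 < b1 by rewrite /b1; lra.
have D0 : 0 < D by lra.
have r20 : 0 <= r + 2 by lra.
have c1 : 0 <= r * n * (D - 1) by rewrite !mulr_ge0 //; lra.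
have c2 : 0 <= n * (D - 1) by rewrite mulr_ge0 //; lra.
have c3 : 0 <= r * D by rewrite mulr_ge0 //; lra.
have c4 : 0 <= r * r by rewrite mulr_ge0.
have q1 := @pochratio D r k D0 r0.
have q2 := @pochratio b1 (r + 2) k b10 r20.
(* Since [K = D n], the base [(D + r) / (D + r + K)] is at most [(1 + r) / n], free of the
   dimension. The next ratio is treated in the same way. *)
have {}q1 : poch D k / poch (D + r) k <= ((1 + r) / n) `^ r.
  apply: le_trans q1 _; apply: ge0_ler_powR => //; rewrite ?nnegrE ?divr_ge0 //; try lra.
  rewrite -/K ler_pdivlMr; last by lra.
  rewrite mulrAC ler_pdivrMr; last by lra.
  by rewrite -dn; lra.
have {}q2 : poch b1 k / poch (b1 + (r + 2)) k <= ((r + 2) / n) `^ (r + 2).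
  apply: le_trans q2 _; apply: ge0_ler_powR => //; rewrite ?nnegrE ?divr_ge0 //; try lra.
  rewrite -/K ler_pdivlMr; last by lra.
  rewrite mulrAC ler_pdivrMr; last by lra.
  by rewrite -dn /b1; lra.
have p1 : 0 < poch 1 k by apply: poch_gt0; lra.
have p2 : 0 < poch D k by apply: poch_gt0; lra.
have p3 : 0 < poch (D + r) k by apply: poch_gt0; lra.
have p4 : 0 < poch b1 k by apply: poch_gt0; lra.
have p5 : 0 < poch (b1 + (r + 2)) k by apply: poch_gt0; lra.
move: p1 p2 p3 p4 p5 q1 q2 H.
move: (poch 1 k) (poch D k) (poch (D + r) k) (poch b1 k) (poch (b1 + (r + 2)) k) => P1 P2 P3 P4 P5.
move=> p1 p2 p3 p4 p5 q1 q2 H.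
have th : (D + r - 1 + K) / (D + r - 1 + K *+ 2) <= 1 by rewrite ler_pdivrMr; lra.
have th0 : 0 <= (D + r - 1 + K) / (D + r - 1 + K *+ 2) by rewrite divr_ge0; lra.
set N := W * (P4 * P1 / (P5 * P3)).
have N0 : 0 < N by rewrite /N; positive.
have e0 := expR_gt0 (2 : R).
set X := 2 * expR 2 / Z * (P2 / P1) * ((D + K) / D) in H.
have DK : 0 < D + K by lra.
have X0 : 0 < X by rewrite /X; positive.
apply: (@le_trans _ _ (X * (N * 1))).
  apply: (@le_trans _ _ (X * (N * ((D + r - 1 + K) / (D + r - 1 + K *+ 2))))).
    by rewrite ler_wpM2r // mulr_ge0 // ltW.
  by rewrite ler_wpM2l ?(ltW X0) // ler_wpM2l // ltW.
have -> : X * (N * 1) = 2 * expR 2 * (W / Z) * (1 + n) * (P2 / P3 * (P4 / P5)).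
  rewrite /X /N -dn; field; nonzero.
have WZ' : W / Z <= 2 `^ (r + 2) by rewrite ler_pdivrMr.
have g1 : ((1 + r) / n) `^ r = (1 + r) `^ r * n `^ (- r).
  by rewrite powRM ?invr_ge0 -?powR_inv1 -?powRrM ?mulN1r //; lra.
have g2 : ((r + 2) / n) `^ (r + 2) = (r + 2) `^ (r + 2) * n `^ (- (r + 2)).
  by rewrite powRM ?invr_ge0 -?powR_inv1 -?powRrM ?mulN1r //; lra.
have n0 : n != 0 by apply: lt0r_neq0; lra.
have g3 : n `^ (- (2 * r + 1)) = n * (n `^ (- r) * n `^ (- (r + 2))).
  rewrite -powRD ?n0 ?implybT // -[X in _ = X * _]powRr1; last by lra.
  by rewrite -powRD ?n0 ?implybT //; congr (_ `^ _); ring.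
apply: (@le_trans _ _ (2 * expR 2 * 2 `^ (r + 2) * (2 * n) * (((1 + r) / n) `^ r * ((r + 2) / n) `^ (r + 2)))).
  apply: ler_pM4 WZ' _ q1 q2; [..|lra].
  - by apply: ltW; positive.
  - by apply: ltW; positive.
  - by lra.
  - by apply: ltW; positive.
  - by apply: ltW; positive.
rewrite g1 g2 g3 le_eqVlt; apply/orP; left; apply/eqP.
move: (expR 2) (2 `^ _) ((1 + r) `^ _) ((r + 2) `^ _) (n `^ _) (n `^ _) => ? ? ? ? ? ?.
ring.
Qed.

End Ratio.

(** * Polynomial majorants of real powers *)

Section Majorant.
Variable R : realType.
Implicit Types (u t n r dl : R).

Lemma powR_le1 u dl : 0 <= u <= 1 -> 0 <= dl -> u `^ dl <= 1.
Proof.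
move=> /andP[u0 u1] d0; have <- : 1 `^ dl = 1 :> R by rewrite powR1.
by apply: ge0_ler_powR; rewrite ?nnegrE.
Qed.

Lemma powR_gt1 (a x : R) : 1 < a -> 0 < x -> 1 < a `^ x.
Proof.
move=> a1 x0; rewrite /powR gt_eqF ?(lt_trans _ a1) // expR_gt1.
by rewrite mulr_gt0 // ln_gt0.
Qed.

(* With [u = sin^2 theta] this is [sin^2 (3 theta)], so its iterates are [u]
   times squares of polynomials and behave like [min 1 (9^i u)]; weighted by
   [9^(- dl i)] they sum up to a multiple of [u^dl]. *)
Definition triple u : R := u * (3 - 4 * u) ^+ 2.

Lemma triple_itv u : 0 <= u <= 1 -> 0 <= triple u <= 1.
Proof.
move=> /andP[u0 u1]; rewrite /triple mulr_ge0 ?sqr_ge0 //=.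
have -> : u * (3 - 4 * u) ^+ 2 = 1 - (1 - u) * (1 - 4 * u) ^+ 2 by ring.
by rewrite lerBlDr lerDl mulr_ge0 ?sqr_ge0 ?subr_ge0.
Qed.

Lemma triple_le u : 0 <= u <= 1 -> triple u <= 9 * u.
Proof.
move=> /andP[u0 u1]; rewrite /triple mulrC ler_wpM2r //.
have -> : (3 - 4 * u) ^+ 2 = 9 - (8 * u + 16 * (u * (1 - u))) by ring.
by rewrite lerBlDr lerDl addr_ge0 ?mulr_ge0 ?subr_ge0.
Qed.

Lemma iter_triple_itv u i : 0 <= u <= 1 -> 0 <= iter i triple u <= 1.
Proof. by move=> u01; elim: i => //= i; exact: triple_itv. Qed.

Definition tsum dl (I : nat) u : R := \sum_(i < I) (9 `^ (- dl)) ^+ i * iter i triple u.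

Lemma tsumS dl I u : tsum dl I.+1 u = u + 9 `^ (- dl) * tsum dl I (triple u).
Proof.
rewrite /tsum big_ord_recl expr0 mul1r; congr (_ + _).
rewrite mulr_sumr; apply: eq_bigr => i _.
by rewrite lift0 iterSr exprS mulrA.
Qed.

(** Here [triple u = 9 u z] with [z = (1 - 4 u / 3)^2] in [[0, 1]], so [z^dl >= z >= 1 - 8 u / 3].
    Replacing [u^dl] by [(u z)^dl] thus loses at most [8 u / 3], and the factor [3 / 8] makes the
    first summand [u] of [tsum] cover exactly this loss. *)
Lemma tsum_lower dl I u : 0 <= dl <= 1 -> 0 <= u <= 1 ->
  3 / 8 * u `^ dl <= tsum dl I u + 3 / 8 * (9 `^ (- dl)) ^+ I.
Proof.
move=> /andP[d0 d1]; elim: I u => [|I IH] u u01.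
  rewrite /tsum big_ord0 add0r expr0 ler_wpM2l //; exact: powR_le1.
rewrite tsumS exprS; case/andP: (u01) => u0 u1.
set p := 9 `^ (- dl).
have p0 : 0 <= p by exact: powR_ge0.
have := ler_wpM2l p0 (IH _ (triple_itv u u01)); rewrite -/p.
set z : R := (1 - 4 / 3 * u) ^+ 2.
have z0 : 0 <= z by exact: sqr_ge0.
have e1 : p * (3 / 8 * triple u `^ dl) = 3 / 8 * (u `^ dl * z `^ dl).
  have -> : triple u = 9 * (u * z) by rewrite /triple /z; field.
  rewrite (@powRM _ 9 (u * z)) //; last exact: mulr_ge0.
  rewrite (@powRM _ u z) //.
  have e : p * 9 `^ dl = 1.
    by rewrite /p -powRD ?addNr ?powRr0 // pnatr_eq0 implybT.
  by rewrite -[RHS]mul1r -[X in _ = X * _]e; ring.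
rewrite e1 => h.
have ud1 : u `^ dl <= 1 by exact: powR_le1.
have ud0 : 0 <= u `^ dl := powR_ge0 _ _.
have zz : z <= z `^ dl.
  have [->|zn0] := eqVneq z 0; first exact: powR_ge0.
  have zp : 0 < z by rewrite lt_neqAle eq_sym zn0.
  rewrite -{1}[z]powRr1 //; apply: ger_powR => //; rewrite zp /=.
  have -> : z = 1 - 8 / 3 * (u * (1 - 2 / 3 * u)) by rewrite /z; field.
  have w0 : 0 <= 1 - 2 / 3 * u by lra.
  by have := mulr_ge0 u0 w0; lra.
have zu : 1 - 8 / 3 * u <= z.
  have -> : z = 1 - 8 / 3 * u + (4 / 3 * u) ^+ 2 by rewrite /z; ring.
  by rewrite lerDl sqr_ge0.
have k1 : u `^ dl * (1 - 8 / 3 * u) <= u `^ dl * z `^ dl.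
  by rewrite ler_wpM2l //; exact: le_trans zz.
have k2 : u `^ dl * u <= u by rewrite ler_piMl.
lra.
Qed.

Definition msum dl (I : nat) u : R := \sum_(i < I) (9 `^ (- dl)) ^+ i * Num.min 1 (9 ^+ i * u).

Lemma tsum_msum dl I u : 0 <= u <= 1 -> tsum dl I u <= msum dl I u.
Proof.
move=> u01; apply: ler_sum => i _; rewrite ler_wpM2l ?exprn_ge0 ?powR_ge0 //.
rewrite le_min; case/andP: (iter_triple_itv u i u01) => _ -> /=.
elim: (i : nat) => [|j IH]; first by rewrite expr0 mul1r.
rewrite iterS (le_trans (triple_le _ (iter_triple_itv u j u01))) // exprS -mulrA.
by rewrite ler_wpM2l.
Qed.

Lemma msumS dl I u : msum dl I.+1 u = Num.min 1 u + 9 `^ (- dl) * msum dl I (9 * u).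
Proof.
rewrite /msum big_ord_recl expr0 !mul1r; congr (_ + _).
rewrite mulr_sumr; apply: eq_bigr => i _.
by rewrite lift0 exprS mulrA exprSr mulrA.
Qed.

(** Both strict bounds on [dl] matter: [p < 1] sums the terms where the minimum is 1, and [9 p > 1]
    those where it is [9^i u]. *)
Lemma msum_upper dl : 0 < dl < 1 ->
  exists C : R, 0 < C /\ forall I u, 0 <= u <= 1 -> msum dl I u <= C * u `^ dl.
Proof.
move=> /andP[d0 d1]; set p : R := 9 `^ (- dl).
have p0 : 0 < p by exact: powR_gt0.
have p1 : p < 1.
  by rewrite /p powRN invf_lt1 ?powR_gt0 // powR_gt1 //; lra.
have p9 : 1 < 9 * p.
  have -> : 9 * p = 9 `^ (1 - dl).
    by rewrite powRD ?pnatr_eq0 ?implybT // powRr1.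
  by rewrite powR_gt1 //; lra.
have pd : p * 9 `^ dl = 1.
  by rewrite /p -powRD ?addNr ?powRr0 // pnatr_eq0 implybT.
(* [E] is the geometric bound valid for all [u]; [D] satisfies [9 p D = D + 1], which reproduces the
   correction below; [C p = E + D] covers [u > 1 / 9]. *)
pose E := (1 - p)^-1; pose D := (9 * p - 1)^-1; pose C := (E + D) / p.
have E0 : 0 < E by rewrite invr_gt0; lra.
have D0 : 0 < D by rewrite invr_gt0; lra.
have eE : 1 + p * E = E by rewrite /E; field; apply/eqP; lra.
have eD : 9 * p * D = D + 1 by rewrite /D; field; apply/eqP; lra.
have eC : C * p = E + D by rewrite /C mulfVK // gt_eqF.
have C0 : 0 < C by rewrite divr_gt0 // addr_gt0.
exists C; split => // I u u01.
have hE J v : msum dl J v <= E.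
  elim: J v => [|J IH] v; first by rewrite /msum big_ord0 ltW.
  rewrite msumS -eE lerD ?ge_min ?lexx // -/p.
  by rewrite ler_wpM2l ?(ltW p0).
(* The subtracted [D u] strengthens the claim so that the induction closes: tripling turns it into
   [(D + 1) u], whose surplus pays for the new summand [u]. *)
suff : msum dl I u <= C * u `^ dl - D * u.
  case/andP: u01 => u0 u1 h; apply: le_trans h _.
  by rewrite lerBlDr lerDl mulr_ge0 // ltW.
elim: I u u01 => [|I IH] u /andP[u0 u1].
  rewrite /msum big_ord0 subr_ge0.
  have uu : u <= u `^ dl.
    have [->|un0] := eqVneq u 0; first exact: powR_ge0.
    have up : 0 < u by rewrite lt_neqAle eq_sym un0.
    by rewrite -{1}[u]powRr1 //; apply: ger_powR => //; [rewrite up|exact: ltW].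
  have DC : D <= C by rewrite -(ler_pM2r p0) eC; nra.
  by apply: ler_pM => //; exact: ltW.
have [u9|u9] := leP u (9^-1); last first.
  apply: le_trans (hE _ _) _.
  have h : C * p <= C * u `^ dl.
    rewrite ler_wpM2l ?(ltW C0) //.
    have -> : p = 9^-1 `^ dl by rewrite -powR_inv1 // -powRrM mulN1r.
    by apply: ge0_ler_powR; rewrite ?nnegrE ?invr_ge0 //; exact: ltW.
  have : D * u <= D by rewrite ler_piMr // ltW.
  lra.
rewrite msumS -/p.
have h := IH (9 * u) _.
have {}h : msum dl I (9 * u) <= C * (9 * u) `^ dl - D * (9 * u).
  by apply: h; apply/andP; split; lra.
have := ler_wpM2l (ltW p0) h.
rewrite powRM //.
have -> : p * (C * (9 `^ dl * u `^ dl) - D * (9 * u)) = p * 9 `^ dl * (C * u `^ dl) - 9 * p * D * u by ring.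
rewrite pd eD => h2.
have : Num.min 1 u <= u by rewrite ge_min lexx orbT.
lra.
Qed.

End Majorant.

Section PolyMajorant.
Variable R : realType.
Implicit Types (u t n r dl : R).

Definition halfpoly : {poly R} := 2^-1%:P * (1 - 'X).

(** With [t = cos (2 theta)] this is [sin (3^i theta) / sin theta], a Chebyshev polynomial of the
    second kind in [cos theta] rewritten in [t]; its degree in [t] is at most [(3^i - 1) / 2]. *)
Fixpoint tripleq (i : nat) : {poly R} :=
  if i is j.+1 then tripleq j * (3%:P - 4%:P * (halfpoly * tripleq j ^+ 2)) else 1.

Lemma iter_tripleE i t :
  iter i (triple R) ((1 - t) / 2) = (1 - t) / 2 * (tripleq i).[t] ^+ 2.
Proof.
elim: i => [|i IH]; first by rewrite /= hornerC expr1n mulr1.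
rewrite iterS IH /triple [tripleq _]/= /halfpoly !hornerE /=.
by field.
Qed.

Lemma size_tripleq i : ((size (tripleq i)).*2 <= 3 ^ i + 1)%N.
Proof.
elim: i => [|i IH]; first by rewrite /= size_poly1.
have [q0|q0] := eqVneq (tripleq i) 0; first by rewrite /= q0 mul0r size_poly0.
set q := tripleq i in IH q0.
have sq : (0 < size q)%N by rewrite size_poly_gt0.
have s1 : (size (1 - 'X : {poly R})%R <= 2)%N.
  by rewrite -opprB size_polyN size_XsubC.
have s2 : (size (4%:P * (halfpoly * q ^+ 2))%R <= (size q).*2)%N.
  rewrite mul_polyC /halfpoly -mulrA mul_polyC.
  apply: leq_trans (size_scale_leq _ _) _; apply: leq_trans (size_scale_leq _ _) _.
  apply: leq_trans (size_polyMleq _ _) _.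
  have := size_polyMleq q q; rewrite -expr2; move: s1 sq.
  move: (size (1 - 'X)%R) (size (q ^+ 2)%R) (size q) => x y z; lia.
have s3 : (size (3%:P - 4%:P * (halfpoly * q ^+ 2))%R <= (size q).*2)%N.
  apply: leq_trans (size_polyD _ _) _; rewrite geq_max size_polyN s2 andbT.
  apply: leq_trans (size_polyC_leq1 _) _; lia.
have := size_polyMleq q (3%:P - 4%:P * (halfpoly * q ^+ 2)).
rewrite [tripleq _]/= -/q expnS; move: s3 sq IH.
move: (size (3%:P - _)%R) (size q) (size (q * _)%R) (3 ^ i)%N => x y z w; lia.
Qed.

Lemma exists_pow3 n : 1 <= n -> exists I : nat, (3 ^ I)%:R <= n /\ n < 3 * (3 ^ I)%:R.
Proof.
move=> n1.
have t0 : (0 < Num.truncn n)%N by rewrite truncn_gt0.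
exists (trunc_log 3 (Num.truncn n)); split.
  apply: (@le_trans _ _ (Num.truncn n)%:R); last by rewrite truncn_le; lra.
  by rewrite ler_nat trunc_logP.
rewrite -natrM -expnS; apply: lt_le_trans (truncnS_gt n) _.
by rewrite ler_nat trunc_log_ltn.
Qed.

Lemma powR_floor r : 0 <= r -> exists (N : nat) dl, [/\ r = N%:R + dl, 0 <= dl & dl < 1].
Proof.
move=> r0; exists (Num.truncn r), (r - (Num.truncn r)%:R).
have := truncnS_gt r; have := truncn_le r; rewrite r0 -natr1 => h1 h2; split; lra.
Qed.

Lemma expr_le1D_powR (v r : R) (N : nat) : 0 <= v -> N%:R <= r -> v ^+ N <= 1 + v `^ r.
Proof.
move=> v0 Nr; have [v1|v1] := leP v 1.
  by rewrite -[leLHS]addr0 lerD ?powR_ge0 // exprn_ile1.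
rewrite -[leLHS]add0r lerD // -powR_mulrn //; apply: ler_powR => //; exact: ltW.
Qed.

(** Write [r = N + dl]: the factor [u^N] is kept, and [u^dl] is replaced by [tsum] truncated at
    [3^I] comparable to [n]. The degrees are then at most about [r + n / 2], so they fit below
    [2 n]. *)
Lemma poly_majorant r : 0 <= r -> exists C, 0 < C /\ forall n, 2 * r + 5 <= n ->
  exists s : seq (R * (nat * {poly R})),
    [/\ forall c, c \in s -> 0 <= c.1 /\ c.2.1%:R + (size c.2.2).-1%:R < 2 * n,
     forall t, -1 <= t <= 1 ->
       (1 - t) `^ r <= \sum_(c <- s) c.1 * ((1 - t) ^+ c.2.1 * c.2.2.[t] ^+ 2) &
     forall t, -1 <= t <= 1 ->
       \sum_(c <- s) c.1 * ((1 - t) ^+ c.2.1 * c.2.2.[t] ^+ 2) <=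
         C * ((1 - t) `^ r + n `^ (- (2 * r)))].
Proof.
move=> r0; have [N [dl [rE d0 d1]]] := powR_floor r r0.
(* An integer [r] needs no approximation, and [msum_upper] would fail for [dl = 0]. *)
move: d0; rewrite le_eqVlt => /predU1P[dl0|d0].
  exists 1; split => // n nr; exists [:: (1, (N, 1%:P))]; split.
  - by move=> c; rewrite inE => /eqP -> /=; rewrite size_polyC oner_eq0 /=; split => //; rewrite mulr0n; lra.
  - move=> t /andP[t1 t2]; rewrite big_seq1 /= hornerC expr1n mul1r mulr1.
    by rewrite rE -dl0 addr0 powR_mulrn //; lra.
  - move=> t /andP[t1 t2]; rewrite big_seq1 /= hornerC expr1n !mul1r mulr1.
    rewrite rE -dl0 addr0 powR_mulrn; last by lra.
    by rewrite lerDl powR_ge0.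
have dl01 : 0 < dl < 1 by rewrite d0.
have dl01' : 0 <= dl <= 1 by rewrite !ltW.
have [C0 [C00 HC0]] := msum_upper R dl dl01.
set p : R := 9 `^ (- dl).
have p0 : 0 < p by exact: powR_gt0.
pose K : R := 2 `^ r.
have K0 : 0 < K by exact: powR_gt0.
have q9 : 0 < (9 `^ dl : R) by exact: powR_gt0.
exists (8 / 3 * C0 + (K + 1) * 9 `^ dl); split.
  by rewrite addr_gt0 // mulr_gt0 // addr_gt0.
move=> n nr; have n1 : 1 <= n by lra.
have [I [I1 I2]] := exists_pow3 n n1.
(* The head is the truncation error [p^I] of [tsum_lower], the tail its main sum divided by [3 / 8].
   The powers of [1 / 2] and [K = 2^r] convert between [u] and [1 - t = 2 u]. *)
pose s : seq (R * (nat * {poly R})) := (K * 2^-1 ^+ N * p ^+ I, (N, 1%:P)) ::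
  [seq (K * (8 / 3) * 2^-1 ^+ N.+1 * p ^+ val i, (N.+1, tripleq (val i))) | i : 'I_I <- enum 'I_I].
have sE t : \sum_(c <- s) c.1 * ((1 - t) ^+ c.2.1 * c.2.2.[t] ^+ 2) =
   K * ((1 - t) / 2) ^+ N * (p ^+ I + 8 / 3 * tsum R dl I ((1 - t) / 2)).
  rewrite /s big_cons /= hornerC expr1n big_map big_enum /= /tsum mulrDr; congr (_ + _).
    by rewrite expr_div_n exprVn; ring.
  rewrite !mulr_sumr; apply: eq_bigr => i _.
  by rewrite iter_tripleE exprS expr_div_n -/p [_ ^+ N.+1]exprS exprVn; field.
exists s; split.
- move=> c; rewrite inE => /orP[/eqP ->|/mapP[i _ ->]] /=.
    rewrite size_polyC oner_eq0 /= mulr0n; split; last by lra.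
    by rewrite !mulr_ge0 ?exprn_ge0 ?invr_ge0 // ltW.
  split; first by rewrite !mulr_ge0 ?exprn_ge0 ?invr_ge0 // ltW.
  have h1 := size_tripleq i.
  have h2 : ((size (tripleq i)).-1.*2 <= 3 ^ I)%N.
    have h2 : (3 ^ i <= 3 ^ I)%N by rewrite leq_exp2l // ltnW.
    move: h1 h2; clear; move: (size _) (3 ^ i)%N (3 ^ I)%N => x y z; lia.
  have : (((size (tripleq i)).-1.*2)%:R : R) <= (3 ^ I)%:R by rewrite ler_nat.
  rewrite -mul2n natrM -natr1; lra.
- move=> t /andP[t1 t2]; rewrite sE; set u := (1 - t) / 2.
  have u0 : 0 <= u by rewrite /u; lra.
  have u01 : 0 <= u <= 1 by rewrite u0 /u; lra.
  have uE : (1 - t) `^ r = K * u ^+ N * u `^ dl.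
    have -> : 1 - t = 2 * u by rewrite /u; field.
    rewrite powRM // {2}rE -/K -powR_mulrn // -mulrA; congr (_ * _).
    have [->|un0] := eqVneq u 0; last by rewrite powRD // un0 implybT.
    have N0 : 0 <= N%:R :> R := ler0n _ _.
    have -> : 0 `^ dl = 0 :> R by rewrite powR0 // gt_eqF.
    by rewrite mulr0 powR0 // gt_eqF //; lra.
  rewrite uE ler_wpM2l ?mulr_ge0 ?exprn_ge0 ?(ltW K0) //.
  by have := tsum_lower R dl I u dl01' u01; rewrite -/p; lra.
- move=> t /andP[t1 t2]; rewrite sE; set u := (1 - t) / 2.
  have u0 : 0 <= u by rewrite /u; lra.
  have u01 : 0 <= u <= 1 by rewrite u0 /u; lra.
  have uE : (1 - t) `^ r = K * u ^+ N * u `^ dl.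
    have -> : 1 - t = 2 * u by rewrite /u; field.
    rewrite powRM // {2}rE -/K -powR_mulrn // -mulrA; congr (_ * _).
    have [->|un0] := eqVneq u 0; last by rewrite powRD // un0 implybT.
    have N0 : 0 <= N%:R :> R := ler0n _ _.
    have -> : 0 `^ dl = 0 :> R by rewrite powR0 // gt_eqF.
    by rewrite mulr0 powR0 // gt_eqF //; lra.
  have ud0 : 0 <= u `^ dl := powR_ge0 _ _.
  have c0 : 0 <= K * u ^+ N by rewrite mulr_ge0 ?exprn_ge0 // ltW.
  have h1 : K * u ^+ N * (8 / 3 * tsum R dl I u) <= 8 / 3 * C0 * (1 - t) `^ r.
    rewrite uE; have : tsum R dl I u <= C0 * u `^ dl.
      exact: le_trans (tsum_msum _ _ _ _ u01) (HC0 I u u01).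
    by move/(ler_wpM2l c0); lra.
  (* [p^I] is [3^I] to the power [- 2 dl], and [n < 3 * 3^I] costs the factor [9^dl]. *)
  have h2 : p ^+ I <= 9 `^ dl * n `^ (- (2 * dl)).
    have -> : p ^+ I = 9 `^ dl * (3 * (3 ^ I)%:R) `^ (- (2 * dl)).
      have -> : p ^+ I = (3 ^ I)%:R `^ (- (2 * dl)).
        rewrite -[LHS]powR_mulrn ?(ltW p0) // /p -powRrM.
        have -> : 9 = 3 `^ 2%:R :> R by rewrite powR_mulrn // expr2; ring.
        have -> : (3 ^ I)%:R = 3 `^ I%:R :> R by rewrite natrX powR_mulrn.
        rewrite -!powRrM; congr (_ `^ _); ring.
      rewrite powRM // mulrA; have -> : 9 = 3 `^ 2%:R :> R by rewrite powR_mulrn // expr2; ring.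
      by rewrite -powRrM -powRD ?subrr ?powRr0 ?mul1r // pnatr_eq0 implybT.
    have n0 : 0 < n by lra.
    have m0 : 0 < 3 * (3 ^ I)%:R :> R by rewrite mulr_gt0 // ltr0n expn_gt0.
    apply: (ler_wpM2l (ltW q9)); rewrite !powRN.
    rewrite lef_pV2 ?posrE ?(powR_gt0 _ n0) ?(powR_gt0 _ m0) //.
    have dl2 : 0 <= 2 * dl by lra.
    by apply: (ge0_ler_powR dl2); rewrite ?nnegrE ?(ltW n0) ?(ltW m0) // ltW.
  (* In terms of [v = n^2 u] this is [v^N <= 1 + v^r] times [n^(- 2 r)]: the error keeps only the
     integer power [u^N], which is split according to the size of [v]. *)
  have h3 : u ^+ N * n `^ (- (2 * dl)) <= n `^ (- (2 * r)) + u `^ r.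
    have n0 : 0 < n by lra.
    have nn : n != 0 by apply: lt0r_neq0.
    have v0 : 0 <= n ^+ 2 * u by rewrite mulr_ge0 // sqr_ge0.
    have := expr_le1D_powR (n ^+ 2 * u) r N v0 _.
    have Nr : N%:R <= r by rewrite rE lerDl ltW.
    move=> /(_ Nr) /(ler_wpM2l (powR_ge0 n (- (2 * r)))).
    have -> : n `^ (- (2 * r)) * (n ^+ 2 * u) ^+ N = u ^+ N * n `^ (- (2 * dl)).
      rewrite exprMn -exprM -[n ^+ _]powR_mulrn ?(ltW n0) // mulrA -powRD ?nn ?implybT //.
      by rewrite mulrC; congr (_ * _ `^ _); rewrite rE natrM; ring.
    have -> : n `^ (- (2 * r)) * (1 + (n ^+ 2 * u) `^ r) = n `^ (- (2 * r)) + u `^ r; last by [].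
    rewrite mulrDr mulr1 powRM ?sqr_ge0 // -[n ^+ 2]powR_mulrn ?(ltW n0) // -powRrM.
    by rewrite mulrA -powRD ?nn ?implybT // addNr powRr0 mul1r.
  have h4 : K * u `^ r = (1 - t) `^ r.
    rewrite /K -powRM //; congr (_ `^ _); rewrite /u; by field.
  have h5 : K * u ^+ N * p ^+ I <= K * 9 `^ dl * (u ^+ N * n `^ (- (2 * dl))).
    by move/(ler_wpM2l c0): h2; lra.
  have h6 : K * 9 `^ dl * (u ^+ N * n `^ (- (2 * dl))) <= K * 9 `^ dl * (n `^ (- (2 * r)) + u `^ r).
    by rewrite ler_wpM2l // mulr_ge0 // ltW.
  have h7 : 9 `^ dl * (K * u `^ r) <= K * 9 `^ dl * (1 - t) `^ r + 9 `^ dl * (1 - t) `^ r.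
    by rewrite h4 lerDr !mulr_ge0 ?powR_ge0 // ltW.
  have h8 : 0 <= K * 9 `^ dl * (1 - t) `^ r by rewrite !mulr_ge0 ?powR_ge0 // ltW.
  have h9 : 0 <= C0 * n `^ (- (2 * r)) by rewrite !mulr_ge0 ?powR_ge0 // ltW.
  have h10 : 0 <= 9 `^ dl * n `^ (- (2 * r)) by rewrite !mulr_ge0 ?powR_ge0 // ltW.
  have h11 : 0 <= 9 `^ dl * (1 - t) `^ r by rewrite !mulr_ge0 ?powR_ge0 // ltW.
  rewrite mulrDr.
  lra.
Qed.
End PolyMajorant.

(** * Zonal integrals on the sphere *)

Section Rotation.
Variables (R : realType) (d : nat) (i j : 'I_d.+1).
Hypothesis ij : i != j.
Implicit Types (c s h : R) (x y : 'rV[R]_d.+1).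

Definition planerot c s : 'M[R]_d.+1 := \matrix_(k, l)
  (if l == i then c * (k == i)%:R - s * (k == j)%:R
   else if l == j then s * (k == i)%:R + c * (k == j)%:R else (k == l)%:R).

Lemma sum_mul_delta (f : 'I_d.+1 -> R) l : \sum_k f k * (k == l)%:R = f l.
Proof.
rewrite (bigD1 l) //= eqxx mulr1 big1 ?addr0 // => k /negbTE ->.
by rewrite mulr0.
Qed.

Lemma planerotE c s y l : (y *m planerot c s) ord0 l =
  if l == i then c * y ord0 i - s * y ord0 j
  else if l == j then s * y ord0 i + c * y ord0 j else y ord0 l.
Proof.
rewrite mxE; under eq_bigr do rewrite mxE.
case: eqP => _.
  under eq_bigr do rewrite mulrBr !(mulrCA (y _ _)).
  by rewrite sumrB -!mulr_sumr !sum_mul_delta.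
case: eqP => _.
  under eq_bigr do rewrite mulrDr !(mulrCA (y _ _)).
  by rewrite big_split /= -!mulr_sumr !sum_mul_delta.
by rewrite sum_mul_delta.
Qed.

Lemma eq_mulmx_row (A B : 'M[R]_d.+1) :
  (forall y l, (y *m A) ord0 l = (y *m B) ord0 l) -> A = B.
Proof.
move=> h; apply/row_matrixP => k; rewrite !rowE; apply/rowP => l; exact: h.
Qed.

Lemma planerotM c1 s1 c2 s2 :
  planerot c1 s1 *m planerot c2 s2 = planerot (c1 * c2 - s1 * s2) (c1 * s2 + s1 * c2).
Proof.
have ji : (j == i) = false by rewrite eq_sym (negbTE ij).
apply: eq_mulmx_row => y l; rewrite mulmxA !planerotE !eqxx ji.
case: eqP => _; first by ring.
by case: eqP => _; first by ring.
Qed.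

Lemma planerot1 : planerot 1 0 = 1%:M.
Proof.
apply: eq_mulmx_row => y l; rewrite mulmx1 planerotE.
case: eqP => [->|_]; first by rewrite mul1r mul0r subr0.
by case: eqP => [->|_] //; rewrite mul1r mul0r add0r.
Qed.

Lemma planerot_tr c s : (planerot c s)^T = planerot c (- s).
Proof.
have ji : (j == i) = false by rewrite eq_sym (negbTE ij).
apply/matrixP => k l; rewrite !mxE.
case: (eqVneq l i) => li; case: (eqVneq k i) => ki;
  case: (eqVneq l j) => lj; case: (eqVneq k j) => kj; rewrite ?mulr1 ?mulr0.
all: try (by move: ij; rewrite -ki kj eqxx).
all: try (by move: ij; rewrite -li lj eqxx).
all: rewrite ?subrr ?addr0; try (by ring).
all: try (by rewrite li eq_sym (negbTE ki)).
all: try (by rewrite ki eq_sym (negbTE li)).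
all: try (by rewrite lj eq_sym (negbTE kj)).
all: try (by rewrite kj eq_sym (negbTE lj)).
all: by rewrite eq_sym.
Qed.

(* The rational parametrization turns the invariance of the mean under
   rotations into a polynomial identity in [h], whose linear coefficient is the
   infinitesimal invariance. *)
Definition halfrot h := planerot ((1 - h ^+ 2) / (1 + h ^+ 2)) (2 * h / (1 + h ^+ 2)).

(** The half-angle rotation [H] has [halfrot h] as its square, so the determinant is
    [(det H)^2 = det (H H^T) = 1], with no expansion. *)
Lemma halfrot_SO h : halfrot h *m (halfrot h)^T = 1%:M /\ \det (halfrot h) = 1.
Proof.
have h0 : 0 < 1 + h ^+ 2 by have := sqr_ge0 h; lra.
have [q [q0 q2]] : exists q, 0 < q /\ 1 + h ^+ 2 = q ^+ 2.
  by exists (Num.sqrt (1 + h ^+ 2)); rewrite sqrtr_gt0 sqr_sqrtr // ltW.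
have qn0 : q != 0 by exact: lt0r_neq0.
pose H := planerot q^-1 (h / q).
have HH : halfrot h = H *m H.
  by rewrite planerotM /halfrot q2; congr planerot; field.
have HT : H *m H^T = 1%:M.
  rewrite planerot_tr planerotM -planerot1; congr planerot; last by ring.
  rewrite (_ : _ - _ = (1 + h ^+ 2) / q ^+ 2); last by field.
  by rewrite q2 divff // expf_neq0.
split; first by rewrite HH trmx_mul mulmxA -(mulmxA H) HT mulmx1 HT.
by rewrite HH det_mulmx -[X in _ * X]det_tr -det_mulmx HT det1.
Qed.

End Rotation.

Section SphereMeasurable.
Variables (R : realType) (d : nat).
Local Notation E := (Rd R d).
Local Notation S := (Ssphere R d).

Lemma measurable_continuous_Rd (f : 'rV[R]_d.+1 -> R) : continuous f ->
  measurable_fun [set: E] (f : E -> R).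
Proof.
move=> /continuousP cf; apply: (measurability _ (RGenOpens.measurableE R)).
move=> _ [_ [a [b /= ->]] <-]; rewrite setTI; apply: sub_sigma_algebra.
by apply: cf; exact: interval_open.
Qed.

Lemma continuous_mulmxr (Q : 'M[R]_d.+1) :
  continuous (fun x : 'rV[R]_d.+1 => x *m Q : 'rV[R]_d.+1).
Proof.
have -> : (fun x : 'rV[R]_d.+1 => x *m Q : 'rV[R]_d.+1) =
   (fun x => \sum_(k <- enum 'I_d.+1) x ord0 k *: row k Q).
  by apply/funext => x; rewrite mulmx_sum_row big_enum.
elim: (enum _) => [|k s IH].
  by under eq_fun do rewrite big_nil; exact: cst_continuous.
under eq_fun do rewrite big_cons.
move=> x; apply: (@cvgD R 'rV[R]_d.+1 _ (nbhs x) _ (fun y => y ord0 k *: row k Q)); last exact: IH.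
by apply: cvgZr_tmp; exact: coord_continuous.
Qed.

Lemma measurable_mulmxr (Q : 'M[R]_d.+1) :
  measurable_fun [set: E] (fun x : E => (x *m Q : 'rV[R]_d.+1) : E).
Proof.
apply: (@measurability _ _ E E setT _ (@open 'rV[R]_d.+1)) => //.
move=> _ [A oA <-]; rewrite setTI.
apply: sub_sigma_algebra.
by have /continuousP := continuous_mulmxr Q; apply.
Qed.

Lemma measurable_coord k : measurable_fun [set: E] (fun y : E => (y : 'rV[R]_d.+1) ord0 k).
Proof. by apply: measurable_continuous_Rd; exact: coord_continuous. Qed.

Lemma measurable_Ssphere : measurable S.
Proof.
have m : measurable_fun [set: E] (fun y : E => dotv y y).
  by rewrite /dotv; apply: measurable_sum => k; apply: measurable_funM; exact: measurable_coord.
have := m measurableT [set 1] (measurable_set1 1); rewrite setTI.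
by congr measurable.
Qed.

Lemma coord_le1 (y : E) k : S y -> `|(y : 'rV[R]_d.+1) ord0 k| <= 1.
Proof.
rewrite /Ssphere /= /dotv (bigD1 k) //= => h.
rewrite -(@expr_le1 _ 2) // real_normK ?num_real //.
rewrite expr2 -h lerDl; apply: sumr_ge0 => l _; rewrite -expr2; exact: sqr_ge0.
Qed.

Lemma dotv_mulmx (Q : 'M[R]_d.+1) (x y : 'rV[R]_d.+1) : Q *m Q^T = 1%:M ->
  dotv (x *m Q) (y *m Q) = dotv x y.
Proof.
have e (u v : 'rV[R]_d.+1) : dotv u v = (u *m v^T) ord0 ord0.
  by rewrite mxE; apply: eq_bigr => k _; rewrite mxE.
by move=> h; rewrite !e trmx_mul mulmxA -(mulmxA x) h mulmx1.
Qed.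

Lemma Ssphere_mulmx (Q : 'M[R]_d.+1) : Q *m Q^T = 1%:M ->
  (fun y : E => (y *m Q : 'rV[R]_d.+1) : E) @^-1` S = S.
Proof. by move=> h; apply/seteqP; split => y; rewrite /Ssphere /= dotv_mulmx. Qed.

(** Boundedness is asked on the sphere only, so that coordinates qualify. The class is closed under
    the ring operations and consists of [mu]-integrable functions. *)
Definition spherefun (f : E -> R) :=
  measurable_fun [set: E] f /\ exists M : R, forall y, S y -> `|f y| <= M.

Lemma spherefun_cst c : spherefun (fun=> c).
Proof. by split; [exact: measurable_cst|exists `|c|]. Qed.

Lemma spherefun_coord k : spherefun (fun y => (y : 'rV[R]_d.+1) ord0 k).
Proof. by split; [exact: measurable_coord|exists 1 => y; exact: coord_le1]. Qed.

Lemma spherefunD f g : spherefun f -> spherefun g -> spherefun (fun y => f y + g y).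
Proof.
move=> [mf [M hM]] [mg [N hN]]; split; first exact: measurable_funD.
exists (M + N) => y Sy; apply: le_trans (ler_normD _ _) _.
by rewrite lerD ?hM ?hN.
Qed.

Lemma spherefunM f g : spherefun f -> spherefun g -> spherefun (fun y => f y * g y).
Proof.
move=> [mf [M hM]] [mg [N hN]]; split; first exact: measurable_funM.
by exists (M * N) => y Sy; rewrite normrM ler_pM ?hM ?hN.
Qed.

Lemma spherefunZ c f : spherefun f -> spherefun (fun y => c * f y).
Proof. by apply: spherefunM; exact: spherefun_cst. Qed.

Lemma spherefun_sum (I : Type) (s : seq I) (P : pred I) (f : I -> E -> R) :
  (forall k, spherefun (f k)) -> spherefun (fun y => \sum_(k <- s | P k) f k y).
Proof.
move=> h; elim: s => [|k s IH].
  by under eq_fun do rewrite big_nil; exact: spherefun_cst.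
under eq_fun do rewrite big_cons.
by case: (P k) => //; exact: spherefunD.
Qed.

Lemma spherefunX f n : spherefun f -> spherefun (fun y => f y ^+ n).
Proof.
move=> hf; elim: n => [|n IH]; first exact: spherefun_cst.
by under eq_fun do rewrite exprS; exact: spherefunM.
Qed.

Lemma spherefun_dotv (x : E) : spherefun (fun y => dotv x y).
Proof.
by apply: spherefun_sum => k; apply: spherefunZ; exact: spherefun_coord.
Qed.

Lemma spherefun_horner (F : {poly R}) f : spherefun f -> spherefun (fun y => F.[f y]).
Proof.
move=> hf; under eq_fun do rewrite horner_coef.
by apply: spherefun_sum => k; apply: spherefunZ; exact: spherefunX.
Qed.

End SphereMeasurable.

Section Zonal.
Variables (R : realType) (d : nat) (mu : {measure set (Rd R d) -> \bar R}).
Hypothesis hmu : is_normalized_surface_measure mu.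
Local Notation S := (Ssphere R d).
Local Notation E := (Rd R d).
Local Notation V := 'rV[R]_d.+1.
Local Notation spherefun := (@spherefun R d).
Local Notation av f := (\int[mu]_(y in S) f y).
Implicit Types (f g : E -> R).

Lemma integrable_spherefun f : spherefun f -> mu.-integrable S (EFin \o f).
Proof.
move=> [mf [M hM]]; apply: measurable_bounded_integrable.
- exact: measurable_Ssphere.
- by case: hmu => -> _ _; exact: ltry.
- exact: measurable_funTS.
- exists M; split; first exact: num_real.
  by move=> N MN y Sy; apply: le_trans (hM y Sy) (ltW MN).
Qed.

Lemma avD f g : spherefun f -> spherefun g -> av (fun y => f y + g y) = av f + av g.
Proof.
by move=> hf hg; rewrite RintegralD //; [exact: measurable_Ssphere|exact: integrable_spherefun..].
Qed.

Lemma avZ (c : R) f : spherefun f -> av (fun y => c * f y) = c * av f.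
Proof.
by move=> hf; rewrite RintegralZl //; [exact: measurable_Ssphere|exact: integrable_spherefun].
Qed.

Lemma av_sum (I : Type) (s : seq I) (P : pred I) (f : I -> E -> R) :
  (forall k, spherefun (f k)) ->
  av (fun y => \sum_(k <- s | P k) f k y) = \sum_(k <- s | P k) av (f k).
Proof.
move=> h; elim: s => [|k s IH].
  under eq_Rintegral do rewrite big_nil.
  by rewrite big_nil Rintegral_cst ?mul0r //; exact: measurable_Ssphere.
under eq_Rintegral do rewrite big_cons.
rewrite big_cons; case: (P k) => //.
by rewrite avD ?IH //; exact: spherefun_sum.
Qed.

Lemma av_cst (c : R) : av (fun=> c) = c.
Proof.
rewrite Rintegral_cst; last exact: measurable_Ssphere.
by case: hmu => -> _ _; rewrite mulr1.
Qed.

Lemma av_rot (Q : 'M[R]_d.+1) f : Q *m Q^T = 1%:M -> \det Q = 1 -> spherefun f ->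
  av (fun y => f ((y : V) *m Q : V)) = av f.
Proof.
move=> QQ detQ hf; pose phi := fun y : E => ((y : V) *m Q : V) : E.
have mphi : measurable_fun [set: E] phi by exact: measurable_mulmxr.
have mf : measurable_fun [set: E] (EFin \o f) by apply/measurable_EFinP; case: hf.
have pS : phi @^-1` S = S by exact: Ssphere_mulmx.
have hfp : spherefun (f \o phi).
  case: hf => mf' [M hM]; split; first exact: measurableT_comp.
  by exists M => y Sy; apply: hM; move: Sy; rewrite -{1}pS.
congr fine.
have := @integral_pushforward _ _ E E R phi mphi mu S (EFin \o f) mf _ (measurable_Ssphere R d).
rewrite pS => <-; last exact: integrable_spherefun.
apply: eq_measure_integral => A mA _.
by case: hmu => _ _ /(_ Q QQ detQ A mA).
Qed.

Lemma spherefun_mulmx (Q : 'M[R]_d.+1) f : Q *m Q^T = 1%:M -> spherefun f ->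
  spherefun (fun y => f ((y : V) *m Q : V)).
Proof.
move=> QQ [mf [M hM]]; split.
  by apply: (measurableT_comp mf); exact: measurable_mulmxr.
by exists M => y Sy; apply: hM; rewrite /Ssphere /= dotv_mulmx.
Qed.

Lemma dotv_planerot (i j : 'I_d.+1) c s (x y : V) : i != j ->
  dotv x (y *m planerot R d i j c s) = dotv x y +
    x ord0 i * ((c - 1) * y ord0 i - s * y ord0 j) + x ord0 j * ((c - 1) * y ord0 j + s * y ord0 i).
Proof.
move=> ij; rewrite /dotv.
under eq_bigr do rewrite planerotE.
rewrite (bigD1 i) //= (bigD1 j) 1?eq_sym //= [in RHS](bigD1 i) //= [in RHS](bigD1 j) 1?eq_sym //=.
rewrite !eqxx ?[j == i]eq_sym ?(negbTE ij).
rewrite (eq_bigr (fun k => x ord0 k * y ord0 k)); last first.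
  by move=> k /andP[/negbTE -> /negbTE ->].
by ring.
Qed.

(** These are polynomials in the rotation parameter whose coefficients depend on the point [y]. *)
Definition spherepoly (P : E -> {poly R}) := forall l, spherefun (fun y => (P y)`_l).

Lemma spherepoly_cst p : spherepoly (fun=> p).
Proof. by move=> l; exact: spherefun_cst. Qed.

Lemma spherepolyC f : spherefun f -> spherepoly (fun y => (f y)%:P).
Proof.
move=> hf l; case: l => [|l]; under eq_fun do rewrite coefC /=; first by [].
exact: spherefun_cst.
Qed.

Lemma spherepolyD P Q : spherepoly P -> spherepoly Q -> spherepoly (fun y => P y + Q y).
Proof.
by move=> hP hQ l; under eq_fun do rewrite coefD; exact: spherefunD.
Qed.

Lemma spherepolyM P Q : spherepoly P -> spherepoly Q -> spherepoly (fun y => P y * Q y).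
Proof.
move=> hP hQ l; under eq_fun do rewrite coefM.
by apply: spherefun_sum => k; exact: spherefunM.
Qed.

Lemma spherepolyX P n : spherepoly P -> spherepoly (fun y => P y ^+ n).
Proof.
move=> hP; elim: n => [|n IH]; first exact: spherepoly_cst.
by under eq_fun do rewrite exprS; exact: spherepolyM.
Qed.

(** The averaged polynomial agrees with [c (1 + h^2)^m] at all natural [h], hence identically, and
    the latter is even in [h]. Differentiation under the integral sign is thereby avoided. *)
Lemma av_coef1 (P : E -> {poly R}) (D m : nat) (c : R) : spherepoly P ->
  (forall y, (size (P y) <= D)%N) ->
  (forall h, av (fun y => (P y).[h]) = c * (1 + h ^+ 2) ^+ m) ->
  av (fun y => (P y)`_1) = 0.
Proof.
move=> hP sP hav.
pose q : {poly R} := \poly_(l < D) av (fun y => (P y)`_l).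
have hq h : q.[h] = c * (1 + h ^+ 2) ^+ m.
  rewrite horner_poly -hav.
  under [RHS]eq_Rintegral => y _ do rewrite (horner_coef_wide _ (sP y)).
  rewrite av_sum.
    apply: eq_bigr => l _; rewrite mulrC -avZ //.
    by apply: eq_Rintegral => y _; rewrite mulrC.
  by move=> l; under eq_fun do rewrite mulrC; exact: spherefunZ.
have qE : q = c%:P * (1 + 'X^2) ^+ m.
  apply/eqP; rewrite -subr_eq0; apply/eqP.
  set w := q - _.
  apply: (@roots_geq_poly_eq0 R w [seq n%:R | n <- iota 0 (size w)]).
  - apply/allP => _ /mapP[n _ ->]; rewrite /root /w.
    by rewrite !(hornerE, horner_exp) /= hq subrr.
  - rewrite map_inj_uniq ?iota_uniq // => x y /eqP; rewrite eqr_nat => /eqP //.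
  - by rewrite size_map size_iota.
have q1 : q`_1 = 0.
  rewrite -[1%N]/(0.+1) -[q`_0.+1]mulr1n -coef_deriv qE -horner_coef0.
  rewrite derivM derivC mul0r add0r deriv_exp derivD derivXn [1^`()]derivC add0r.
  by rewrite hornerM hornerMn hornerM hornerMn hornerX !(mul0rn, mul0r, mulr0).
have := q1; rewrite coef_poly; case: ltnP => // D1 _.
transitivity (av (fun=> 0)); last exact: av_cst.
by apply: eq_Rintegral => y _; rewrite nth_default // (leq_trans (sP y)).
Qed.

Variable x : V.

(** The derivative of [(x.y)^m y_i] along the rotation field of the plane [(i, j)] has mean zero. *)
Lemma av_infinitesimal_rot (i j : 'I_d.+1) (m : nat) : i != j ->
  av (fun y : E => m%:R * dotv x y ^+ m.-1 *
        (x ord0 j * (y : V) ord0 i - x ord0 i * (y : V) ord0 j) * (y : V) ord0 i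
      - dotv x y ^+ m * (y : V) ord0 j) = 0.
Proof.
move=> ij.
pose A (y : E) := x ord0 i * (y : V) ord0 i + x ord0 j * (y : V) ord0 j.
pose B (y : E) := x ord0 j * (y : V) ord0 i - x ord0 i * (y : V) ord0 j.
(* [L] and [M] are the rotated [x.y] and [y_i] multiplied by [1 + h^2], which clears the
   denominators of [halfrot]; their linear coefficients are twice the infinitesimal variations. *)
pose L (y : E) : {poly R} := (dotv x y)%:P + (2 * B y)%:P * 'X + (dotv x y - 2 * A y)%:P * 'X^2.
pose M (y : E) : {poly R} := ((y : V) ord0 i)%:P + (- 2 * (y : V) ord0 j)%:P * 'X + (- (y : V) ord0 i)%:P * 'X^2.
pose P y := L y ^+ m * M y.
have hy k : spherefun (fun y : E => (y : V) ord0 k) by exact: spherefun_coord.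
have ht : spherefun (fun y : E => dotv x y) by exact: spherefun_dotv.
have hB : spherefun (fun y : E => 2 * B y).
  apply: spherefunZ; apply: spherefunD; first exact: spherefunZ.
  by under eq_fun do rewrite -mulNr; exact: spherefunZ.
have hA : spherefun (fun y : E => dotv x y - 2 * A y).
  apply: spherefunD => //; under eq_fun do rewrite -mulNr.
  by apply: spherefunZ; apply: spherefunD; exact: spherefunZ.
have hP : spherepoly P.
  apply: spherepolyM; first apply: spherepolyX.
    apply: spherepolyD; first apply: spherepolyD; first exact: spherepolyC.
      by apply: spherepolyM; [exact: spherepolyC|exact: spherepoly_cst].
    by apply: spherepolyM; [exact: spherepolyC|exact: spherepoly_cst].
  apply: spherepolyD; first apply: spherepolyD; first exact: spherepolyC.
    apply: spherepolyM; [apply: spherepolyC; exact: spherefunZ|exact: spherepoly_cst].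
  apply: spherepolyM; last exact: spherepoly_cst.
  by apply: spherepolyC; under eq_fun do rewrite -mulN1r; exact: spherefunZ.
have size_quad (a b c : R) : (size (a%:P + b%:P * 'X + c%:P * 'X^2)%R <= 3)%N.
  apply/leq_sizeP => -[|[|[|l]]] // _.
  by rewrite !coefD !coefCM coefC coefX coefXn !mulr0 !addr0.
have sP y : (size (P y) <= m * 2 + 3)%N.
  apply: leq_trans (size_polyMleq _ _) _.
  have s1 := size_poly_exp_leq (L y) m; have s2 := size_quad _ _ _ : (size (L y) <= 3)%N.
  have s3 := size_quad _ _ _ : (size (M y) <= 3)%N.
  have s4 : ((size (L y)).-1 * m <= m * 2)%N.
    by rewrite mulnC leq_mul2l; move: s2; case: (size _) => [|[|[|[|?]]]] //; rewrite orbT.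
  by move: s1 s3 s4; move: (size (L y ^+ m)) (size (M y)) ((size (L y)).-1 * m)%N => u v w; lia.
have hrot h : av (fun y => (P y).[h]) =
    av (fun y : E => dotv x y ^+ m * (y : V) ord0 i) * (1 + h ^+ 2) ^+ m.+1.
  have [QQ detQ] := halfrot_SO R d i j ij h.
  have hg : spherefun (fun y : E => dotv x y ^+ m * (y : V) ord0 i).
    by apply: spherefunM => //; exact: spherefunX.
  have hh : 1 + h ^+ 2 != 0 by apply: lt0r_neq0; have := sqr_ge0 h; lra.
  rewrite -(av_rot _ _ QQ detQ hg) mulrC -avZ; last first.
    exact: (spherefun_mulmx _ _ QQ hg).
  apply: eq_Rintegral => y _.
  rewrite /halfrot dotv_planerot // planerotE eqxx.
  set t := dotv x y; set c := _ / _; set s := _ / _.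
  have eL : (L y).[h] = (1 + h ^+ 2) * (t + x ord0 i * ((c - 1) * (y : V) ord0 i - s * (y : V) ord0 j)
       + x ord0 j * ((c - 1) * (y : V) ord0 j + s * (y : V) ord0 i)).
    by rewrite /L !(hornerE, horner_exp) /= /A /B /c /s -/t; field.
  have eM : (M y).[h] = (1 + h ^+ 2) * (c * (y : V) ord0 i - s * (y : V) ord0 j).
    by rewrite /M !(hornerE, horner_exp) /= /c /s; field.
  by rewrite /P hornerM horner_exp eL eM exprMn [_ ^+ m.+1]exprSr mulrACA.
have := av_coef1 P _ _ _ hP sP hrot.
have -> : av (fun y => (P y)`_1) = av (fun y : E => 2 * (m%:R * dotv x y ^+ m.-1 *
        (x ord0 j * (y : V) ord0 i - x ord0 i * (y : V) ord0 j) * (y : V) ord0 i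
      - dotv x y ^+ m * (y : V) ord0 j)).
  apply: eq_Rintegral => y _.
  rewrite -[1%N]/(0.+1) -[_`_0.+1]mulr1n -coef_deriv -horner_coef0 /P derivM deriv_exp.
  have L0 : (L y).[0] = dotv x y by rewrite /L !(hornerE, horner_exp) /=; ring.
  have M0 : (M y).[0] = (y : V) ord0 i by rewrite /M !(hornerE, horner_exp) /=; ring.
  have dq (a b c : R) : ((a%:P + b%:P * 'X + c%:P * 'X^2)^`()).[0] = b.
    rewrite !derivD !derivM !derivC !derivX !(hornerE, horner_exp) /=; ring.
  have L1 : ((L y)^`()).[0] = 2 * B y by exact: dq.
  have M1 : ((M y)^`()).[0] = - 2 * (y : V) ord0 j by exact: dq.
  by rewrite hornerD !hornerM hornerMn hornerM !horner_exp L0 M0 L1 M1 /B -mulr_natl; ring.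
rewrite avZ; last first.
  apply: spherefunD.
    apply: spherefunM => //; apply: spherefunM; first by apply: spherefunZ; exact: spherefunX.
    apply: spherefunD; first exact: spherefunZ.
    by under eq_fun do rewrite -mulNr; exact: spherefunZ.
  under eq_fun do rewrite -mulN1r; apply: spherefunZ.
  by apply: spherefunM => //; exact: spherefunX.
by move/eqP; rewrite mulf_eq0 pnatr_eq0 /= => /eqP.
Qed.
End Zonal.

Section ZonalFormula.
Variables (R : realType) (d : nat) (mu : {measure set (Rd R d) -> \bar R}).
Hypothesis hmu : is_normalized_surface_measure mu.
Hypothesis d0 : (0 < d)%N.
Local Notation S := (Ssphere R d).
Local Notation E := (Rd R d).
Local Notation V := 'rV[R]_d.+1.
Local Notation spherefun := (@spherefun R d).
Local Notation av f := (\int[mu]_(y in S) f y).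
Variable x : V.
Hypothesis Sx : S x.
Local Notation wint := (@wint R).
Let a : R := d%:R / 2 - 1.

Let hy k : spherefun (fun y : E => (y : V) ord0 k). Proof. exact: spherefun_coord. Qed.
Let ht : spherefun (fun y : E => dotv x y). Proof. exact: spherefun_dotv. Qed.
Let htX m : spherefun (fun y : E => dotv x y ^+ m). Proof. exact: spherefunX. Qed.

Lemma spherefun_infinitesimal (i j : 'I_d.+1) (m : nat) :
  spherefun (fun y : E => m%:R * dotv x y ^+ m.-1 *
        (x ord0 j * (y : V) ord0 i - x ord0 i * (y : V) ord0 j) * (y : V) ord0 i
      - dotv x y ^+ m * (y : V) ord0 j).
Proof.
apply: spherefunD.
  apply: spherefunM => //; apply: spherefunM; first exact: spherefunZ.
  apply: spherefunD; first exact: spherefunZ.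
  by under eq_fun do rewrite -mulNr; exact: spherefunZ.
under eq_fun do rewrite -mulN1r; apply: spherefunZ.
exact: spherefunM.
Qed.

(* Sum over [i] and [j] the identities [av_infinitesimal_rot], weighted by
   [x_j]. *)
Lemma av_moment (m : nat) :
  av (fun y => m%:R * dotv x y ^+ m.-1) - (m + d)%:R * av (fun y => dotv x y ^+ m.+1) = 0.
Proof.
pose D i j (y : E) := m%:R * dotv x y ^+ m.-1 *
        (x ord0 j * (y : V) ord0 i - x ord0 i * (y : V) ord0 j) * (y : V) ord0 i
      - dotv x y ^+ m * (y : V) ord0 j.
have hD i j : spherefun (D i j) by exact: spherefun_infinitesimal.
have : av (fun y => \sum_i \sum_(j | i != j) x ord0 j * D i j y) = 0.
  rewrite av_sum //; last by move=> i; apply: spherefun_sum => j; exact: spherefunZ.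
  rewrite big1 // => i _; rewrite (av_sum _ _ _ hmu); last by move=> j; exact: spherefunZ.
  by rewrite big1 // => j ij; rewrite avZ // av_infinitesimal_rot // mulr0.
rewrite -avZ // => h.
have {h} : av (fun y => m%:R * dotv x y ^+ m.-1 + - 1 * ((m + d)%:R * dotv x y ^+ m.+1)) = 0.
  rewrite -[RHS]h; apply: eq_Rintegral => y; rewrite inE => Sy.
  have e (i j : 'I_d.+1) : x ord0 j * D i j y = m%:R * dotv x y ^+ m.-1 *
       (x ord0 j ^+ 2 * (y : V) ord0 i ^+ 2 - (x ord0 i * (y : V) ord0 i) * (x ord0 j * (y : V) ord0 j))
     - dotv x y ^+ m * (x ord0 j * (y : V) ord0 j).
    by rewrite /D; ring.
  have s1 i : \sum_(j | i != j) x ord0 j * D i j y =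
     m%:R * dotv x y ^+ m.-1 * ((y : V) ord0 i ^+ 2 - x ord0 i * (y : V) ord0 i * dotv x y)
     - dotv x y ^+ m * (dotv x y - x ord0 i * (y : V) ord0 i).
    have -> : \sum_(j | i != j) x ord0 j * D i j y = \sum_j x ord0 j * D i j y - x ord0 i * D i i y.
      rewrite [in RHS](bigD1 i) //= addrAC subrr add0r.
      by apply: eq_bigl => j; rewrite eq_sym.
    under eq_bigr do rewrite e.
    rewrite sumrB -!mulr_sumr sumrB -mulr_suml -mulr_sumr -/(dotv x y).
    have -> : \sum_j x ord0 j ^+ 2 = 1.
      by move: Sx; rewrite /Ssphere /= /dotv => <-; apply: eq_bigr => j _; rewrite expr2.
    by rewrite e; ring.
  under eq_bigr do rewrite s1.
  rewrite sumrB -!mulr_sumr !sumrB -mulr_suml -/(dotv x y).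
  have -> : \sum_i (y : V) ord0 i ^+ 2 = 1.
    by move: Sy; rewrite /Ssphere /= /dotv => <-; apply: eq_bigr => j _; rewrite expr2.
  rewrite sumr_const card_ord -(mulr_natr (dotv x y)) natrD -[d.+1%:R]natr1.
  clear h D hD e s1; case: m => [|m'] /=; first by ring.
  by rewrite -!natr1 !exprS; ring.
have h1 : spherefun (fun y : E => m%:R * dotv x y ^+ m.-1) by exact: spherefunZ.
have h2 : spherefun (fun y : E => (m + d)%:R * dotv x y ^+ m.+1) by exact: spherefunZ.
by rewrite (avD _ _ _ hmu _ _ h1 (spherefunZ _ _ _ _ h2)) (avZ _ _ _ hmu _ _ h2) mulN1r.
Qed.

Lemma av_power (m : nat) : av (fun y => dotv x y ^+ m) * wint a a 1 = wint a a 'X^m.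
Proof.
have dr : 0 < d%:R :> R by rewrite ltr0n.
have a1 : -1 < a by rewrite /a; lra.
have step n : n%:R * wint a a 'X^(n.-1) = (n + d)%:R * wint a a 'X^(n.+1).
  have := wint_parts R a a 'X^n a1 a1; rewrite derivXn => h.
  have e1 : (1 - 'X) * (1 + 'X) * ('X^(n.-1) *+ n) = n%:R%:P * ('X^(n.-1) : {poly R}) - n%:R%:P * 'X^(n.+1).
    case: n {h} => [|n]; first by rewrite !mulr0n polyC0 mulr0 !mul0r subrr.
    by rewrite -mulr_natl -polyC_natr /= !exprS; ring.
  have e2 : wint a a ((1 + 'X) * 'X^n) - wint a a ((1 - 'X) * 'X^n) = 2 * wint a a 'X^(n.+1).
    by rewrite -wintB // -wintC //; congr wint; rewrite exprS -[2]/(1 + 1) polyCD polyC1; ring.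
  move: h; rewrite e1 wintB // !wintC // -[in RHS]mulrBr e2 natrD.
  by rewrite mulrA (_ : (a + 1) * 2 = d%:R) /a; lra.
(* The recursion links [m - 1] to [m + 1], so two consecutive moments are carried through the
   induction. At index 0 its left side vanishes, which makes the first moments zero. *)
have [m1 m2] : av (fun y => dotv x y ^+ m) * wint a a 1 = wint a a 'X^m /\
   av (fun y => dotv x y ^+ m.+1) * wint a a 1 = wint a a 'X^(m.+1); last by [].
have nz n : (n + d)%:R != 0 :> R by rewrite pnatr_eq0 addn_eq0 negb_and -!lt0n d0 orbT.
have st n : n%:R * av (fun y => dotv x y ^+ n.-1) = (n + d)%:R * av (fun y => dotv x y ^+ n.+1).
  by have /eqP := av_moment n; rewrite avZ // subr_eq0 => /eqP.
elim: m => [|m [IH1 IH2]]; split => //.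
- by rewrite -[RHS]mul1r; congr (_ * _); exact: (av_cst _ _ _ hmu 1).
- apply: (mulfI (nz 0%N)); rewrite mulrA -st -step /= !mul0r //.
- apply: (mulfI (nz m.+1)); rewrite mulrA -st -step /= -mulrA IH1 //.
Qed.

Lemma av_zonal (F : {poly R}) : av (fun y => F.[dotv x y]) * wint a a 1 = wint a a F.
Proof.
have dr : 0 < d%:R :> R by rewrite ltr0n.
have a1 : -1 < a by rewrite /a; lra.
under eq_Rintegral do rewrite horner_coef.
rewrite av_sum //; last by move=> k; exact: spherefunZ.
rewrite -[in RHS](coefK F) poly_def wint_sum // mulr_suml; apply: eq_bigr => i _.
by rewrite avZ // wintZ // -mulrA av_power.
Qed.

End ZonalFormula.

(** * Marcinkiewicz-Zygmund inequalities for zonal functions *)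

Section PolynomialDegree.
Variables (R : realType) (d : nat).
Local Notation E := (Rd R d).
Local Notation S := (Ssphere R d).
Implicit Types (D : nat) (f g : E -> R).

Definition poly_deg_le D f :=
  exists s : seq (R * (d.+1).-tuple nat),
    all (fun c => (\sum_(i < d.+1) tnth c.2 i <= D)%N) s /\
    forall x : E, f x = \sum_(c <- s) c.1 * \prod_(i < d.+1) (x ord0 i) ^+ tnth c.2 i.

Lemma poly_deg_le_lt D (m : R) f : poly_deg_le D f -> D%:R < m -> poly_deg_lt m f.
Proof.
move=> [s [sD fE]] Dm; exists s; split => //.
by apply: sub_all sD => c cD; apply: le_lt_trans Dm; rewrite ler_nat.
Qed.

Lemma poly_deg_leW D D' f : (D <= D')%N -> poly_deg_le D f -> poly_deg_le D' f.
Proof.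
move=> DD [s [sD fE]]; exists s; split => //.
by apply: sub_all sD => c cD; exact: leq_trans cD DD.
Qed.

Lemma poly_deg_leD D f g : poly_deg_le D f -> poly_deg_le D g ->
  poly_deg_le D (fun y => f y + g y).
Proof.
move=> [s [sD fE]] [s' [sD' gE]]; exists (s ++ s'); split; first by rewrite all_cat sD.
by move=> x; rewrite fE gE big_cat.
Qed.

Lemma poly_deg_leM D D' f g : poly_deg_le D f -> poly_deg_le D' g ->
  poly_deg_le (D + D') (fun y => f y * g y).
Proof.
move=> [s [sD fE]] [s' [sD' gE]].
exists [seq (c.1 * e.1, [tuple (tnth c.2 i + tnth e.2 i)%N | i < d.+1]) | c <- s, e <- s'].
split.
  apply/allP => _ /allpairsP[[c e] /= [cs es ->]] /=.
  under eq_bigr do rewrite tnth_mktuple.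
  by rewrite big_split leq_add //; [exact: (allP sD)|exact: (allP sD')].
move=> x; rewrite fE gE big_allpairs_dep big_distrlr /=.
apply: eq_bigr => c _; apply: eq_bigr => e _.
rewrite mulrACA -big_split /=; congr (_ * _); apply: eq_bigr => i _.
by rewrite tnth_mktuple exprD.
Qed.

Lemma poly_deg_le_cst (c : R) : poly_deg_le 0 (fun=> c).
Proof.
exists [:: (c, [tuple 0%N | i < d.+1])]; split.
  by rewrite /= andbT; under eq_bigr do rewrite tnth_mktuple; rewrite sum_nat_const muln0.
move=> x; rewrite big_seq1 /=; under eq_bigr do rewrite tnth_mktuple expr0.
by rewrite big1 ?mulr1.
Qed.

Lemma poly_deg_le_coord k : poly_deg_le 1 (fun y => (y : 'rV[R]_d.+1) ord0 k).
Proof.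
exists [:: (1, [tuple (i == k : nat) | i < d.+1])]; split.
  rewrite /= andbT; under eq_bigr do rewrite tnth_mktuple.
  by rewrite (bigD1 k) //= eqxx big1 // => i /negbTE ->.
move=> x; rewrite big_seq1 /= mul1r; under eq_bigr do rewrite tnth_mktuple.
by rewrite (bigD1 k) //= eqxx expr1 big1 ?mulr1 // => i /negbTE ->.
Qed.

Lemma poly_deg_leZ D (c : R) f : poly_deg_le D f -> poly_deg_le D (fun y => c * f y).
Proof. by rewrite -[D]add0n => h; apply: poly_deg_leM h; exact: poly_deg_le_cst. Qed.

Lemma poly_deg_le_sum (I : Type) (s : seq I) D (f : I -> E -> R) :
  (forall k, poly_deg_le D (f k)) -> poly_deg_le D (fun y => \sum_(k <- s) f k y).
Proof.
move=> h; elim: s => [|k s IH].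
  by under eq_fun do rewrite big_nil; apply: poly_deg_leW (poly_deg_le_cst 0).
under eq_fun do rewrite big_cons.
exact: poly_deg_leD.
Qed.

Lemma poly_deg_le_dotv (x : E) : poly_deg_le 1 (fun y => dotv x y).
Proof. by apply: poly_deg_le_sum => k; apply: poly_deg_leZ; exact: poly_deg_le_coord. Qed.

Lemma poly_deg_leX D f n : poly_deg_le D f -> poly_deg_le (n * D) (fun y => f y ^+ n).
Proof.
move=> hf; elim: n => [|n IH]; first exact: poly_deg_le_cst.
by under eq_fun do rewrite exprS; rewrite mulSn; exact: poly_deg_leM.
Qed.

Lemma poly_deg_le_horner (q : {poly R}) (x : E) :
  poly_deg_le (size q).-1 (fun y => q.[dotv x y]).
Proof.
under eq_fun do rewrite horner_coef.
have h (k : 'I_(size q)) : poly_deg_le (size q).-1 (fun y => q`_k * dotv x y ^+ k).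
  apply: poly_deg_leZ; apply: poly_deg_leW (poly_deg_leX _ _ k (poly_deg_le_dotv x)).
  by rewrite muln1 -ltnS (leq_trans (ltn_ord k)) // leqSpred.
exact: poly_deg_le_sum.
Qed.

Lemma spherefun_poly_deg_le D f : poly_deg_le D f -> spherefun R d f.
Proof.
move=> [s [_ fE]]; have -> : f = fun x => \sum_(c <- s) c.1 * \prod_(i < d.+1) (x ord0 i) ^+ tnth c.2 i.
  by apply/funext.
apply: spherefun_sum => c; apply: spherefunZ.
elim: (index_enum _) => [|i r IH].
  by under eq_fun do rewrite big_nil; exact: spherefun_cst.
under eq_fun do rewrite big_cons.
by apply: spherefunM => //; apply: spherefunX; exact: spherefun_coord.
Qed.

Lemma onem_dotv (x y : E) : S x -> S y ->
  1 - dotv x y = \sum_i 2^-1 * (x ord0 i - y ord0 i) ^+ 2.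
Proof.
rewrite /Ssphere /= => Sx Sy.
have e i : 2^-1 * (x ord0 i - y ord0 i) ^+ 2 =
    2^-1 * (x ord0 i * x ord0 i) + 2^-1 * (y ord0 i * y ord0 i) - x ord0 i * y ord0 i by field.
under eq_bigr do rewrite e.
by rewrite sumrB big_split /= -!mulr_sumr -/(dotv x x) -/(dotv y y) -/(dotv x y) Sx Sy; field.
Qed.

Lemma onem_dotv_ge0 (x y : E) : S x -> S y -> 0 <= 1 - dotv x y.
Proof. by move=> Sx Sy; rewrite onem_dotv // sumr_ge0 // => i _; rewrite mulr_ge0 ?sqr_ge0. Qed.

Lemma dotv_le1 (x y : E) : S x -> S y -> -1 <= dotv x y <= 1.
Proof.
move=> Sx Sy; have h1 := onem_dotv_ge0 x y Sx Sy.
have Sy' : S (- y : 'rV[R]_d.+1).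
  by move: Sy; rewrite /Ssphere /= /dotv => <-; apply: eq_bigr => i _; rewrite !mxE mulrNN.
have := onem_dotv_ge0 x _ Sx Sy'.
have -> : dotv x (- y : 'rV[R]_d.+1) = - dotv x y.
  by rewrite /dotv -sumrN; apply: eq_bigr => i _; rewrite !mxE mulrN.
by move=> h2; apply/andP; split; lra.
Qed.

Section MZ.
Variables (mu nuv : {measure set E -> \bar R}) (m c : R).
Hypothesis MZ : MZ_ineq mu nuv m c.

(** Each factor [1 - x.y] becomes a sum of squares of linear functions [x_i - y_i], and these are
    absorbed into [f]. A power of [u] therefore raises the degree being squared by a full unit,
    whence the count [N + D]. *)
Lemma MZ_onem (x : E) (N D : nat) f : S x -> poly_deg_le D f -> (N + D)%:R < m / 2 ->
  (\int[nuv]_(y in S) ((1 - dotv x y) ^+ N * f y ^+ 2)%:E <=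
   c%:E * \int[mu]_(y in S) ((1 - dotv x y) ^+ N * f y ^+ 2)%:E)%E.
Proof.
move=> Sx; elim: N D f => [|N IH] D f fD Dm.
  have := MZ f (poly_deg_le_lt _ _ _ fD Dm).
  under eq_integral do rewrite -[X in X%:E]mul1r.
  by under [in X in (_ * X)%E]eq_integral do rewrite -[X in X%:E]mul1r.
pose g i (y : E) := (x ord0 i - y ord0 i) * f y.
have gD i : poly_deg_le (1 + D) (g i).
  apply: poly_deg_leM => //; apply: poly_deg_leD.
    exact: poly_deg_leW (poly_deg_le_cst _).
  by under eq_fun do rewrite -mulN1r; apply: poly_deg_leZ; exact: poly_deg_le_coord.
have mh i : measurable_fun S (fun y => ((1 - dotv x y) ^+ N * g i y ^+ 2)%:E).
  apply/measurable_EFinP; apply: measurable_funTS.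
  suff [] : spherefun R d (fun y => (1 - dotv x y) ^+ N * g i y ^+ 2) by [].
  apply: spherefunM; last by apply: spherefunX; exact: spherefun_poly_deg_le (gD i).
  apply: spherefunX; apply: spherefunD; first exact: spherefun_cst.
  by under eq_fun do rewrite -mulN1r; apply: spherefunZ; exact: spherefun_dotv.
have mg i : measurable_fun S (fun y => (2^-1 * ((1 - dotv x y) ^+ N * g i y ^+ 2))%:E).
  apply/measurable_EFinP; apply: measurable_funM; first exact: measurable_cst.
  by have /measurable_EFinP := mh i.
have nn i y : S y -> 0 <= (1 - dotv x y) ^+ N * g i y ^+ 2.
  by move=> Sy; exact: mulr_ge0 (exprn_ge0 N (onem_dotv_ge0 _ _ Sx Sy)) (sqr_ge0 _).
have g0 i y : S y -> (0 <= (2^-1 * ((1 - dotv x y) ^+ N * g i y ^+ 2))%:E)%E.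
  by move=> Sy; rewrite lee_fin; apply: mulr_ge0; [rewrite invr_ge0|exact: nn].
have split_int (k : {measure set E -> \bar R}) :
    (\int[k]_(y in S) ((1 - dotv x y) ^+ N.+1 * f y ^+ 2)%:E =
     \sum_i 2^-1%:E * \int[k]_(y in S) ((1 - dotv x y) ^+ N * g i y ^+ 2)%:E)%E.
  transitivity (\int[k]_(y in S) \sum_i (2^-1 * ((1 - dotv x y) ^+ N * g i y ^+ 2))%:E)%E.
    apply: eq_integral => y; rewrite inE => Sy.
    rewrite sumEFin exprSr {2}onem_dotv // mulr_sumr mulr_suml; congr EFin.
    by apply: eq_bigr => i _; rewrite /g exprMn; ring.
  rewrite ge0_integral_sum //; last exact: measurable_Ssphere.
  apply: eq_bigr => i _; under eq_integral do rewrite EFinM.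
  rewrite ge0_integralZl //; [exact: measurable_Ssphere|].
  by move=> y Sy; rewrite lee_fin; exact: nn.
rewrite !split_int ge0_sume_distrr; last first.
  move=> i _; rewrite mule_ge0 ?lee_fin // integral_ge0 // => y Sy.
  by rewrite lee_fin; exact: nn.
apply: lee_sum => i _; rewrite muleCA lee_wpmul2l ?lee_fin //.
by apply: (IH (1 + D)%N) => //; rewrite addnA addn1.
Qed.

End MZ.

Lemma MZ_zonal (mu nuv : {measure set E -> \bar R}) (m c : R) (x : E) (N : nat) (q : {poly R}) :
  is_normalized_surface_measure mu -> (0 < d)%N -> 0 <= c -> MZ_ineq mu nuv m c ->
  S x -> (N + (size q).-1)%:R < m / 2 ->
  (\int[nuv]_(y in S) ((1 - dotv x y) ^+ N * q.[dotv x y] ^+ 2)%:E <=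
   (c * (wint R (d%:R / 2 - 1) (d%:R / 2 - 1) ((1 - 'X) ^+ N * q ^+ 2) /
         wint R (d%:R / 2 - 1) (d%:R / 2 - 1) 1))%:E)%E.
Proof.
move=> hmu d0 c0 MZ Sx Nq.
have dr : 0 < d%:R :> R by rewrite ltr0n.
have h := MZ_onem mu nuv m c MZ x N _ _ Sx (poly_deg_le_horner q x) Nq.
apply: (le_trans h) => {h}.
rewrite EFinM lee_wpmul2l ?lee_fin //.
set F := (1 - 'X) ^+ N * q ^+ 2.
have <- : \int[mu]_(y in S) F.[dotv x y] = wint R (d%:R / 2 - 1) (d%:R / 2 - 1) F /
   wint R (d%:R / 2 - 1) (d%:R / 2 - 1) 1.
  rewrite -(av_zonal R d mu hmu d0 x Sx) mulfK // lt0r_neq0 // wint_gt0 //; lra.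
rewrite /Rintegral fineK; last first.
  apply: integrable_fin_num; first exact: measurable_Ssphere.
  apply: integrable_spherefun => //; apply: spherefun_horner; exact: spherefun_dotv.
rewrite le_eqVlt; apply/orP; left; apply/eqP; apply: eq_integral => y _.
by rewrite /F !(hornerE, horner_exp).
Qed.

End PolynomialDegree.

(** * The kernel and the final estimate *)

Section Omega.
Variable R : realType.
Local Notation wint := (@wint R).

Lemma gamma_half_gt0 k : 0 < gamma_half R k.+1.
Proof.
have pi0 : 0 < pi :> R by exact: pi_gt0.
suff : 0 < gamma_half R k.+1 /\ 0 < gamma_half R k.+2 by case.
elim: k => [|k [h1 h2]]; first by rewrite /= sqrtr_gt0 pi0 ltr01.
split=> //; rewrite (_ : gamma_half R k.+3 = k.+1%:R / 2 * gamma_half R k.+1) //.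
by rewrite mulr_gt0 // divr_gt0.
Qed.

Lemma omega_ratioE d : (0 < d)%N ->
  omega R d / omega R d.-1 = pi `^ (2^-1) * gamma_half R d / gamma_half R d.+1.
Proof.
case: d => // d _; rewrite /omega [d.+1.-1]/=.
have pi0 : 0 < pi :> R by exact: pi_gt0.
have g1 := gamma_half_gt0 d; have g2 := gamma_half_gt0 d.+1.
have -> : pi `^ (d.+2%:R / 2) = pi `^ 2^-1 * pi `^ (d.+1%:R / 2) :> R.
  rewrite -powRD; last by rewrite (gt_eqF pi0) implybT.
  by congr (_ `^ _); rewrite -[d.+2%:R]natr1; field.
have p1 : 0 < pi `^ (d.+1%:R / 2) :> R by exact: powR_gt0.
move: g1 g2 p1; move: (gamma_half R d.+1) (gamma_half R d.+2) (pi `^ _) (pi `^ _) => u v z w u0 v0 z0.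
by field; rewrite !lt0r_neq0.
Qed.

Lemma omega_ratio_ge0 d : (0 < d)%N -> 0 <= omega R d / omega R d.-1.
Proof.
case: d => // d _; rewrite omega_ratioE // !mulr_ge0 ?powR_ge0 ?invr_ge0 //.
  by apply: ltW; exact: gamma_half_gt0.
by apply: ltW; exact: gamma_half_gt0.
Qed.

Lemma omega_ratioSS d : (0 < d)%N ->
  omega R d.+2 / omega R d.+1 = d%:R / (d%:R + 1) * (omega R d / omega R d.-1).
Proof.
move=> d0; rewrite (omega_ratioE d.+2 _) // (omega_ratioE d) //.
case: d d0 => // d _.
have g1 := gamma_half_gt0 d; have g2 := gamma_half_gt0 d.+1.
rewrite (_ : gamma_half R d.+3 = d.+1%:R / 2 * gamma_half R d.+1) //.
rewrite (_ : gamma_half R d.+4 = d.+2%:R / 2 * gamma_half R d.+2) //.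
rewrite natr1; have n1 : 0 < d.+1%:R :> R by []. have n2 : 0 < d.+2%:R :> R by [].
move: g1 g2 n1 n2; move: (gamma_half R d.+1) (gamma_half R d.+2) (pi `^ _) (d.+1%:R) (d.+2%:R).
by move=> u v z n1 n2 u0 v0 n10 n20; field; rewrite !lt0r_neq0.
Qed.

Lemma wint_oneSS_half d : (0 < d)%N ->
  wint (d.+2%:R / 2 - 1) (d.+2%:R / 2 - 1) 1 =
  d%:R / (d%:R + 1) * wint (d%:R / 2 - 1) (d%:R / 2 - 1) 1.
Proof.
move=> d0; have dr : 0 < d%:R :> R by rewrite ltr0n.
have -> : d.+2%:R / 2 - 1 = d%:R / 2 - 1 + 1 :> R by rewrite -!natr1; field.
rewrite wint_oneSS; [|lra|lra].
congr (_ * _); field.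
by do ?(apply/andP; split); apply: lt0r_neq0; lra.
Qed.

(** The quotient [r d / Z d] does not change when [d] grows by two, so its values at 0 and 1 control
    all others. *)
Lemma two_step_bound (r Z q : nat -> R) :
  (forall d, 0 <= r d) -> (forall d, 0 < Z d) -> (forall d, 0 <= q d) ->
  (forall d, r d.+2 = q d * r d) -> (forall d, Z d.+2 = q d * Z d) ->
  exists c, 0 < c /\ forall d, r d <= c * Z d.
Proof.
move=> r0 Z0 q0 rS ZS.
have h0 d : 0 <= r d / Z d by rewrite divr_ge0 // ltW.
exists (1 + r 0%N / Z 0%N + r 1%N / Z 1%N); split.
  by rewrite -addrA ltr_pwDl // addr_ge0.
move=> d; set c := 1 + _ + _.
suff h : r d <= c * Z d /\ r d.+1 <= c * Z d.+1 by case: h.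
elim: d => [|d [h1 h2]]; split => //.
- by rewrite -ler_pdivrMr // /c -addrA addrCA lerDl addr_ge0.
- by rewrite -ler_pdivrMr // /c lerDr addr_ge0.
- by rewrite rS ZS [leRHS]mulrCA; apply: ler_wpM2l.
Qed.

(* Both sides satisfy the same two-step recursion in [d]; comparing the first
   two values avoids evaluating either in closed form. *)
Lemma omega_ratio_bound : exists c : R, 0 < c /\ forall d, (0 < d)%N ->
  omega R d / omega R d.-1 <= c * wint (d%:R / 2 - 1) (d%:R / 2 - 1) 1.
Proof.
have [|||||c [c0 hc]] := two_step_bound (fun d => omega R d.+1 / omega R d)
   (fun d => wint (d.+1%:R / 2 - 1) (d.+1%:R / 2 - 1) 1) (fun d => d.+1%:R / (d.+1%:R + 1)).
- by move=> d; exact: (omega_ratio_ge0 d.+1).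
- by move=> d; have dr : 0 < d.+1%:R :> R by []; apply: wint_gt0; lra.
- by move=> d; rewrite divr_ge0.
- by move=> d; exact: (omega_ratioSS d.+1).
- by move=> d; exact: (wint_oneSS_half d.+1).
by exists c; split => // -[].
Qed.

End Omega.

Section JacobiSpec.
Variable R : realType.

(** [xget] returns the zero sequence if nothing meets the specification. Keeping this alternative
    spares the construction of orthonormal polynomials; in the second case the kernel or the Jacobi
    quotient is zero. *)
Lemma jacobi_seq_orth (a b : R) : -1 < a -> -1 < b ->
  (forall l, size (jacobi_seq a b l) = l.+1) /\
  (forall l m, wint R a b (jacobi_seq a b l * jacobi_seq a b m) = (l == m)%:R)
  \/ forall l, jacobi_seq a b l = 0.
Proof.
move=> a1 b1; have [[P hP]|nP] := pselect (exists P, jacobi_spec a b P); last first.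
  right => l; rewrite /jacobi_seq xgetPN // => P /= hP; apply: nP; by exists P.
have [h1 h2] : jacobi_spec a b (jacobi_seq a b).
  by rewrite /jacobi_seq; apply: (@xgetPex _ (fun=> 0) [set P | jacobi_spec a b P]); exists P.
left; split => [l|l m]; first by case: (h1 l).
have := h2 l m.
rewrite -[X in (X = _)%E -> _]/(\int[lebesgue_measure]_(x in `[(-1)%R, 1%R]%classic)
  ((jacobi_seq a b l).[x] * (jacobi_seq a b m).[x] * jacobi_weight a b x)%:E)%E.
under eq_integral do rewrite -hornerM.
by rewrite -EFin_wint // => -[].
Qed.

End JacobiSpec.

Section ZonalSums.
Variables (R : realType) (d : nat).
Local Notation E := (Rd R d).
Local Notation S := (Ssphere R d).
Local Notation wint := (@wint R).

Lemma MZ_zonal_sum (mu nuv : {measure set E -> \bar R}) (m c : R) (x : E)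
    (s : seq (R * (nat * {poly R}))) :
  is_normalized_surface_measure mu -> (0 < d)%N -> 0 <= c -> MZ_ineq mu nuv m c -> S x ->
  (forall e, e \in s -> 0 <= e.1 /\ (e.2.1 + (size e.2.2).-1)%:R < m / 2) ->
  (\int[nuv]_(y in S) (\sum_(e <- s) e.1 * ((1 - dotv x y) ^+ e.2.1 * e.2.2.[dotv x y] ^+ 2))%:E <=
   (c * (\sum_(e <- s) e.1 * wint (d%:R / 2 - 1) (d%:R / 2 - 1) ((1 - 'X) ^+ e.2.1 * e.2.2 ^+ 2)
      / wint (d%:R / 2 - 1) (d%:R / 2 - 1) 1))%:E)%E.
Proof.
move=> hmu d0 c0 MZ Sx.
have mS := measurable_Ssphere R d.
have nn (N : nat) (q : {poly R}) y : S y -> 0 <= (1 - dotv x y) ^+ N * q.[dotv x y] ^+ 2.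
  by move=> Sy; exact: mulr_ge0 (exprn_ge0 N (onem_dotv_ge0 _ _ _ _ Sx Sy)) (sqr_ge0 _).
have sf (N : nat) (q : {poly R}) : spherefun R d (fun y => (1 - dotv x y) ^+ N * q.[dotv x y] ^+ 2).
  apply: spherefunM; apply: spherefunX.
    apply: spherefunD; first exact: spherefun_cst.
    by under eq_fun do rewrite -mulN1r; apply: spherefunZ; exact: spherefun_dotv.
  by apply: spherefun_horner; exact: spherefun_dotv.
elim: s => [|e s IH] h.
  under eq_integral do rewrite big_nil.
  by rewrite integral0 big_nil mulr0.
under eq_integral do rewrite big_cons EFinD.
have e0 : 0 <= e.1 by case: (h e); rewrite ?mem_head.
have h' e' : e' \in s -> 0 <= e'.1 /\ (e'.2.1 + (size e'.2.2).-1)%:R < m / 2.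
  by move=> es; apply: h; rewrite inE es orbT.
rewrite ge0_integralD //; last 4 first.
- by move=> y Sy; rewrite lee_fin mulr_ge0 // nn.
- apply/measurable_EFinP; apply: measurable_funTS.
  by have [] := spherefunZ R d e.1 _ (sf e.2.1 e.2.2).
- move=> y Sy; rewrite lee_fin; rewrite big_seq; apply: sumr_ge0 => e' es.
  by rewrite mulr_ge0 ?nn //; case: (h' _ es).
- apply/measurable_EFinP; apply: measurable_funTS.
  suff [] : spherefun R d (fun y => \sum_(e <- s) e.1 * ((1 - dotv x y) ^+ e.2.1 * e.2.2.[dotv x y] ^+ 2)) by [].
  by apply: spherefun_sum => e'; apply: spherefunZ.
rewrite big_cons mulrDr EFinD; apply: leeD; last exact: IH.
under eq_integral do rewrite EFinM.
rewrite ge0_integralZl //; last 2 first.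
- apply/measurable_EFinP; apply: measurable_funTS; by have [] := sf e.2.1 e.2.2.
- by move=> y Sy; rewrite lee_fin nn.
have [_ hs] := h e (mem_head _ _).
have := MZ_zonal R d mu nuv m c x e.2.1 e.2.2 hmu d0 c0 MZ Sx hs.
move/(lee_wpmul2l (x := e.1%:E)); rewrite lee_fin => /(_ e0) hh; apply: le_trans hh _.
by rewrite -EFinM lee_fin mulrCA -[in leRHS]mulrA.
Qed.

End ZonalSums.

(** * Moments of the Jacobi polynomial of degree [dn], uniformly in [d] *)

Section OneDim.
Variable R : realType.
Local Notation wint := (@wint R).
Local Notation leb := (@lebesgue_measure R).

Lemma wint_le2 (a b a1 b1 a2 b2 c1 c2 : R) (F G : {poly R}) :
  -1 < a -> -1 < b -> -1 < a1 -> -1 < b1 -> -1 < a2 -> -1 < b2 ->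
  (forall x, -1 <= x <= 1 -> G.[x] * jacobi_weight a b x <=
     F.[x] * (c1 * jacobi_weight a1 b1 x + c2 * jacobi_weight a2 b2 x)) ->
  wint a b G <= c1 * wint a1 b1 F + c2 * wint a2 b2 F.
Proof.
move=> a0 b0 a10 b10 a20 b20 h.
have mI : measurable (`[(-1 : R), 1]%classic : set R) by exact: measurable_itv.
have i1 := integrable_poly_weight R a1 b1 (c1%:P * F) a10 b10.
have i2 := integrable_poly_weight R a2 b2 (c2%:P * F) a20 b20.
rewrite -!wintC // /wint -(RintegralD _ i1 i2) //.
apply: le_Rintegral => //; first exact: integrable_poly_weight.
  by have := @integrableD _ _ _ leb _ mI _ _ i1 i2.
move=> x; rewrite /= in_itv /= => x1.
rewrite !hornerM !hornerC; have := h x x1.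
move: (jacobi_weight a b x) (jacobi_weight a1 b1 x) (jacobi_weight a2 b2 x) => u v w.
by lra.
Qed.

(** The orthonormality weight has exponents [d / 2 + r] and [d / 2 - 2], so moving one power from
    [1 - t] to [1 + t] gives the sphere weight times [(1 - t)^r]: this is [first_moment]. Without
    the factor [(1 - t)^r], interpolate between that moment and the one [j] powers lower, bounded by
    the Hardy iteration with [E] of order [n^2]. *)
Lemma zonal_moment_bound (r : R) : 0 <= r -> exists C : R, 0 < C /\
  forall (d k : nat) (n : R) (P : nat -> {poly R}),
  (3 <= d)%N -> d%:R * n = k%:R -> (d%:R + r + 1) ^+ 2 <= n * d%:R ->
  (forall l, size (P l) = l.+1) ->
  (forall l m, wint (d%:R / 2 + r) (d%:R / 2 - 2) (P l * P m) = (l == m)%:R) ->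
  wint (d%:R / 2 - 1 + r) (d%:R / 2 - 1) (P k * P k) <= C * n /\
  wint (d%:R / 2 - 1) (d%:R / 2 - 1) (P k * P k) <= C * n `^ (2 * r) * n.
Proof.
move=> r0; have [N [dl [rE dl0 dl1]]] := powR_floor R r r0.
pose j := N.+1.
have rj : r <= j%:R by rewrite /j -natr1 rE; lra.
(* [432 = 3 * 4 * 36]: the right side of [HE] is at least [(D / 6)^2 / 4 * q n^2 = 3 K^2], while its
   left side is at most [3 K^2]. Hiding the value behind [qE] keeps it symbolic. *)
have [q qE] : exists q : R, q = 432 by exists 432.
have q1 : 1 <= q by rewrite qE; lra.
have q0 : 0 <= q := le_trans ler01 q1.
exists (5 * (1 + q ^+ j)); split.
  by rewrite mulr_gt0 // ltr_pwDl // exprn_ge0.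
move=> d k n P d3 dn nd sP oP.
have dr : 3 <= d%:R :> R by rewrite (ler_nat R 3).
set D : R := d%:R in dr dn nd oP *; set K : R := k%:R in dn.
have nD : D + 2 * r + 2 <= n.
  rewrite -(ler_pM2r (_ : 0 < D)); last by lra.
  apply: le_trans nd; have := sqr_ge0 r; have : 0 <= r * D by rewrite mulr_ge0 //; lra.
  lra.
have n0 : 0 < n by lra.
pose al := D / 2 + r; pose be := D / 2 - 2.
have be1 : -1 < be by rewrite /be; lra.
have al0 : 0 < al by rewrite /al; lra.
have e1 : D / 2 - 1 + r = al - 1 by rewrite /al; ring.
have e2 : D / 2 - 1 = be + 1 by rewrite /be; ring.
have X1 := first_moment R al be P k al0 be1 sP oP.
(* The [- 1] leaves room for [Y 0 = 1] in the sum [X 0 + Y 0]. *)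
have X1le : wint (al - 1) (be + 1) (P k * P k) <= 5 * n - 1.
  rewrite X1 ler_pdivrMr // -/K -dn /al /be.
  have : 0 <= (n - 1) * r by rewrite mulr_ge0 //; lra.
  have : 0 <= (n - 5) * (D / 2) by rewrite mulr_ge0; lra.
  lra.
split.
  rewrite e1 e2 (le_trans X1le) // mulrAC.
  have : 0 <= 5 * n * q ^+ j by rewrite !mulr_ge0 ?exprn_ge0 // ltW.
  lra.
have jal : j%:R <= r + 1 by rewrite /j -natr1 rE; lra.
(* From [j <= r + 1] the difference is at least [D / 2 - 1], and [D >= 3]. *)
have aj : D / 6 <= al - j%:R by rewrite /al; lra.
have J0 : j%:R < al by lra.
have p1 : -1 < D / 2 - 1 by lra.
have p2 : -1 < al - 1 by rewrite /al; lra.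
have p3 : -1 < be + 1 by rewrite /be; lra.
have p4 : -1 < al - j%:R - 1 by lra.
have W : wint (D / 2 - 1) (D / 2 - 1) (P k * P k) <=
   (n ^+ 2) `^ r * wint (al - 1) (be + 1) (P k * P k) +
   (n ^+ 2) `^ r * (n ^+ 2) ^- j * wint (al - j%:R - 1) (be + 1) (P k * P k).
  apply: (wint_le2 _ _ _ _ _ _ _ _ _ _ p1 p1 p2 p3 p4 p3) => x /andP[x1 x2].
    apply: ler_wpM2l; first by rewrite hornerM -expr2 sqr_ge0.
    rewrite /jacobi_weight -e2.
    have x0 : 0 <= 1 - x by lra.
    have m0 : 0 < n ^+ 2 by rewrite exprn_gt0.
    have a0 : 0 < D / 2 - 1 by lra.
    have := powR_interp R (1 - x) (n ^+ 2) (D / 2 - 1) r j x0 m0 a0 r0 rj.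
    have -> : D / 2 - 1 + r - j%:R = al - j%:R - 1 by rewrite /al; ring.
    rewrite e1 => h.
    have := ler_wpM2r (powR_ge0 (1 + x) (D / 2 - 1)) h.
    move: {h} ((n ^+ 2) `^ r) ((1 - x) `^ (D / 2 - 1)) ((1 - x) `^ (al - 1)) ((1 - x) `^ (al - j%:R - 1)) ((1 + x) `^ (D / 2 - 1)) ((n ^+ 2) ^- j).
    by clear => t1 t2 t3 t4 t5 t6 h; lra.
apply: (le_trans W) => {W}.
have nn1 : 1 <= n ^+ 2 by rewrite exprn_ege1 //; lra.
have E1 : 1 <= q * n ^+ 2.
  by rewrite -[leLHS]mulr1 ler_pM.
have ode := orth_ode R al be P (lt_trans (ltrN10 _) al0) be1 sP oP k.
have KD : K = D * n by rewrite dn.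
have HE : jeig R al be k + al * (be + 1) / 2 <= (al - j%:R) ^+ 2 / 4 * (q * n ^+ 2).
  apply: (@le_trans _ _ ((D / 6) ^+ 2 / 4 * (q * n ^+ 2))); last first.
    apply: ler_wpM2r; first exact: le_trans E1.
    apply: ler_wpM2r; first by rewrite invr_ge0.
    by rewrite ler_sqr ?nnegrE; lra.
  have -> : (D / 6) ^+ 2 / 4 * (q * n ^+ 2) = 3 * K ^+ 2 by rewrite qE KD; field.
  have kD : (D + r + 1) ^+ 2 <= K by rewrite KD mulrC.
  have Dr : D + r + 1 <= (D + r + 1) ^+ 2 by rewrite expr2 ler_peMl //; lra.
  have K1 : 1 <= K by lra.
  have KK : K <= K ^+ 2 by rewrite expr2 ler_peMl //; lra.
  have h1 : K * (D + r - 1) <= K * K by rewrite ler_wpM2l //; lra.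
  have h2 : al * (be + 1) <= (D + r + 1) * (D + r + 1).
    by rewrite ler_pM // /al /be; lra.
  rewrite /jeig -/K; have -> : K + al + be + 1 = K + (D + r - 1) by rewrite /al /be; field.
  move: h2 kD; rewrite /= -expr2 => h2 kD.
  lra.
have mb := @moment_bound R al be (jeig R al be k) (q * n ^+ 2) (P k) j J0 be1 E1 ode HE j (leqnn j).
rewrite subr0 oP eqxx mulr1n (exprMn _ q) -mulrA in mb.
have -> : (n ^+ 2) `^ r = n `^ (2 * r).
  by rewrite -powR_mulrn ?(ltW n0) // -powRrM.
have T0 : 0 <= n `^ (2 * r) by exact: powR_ge0.
have m0 : 0 < (n ^+ 2) ^+ j by rewrite !exprn_gt0.
have Q0 : 0 <= q ^+ j by rewrite exprn_ge0.
move: m0 Q0 T0 mb X1le n0; rewrite -mulrA.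
move: (wint (al - 1) _ _) (wint (al - j%:R - 1) _ _) ((n ^+ 2) ^+ j) (q ^+ j) (n `^ (2 * r)).
clear => X Y M Q T m0 Q0 T0 mb X1le n0.
have X5 : X <= 5 * n by lra.
have Y5 : M^-1 * Y <= Q * (5 * n).
  rewrite mulrC ler_pdivrMr // (le_trans mb) // -mulrA; apply: ler_wpM2l => //.
  by rewrite mulrC; apply: ler_wpM2r; [exact: ltW|lra].
have := ler_wpM2l T0 X5; have := ler_wpM2l T0 Y5.
by lra.
Qed.

End OneDim.

Section Kernel.
Variable R : realType.
Local Notation wint := (@wint R).

Lemma wint_sqr_sum (a b : R) (P : nat -> {poly R}) (c : nat -> R) (n : nat) (A : pred nat) :
  -1 < a -> -1 < b -> (forall l m, wint a b (P l * P m) = (l == m)%:R) ->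
  wint a b ((\sum_(l < n | A l) (c l)%:P * P l) ^+ 2) = \sum_(l < n | A l) c l ^+ 2.
Proof.
move=> a1 b1 oP; rewrite expr2 mulr_suml wint_sum //; apply: eq_bigr => l Al.
rewrite mulr_sumr wint_sum // (bigD1 l) //= big1 => [|m /andP[Am ml]].
  have -> : (c l)%:P * P l * ((c l)%:P * P l) = (c l ^+ 2)%:P * (P l * P l).
    by rewrite -[c l ^+ 2]mulr1 expr2 !polyCM polyC1; ring.
  by rewrite wintC // oP eqxx mulr1 addr0.
have -> : (c l)%:P * P l * ((c m)%:P * P m) = (c l * c m)%:P * (P l * P m).
  by rewrite !polyCM; ring.
rewrite wintC // oP; case: eqP => [lm|_]; last by rewrite mulr0.
by move: ml; rewrite -val_eqE /= lm eqxx.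
Qed.

Lemma orth_at1 (a b : R) (P : nat -> {poly R}) l : -1 < a -> -1 < b -> 0 < a + b + 1 ->
  (forall l, size (P l) = l.+1) -> (forall l m, wint a b (P l * P m) = (l == m)%:R) ->
  0 < jnorm R a b l /\ (P l).[1] ^+ 2 = (jnorm R a b l)^-1.
Proof.
move=> a1 b1 ab sP oP.
have sl : (size (P l) <= l.+1)%N by rewrite sP.
have := wint_sqr_jnorm R a b l (P l) a1 b1 ab sl (orth_ode R a b P a1 b1 sP oP l).
rewrite oP eqxx mulr1n => h.
have j0 : 0 < jnorm R a b l.
  have l0 : 0 <= l%:R :> R by [].
  rewrite /jnorm; apply: mulr_gt0; first apply: mulr_gt0; first exact: wint_gt0.
    by apply: divr_gt0; apply: mulr_gt0; apply: poch_gt0; lra.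
  by apply: divr_gt0; lra.
by split => //; apply: (mulIf (lt0r_neq0 j0)); rewrite -h mulVf // lt0r_neq0.
Qed.

Lemma size_pred_sum_lt (I : Type) (s : seq I) (Q : pred I) (f : I -> {poly R}) (m : R) :
  0 < m -> (forall i, Q i -> (size (f i)).-1%:R < m) ->
  (size (\sum_(i <- s | Q i) f i)%R).-1%:R < m.
Proof.
move=> m0 h; apply: (big_ind (fun p : {poly R} => (size p).-1%:R < m)) => //.
  by rewrite size_poly0.
move=> p q hp hq; apply: le_lt_trans (_ : (maxn (size p).-1 (size q).-1)%:R < m).
  rewrite ler_nat; have := size_polyD p q.
  by move: (size p) (size q) (size (p + q)%R) => u v w; lia.
by rewrite /maxn; case: ifP.
Qed.

Lemma am_gm_weight (K P w eta : R) : 0 < eta -> 0 <= w ->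
  `|K * P| * w <= eta / 2 * K ^+ 2 + eta^-1 / 2 * (P ^+ 2 * w ^+ 2).
Proof.
move=> e0 w0; rewrite normrM.
have -> : K ^+ 2 = `|K| ^+ 2 by rewrite real_normK ?num_real.
have -> : P ^+ 2 = `|P| ^+ 2 by rewrite real_normK ?num_real.
move: `|K| `|P| => x y; rewrite -subr_ge0.
have -> : eta / 2 * x ^+ 2 + eta^-1 / 2 * (y ^+ 2 * w ^+ 2) - x * y * w =
   eta / 2 * (x - y * w / eta) ^+ 2 by field; exact: lt0r_neq0.
by rewrite mulr_ge0 ?sqr_ge0 // divr_ge0 // ltW.
Qed.

Lemma powR_le1D (v s r : R) : 0 <= v -> 0 <= s -> s <= r -> v `^ s <= 1 + v `^ r.
Proof.
move=> v0 s0 sr; have [v1|v1] := leP v 1.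
  rewrite -[leLHS]addr0 lerD ?powR_ge0 //.
  have <- : 1 `^ s = 1 :> R by rewrite powR1.
  by apply: ge0_ler_powR; rewrite ?nnegrE.
by rewrite -[leLHS]add0r lerD //; apply: ler_powR => //; exact: ltW.
Qed.

End Kernel.

Section ZonalMajorant.
Variable R : realType.
Local Notation wint := (@wint R).

(** By Parseval the integral of [K^2] is the squared constant times the sum of the squared values at
    1, which are the inverses of [jnorm]; dropping the condition [l < m] only enlarges the sum. *)
Lemma kernel_poly (d : nat) (m : R) : 0 < m -> let a := d%:R / 2 - 1 : R in
  -1 < a -> 0 < a + a + 1 ->
  (forall l, size (jacobi_seq a a l) = l.+1) ->
  (forall l1 l2, wint a a (jacobi_seq a a l1 * jacobi_seq a a l2) = (l1 == l2)%:R) ->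
  exists K : {poly R}, [/\ forall t, K.[t] = Kdm d m t, (size K).-1%:R < m &
    wint a a (K ^+ 2) <= (omega R d / omega R d.-1) ^+ 2 *
       \sum_(l < (Num.truncn m).+1) (jnorm R a a l)^-1].
Proof.
move=> m0 a a1 aa sP oP; set e := jacobi_seq a a in sP oP *.
set Om := omega R d / omega R d.-1.
exists (Om%:P * \sum_(l < (Num.truncn m).+1 | l%:R < m) (e l).[1]%:P * e l); split.
- move=> t; rewrite hornerM hornerC horner_sum /Kdm -/Om; congr (_ * _).
  by apply: eq_bigr => l _; rewrite hornerM hornerC.
- rewrite mul_polyC; apply: le_lt_trans (_ : (size (\sum_(l < (Num.truncn m).+1 | l%:R < m) (e l).[1]%:P * e l)%R).-1%:R < m).
    by rewrite ler_nat; have := size_scale_leq Om (\sum_(l < (Num.truncn m).+1 | l%:R < m) (e l).[1]%:P * e l); move: (size _) (size _) => u v; lia.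
  apply: size_pred_sum_lt => // l lm; apply: le_lt_trans lm.
  rewrite ler_nat mul_polyC; have := size_scale_leq (e l).[1] (e l); rewrite sP.
  by move: (size _) => u; lia.
- rewrite exprMn expr2 -polyCM -expr2 wintC //; apply: ler_wpM2l; first exact: sqr_ge0.
  rewrite (wint_sqr_sum R a a e (fun l => (e l).[1]) _ (fun l => l%:R < m)) //.
  rewrite big_mkcond /=; apply: ler_sum => l _.
  have [j0 <-] := orth_at1 R a a e l a1 a1 aa sP oP.
  by case: ifP => // _; exact: sqr_ge0.
Qed.

(** This [eta] makes the first term exactly half of the target, and the hypothesis on [A B] bounds
    the second by the other half. *)
Lemma balance (A B kappa Q : R) : 0 < A -> 0 < kappa -> 0 < Q ->
  A * B <= kappa ^+ 2 * Q ^+ 2 ->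
  exists eta, 0 < eta /\ eta / 2 * A + eta^-1 / 2 * B <= kappa * Q.
Proof.
move=> A0 k0 Q0 AB; have kQ : 0 < kappa * Q by exact: mulr_gt0.
exists (kappa * Q / A); split; first by rewrite divr_gt0.
have -> : kappa * Q / A / 2 * A = kappa * Q / 2 by field; exact: lt0r_neq0.
have -> : (kappa * Q / A)^-1 / 2 * B = A * B / (2 * (kappa * Q)).
  by field; rewrite !lt0r_neq0.
have : A * B / (2 * (kappa * Q)) <= kappa * Q / 2.
  rewrite ler_pdivrMr ?mulr_gt0 //; apply: (le_trans AB).
  by rewrite le_eqVlt; apply/orP; left; apply/eqP; field.
lra.
Qed.

(** * The zonal sum of weighted squares that dominates the integrand *)

Lemma zonal_majorant (r s : R) : 0 <= s -> s <= r -> exists kappa : R, 0 < kappa /\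
  forall (d k : nat) (n : R), (3 <= d)%N -> d%:R * n = k%:R ->
  (d%:R + r + 1) ^+ 2 <= n * d%:R ->
  exists L : seq (R * (nat * {poly R})),
   [/\ forall e, e \in L -> 0 <= e.1 /\ (e.2.1 + (size e.2.2).-1)%:R < (d%:R + 2) * n,
     forall t, -1 <= t <= 1 -> `|Phit d k n r t| * (1 - t) `^ (s / 2) <=
        \sum_(e <- L) e.1 * ((1 - t) ^+ e.2.1 * e.2.2.[t] ^+ 2) &
     \sum_(e <- L) e.1 * wint (d%:R / 2 - 1) (d%:R / 2 - 1) ((1 - 'X) ^+ e.2.1 * e.2.2 ^+ 2)
        / wint (d%:R / 2 - 1) (d%:R / 2 - 1) 1 <= kappa * n `^ (- s)].
Proof.
move=> s0 sr; have r0 : 0 <= r := le_trans s0 sr.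
have [Cm [Cm0 hCm]] := poly_majorant R r r0.
have [Cz [Cz0 hCz]] := zonal_moment_bound R r r0.
have [c0 [c00 hc0]] := omega_ratio_bound R.
pose Cr := 4 * expR 2 * 2 `^ (r + 2) * (1 + r) `^ r * (r + 2) `^ (r + 2) : R.
have Cr0 : 0 <= Cr by rewrite /Cr !mulr_ge0 ?powR_ge0 // ltW // expR_gt0.
pose C1 := Cz * (1 + 2 * Cm).
have C10 : 0 <= C1 by rewrite /C1 mulr_ge0 ?addr_ge0 ?mulr_ge0 // ltW.
have q0 : 0 <= c0 ^+ 2 * (Cr * C1).
  by apply: mulr_ge0; [exact: sqr_ge0|exact: mulr_ge0].
have [kappa [kappa1 kappa2]] : exists kappa : R, 1 <= kappa /\ c0 ^+ 2 * (Cr * C1) <= kappa ^+ 2.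
  exists (1 + c0 ^+ 2 * (Cr * C1)); split; first by rewrite lerDl.
  rewrite expr2 -[leLHS]mul1r; apply: ler_pM => //; first by rewrite lerDl.
  by rewrite lerDr.
have kappa0 : 0 < kappa := lt_le_trans ltr01 kappa1.
exists kappa; split=> //.
move=> d k n d3 dn nd.
have dr : 3 <= d%:R :> R by rewrite (ler_nat R 3).
have nD : d%:R + 2 * r + 2 <= n.
  rewrite -(ler_pM2r (_ : 0 < d%:R)); last by lra.
  apply: le_trans nd; have := sqr_ge0 r; have : 0 <= r * d%:R by rewrite mulr_ge0 //; lra.
  lra.
have n0 : 0 < n by lra.
have nr : 2 * r + 5 <= n by lra.
have n1 : 1 <= n by lra.
set a := d%:R / 2 - 1; have a1 : -1 < a by rewrite /a; lra.
have aa : 0 < a + a + 1 by rewrite /a; lra.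
have ar1 : -1 < a + r by rewrite /a; lra.
have ra0 : r + a != 0 by apply: lt0r_neq0; rewrite /a; lra.
pose al := d%:R / 2 + r : R; pose be := d%:R / 2 - 2 : R.
have al1 : -1 < al by rewrite /al; lra.
have be1 : -1 < be by rewrite /be; lra.
have ab : 0 < al + be + 1 by rewrite /al /be; lra.
have Z0 := wint_gt0 R a a a1 a1.
have Qpos : 0 < n `^ (- s) by exact: powR_gt0.
(* If either Jacobi sequence is the zero default, [Phit] vanishes and the empty list suffices. *)
have [[sE oE]|zE] := jacobi_seq_orth R a a a1 a1; last first.
  exists [::]; split => //.
    move=> t _; rewrite big_nil /Phit /Kdm big1 ?mulr0 ?mul0r ?normr0 ?mul0r //.
    by move=> l _; rewrite /jacobi -/a zE horner0 mul0r.
  by rewrite big_nil mulr_ge0 // ltW.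
have [[sP oP]|zP] := jacobi_seq_orth R al be al1 be1; last first.
  exists [::]; split => //.
    move=> t _; rewrite big_nil /Phit /jacobi -/al -/be zP horner0 mul0r mulr0 normr0 mul0r //.
  by rewrite big_nil mulr_ge0 // ltW.
have m0 : 0 < (d%:R + 2) * n by rewrite mulr_gt0 //; lra.
have [K [KE sK AK]] := kernel_poly d _ m0 a1 aa sE oE.
rewrite -/a in AK.
have [X1 W0] := hCz d k n _ d3 dn nd sP oP.
rewrite -/a in X1 W0.
have [N0 NE] := orth_at1 R al be _ k al1 be1 ab sP oP.
set N := jnorm R al be k in N0 NE.
set p := jacobi_seq al be k in X1 W0 NE.
pose P := p.[1]^-1%:P * p.
have mE : (d%:R + 2) * n = k%:R + 2 * n by rewrite -dn; ring.
have [ms [ms1 ms2 ms3]] := hCm n nr.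
set T := n `^ (2 * r) in W0; set T' := n `^ (- (2 * r)) in ms3.
set Q := n `^ (- s) in Qpos *.
have T0 : 0 < T by exact: powR_gt0.
have T'0 : 0 < T' by exact: powR_gt0.
have nn0 : n != 0 by exact: lt0r_neq0.
have TT : T * T' = 1 by rewrite /T /T' -powRD ?nn0 ?implybT // subrr powRr0.
set W := wint a a (p * p) in W0; set X := wint (a + r) a (p * p) in X1.
pose G : {poly R} := \sum_(c <- ms) c.1%:P * ((1 - 'X) ^+ c.2.1 * c.2.2 ^+ 2).
have GE t : G.[t] = \sum_(c <- ms) c.1 * ((1 - t) ^+ c.2.1 * c.2.2.[t] ^+ 2).
  by rewrite horner_sum; apply: eq_bigr => c _; rewrite !(hornerE, horner_exp).
have WG : wint a a (G * (p * p)) <= Cm * X + (Cm * T') * W.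
  apply: (wint_le2 _ _ _ _ _ _ _ _ _ _ _ a1 a1 ar1 a1 a1 a1) => t t11.
  have -> : jacobi_weight (a + r) a t = (1 - t) `^ r * jacobi_weight a a t.
    rewrite /jacobi_weight mulrA -powRD ?(negbTE ra0) //.
    by rewrite [r + a]addrC.
  rewrite hornerM GE; have p0 : 0 <= (p * p).[t] by rewrite hornerM -expr2 sqr_ge0.
  have := ler_wpM2r (mulr_ge0 p0 (jacobi_weight_ge0 R a a t)) (ms3 t t11).
  move: (jacobi_weight a a t) (\sum_(c <- ms) _) ((p * p).[t]) ((1 - t) `^ r).
  by clear => w g q u; lra.
set Z := wint a a 1 in Z0 *.
set Ssum := \sum_(l < _) _ in AK.
have S0 : 0 < Ssum.
  rewrite /Ssum big_ord_recl ltr_pwDl //.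
    by rewrite invr_gt0; have [] := orth_at1 R a a _ 0 a1 a1 aa sE oE.
  apply: sumr_ge0 => l _; rewrite invr_ge0 ltW //.
  by have [] := orth_at1 R a a _ (lift ord0 l) a1 a1 aa sE oE.
(* The kernel sum stops at the integer part of [(d + 2) n = k + 2 n], that is at [k + m] with
   [m <= 2 n]. *)
have SN : Ssum * N <= Cr * n `^ (- (2 * r + 1)).
  have kL : (k <= Num.truncn ((d%:R + 2) * n))%N.
    by rewrite truncn_ge_nat ?(ltW m0) // mE lerDl mulr_ge0 // ltW.
  rewrite /Ssum -(subnKC kL); apply: christoffel_ratio => //.
  by rewrite natrB // lerBlDr [leRHS]addrC -mE truncn_le ltW.
(* The squared [omega] ratio is at most [c0^2 Z^2], and dividing by [Z] normalizes the measure. The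
   [1 / Z] in [B'] below then cancels the remaining [Z]. *)
pose A' := c0 ^+ 2 * Z * Ssum.
have A'0 : 0 < A' by rewrite /A' !mulr_gt0 // exprn_gt0.
have AA : wint a a (K ^+ 2) / Z <= A'.
  rewrite ler_pdivrMr //; apply: (le_trans AK).
  have d0 : (0 < d)%N by apply: leq_trans d3.
  have h1 := hc0 d d0; have h2 := omega_ratio_ge0 R d d0.
  have -> : A' * Z = (c0 * Z) ^+ 2 * Ssum by rewrite /A'; ring.
  have cZ0 : 0 <= c0 * Z by apply: mulr_ge0; exact: ltW.
  by rewrite ler_wpM2r ?(ltW S0) // ler_sqr ?nnegrE.
pose B' := Q ^+ 2 * (N / Z) * (T * n * C1).
have AB : A' * B' <= kappa ^+ 2 * Q ^+ 2.
  have e : A' * B' = c0 ^+ 2 * (Ssum * N * (T * n) * C1) * Q ^+ 2.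
    by rewrite /A' /B'; field; exact: lt0r_neq0.
  rewrite e ler_wpM2r ?sqr_ge0 //; apply: le_trans kappa2.
  rewrite ler_wpM2l ?sqr_ge0 // ler_wpM2r //.
  have -> : Cr = Cr * n `^ (- (2 * r + 1)) * (T * n).
    have <- : n `^ (2 * r + 1) = T * n by rewrite powRD ?nn0 ?implybT // powRr1 // ltW.
    by rewrite -mulrA -powRD ?nn0 ?implybT // addNr powRr0 mulr1.
  by rewrite ler_wpM2r // mulr_ge0 // ltW.
have [eta [eta0 etaB]] := balance _ _ _ _ A'0 kappa0 Qpos AB.
have etai0 : 0 < eta^-1 by rewrite invr_gt0.
(* The list contains the AM-GM term in [K^2], and [P^2 u^s / eta] after [u^s <= Q^2 (1 + T u^r)],
   with [u^r] replaced by its majorant [ms]. The products [P q] have degree at most [k] plus that of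
   [q], within the [2 n] left over. *)
exists ((eta / 2, (0%N, K)) :: (eta^-1 / 2 * Q ^+ 2, (0%N, P)) ::
   [seq (eta^-1 / 2 * Q ^+ 2 * T * c.1, (c.2.1, P * c.2.2)) | c <- ms]).
have sP' : ((size P).-1 <= k)%N.
  have := size_scale_leq p.[1]^-1 p; rewrite -mul_polyC -/P sP.
  by move: (size P); clear => u; lia.
split.
- move=> e; rewrite !inE => /or3P[/eqP ->|/eqP ->|/mapP[c cm ->]] /=.
  + by rewrite add0n; split=> //; rewrite divr_ge0 // ltW.
  + split; first by rewrite mulr_ge0 ?sqr_ge0 // divr_ge0 // ltW.
    rewrite add0n; apply: (@le_lt_trans _ _ k%:R); first by rewrite ler_nat.
    by rewrite mE; lra.
  + have [c10 cn] := ms1 c cm; split.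
      by rewrite !mulr_ge0 ?sqr_ge0 // ltW.
    apply: (@le_lt_trans _ _ (c.2.1 + (k + (size c.2.2).-1))%:R).
      rewrite ler_nat leq_add2l; have := size_polyMleq P c.2.2; move: sP'.
      by move: (size P) (size c.2.2) (size (P * c.2.2)%R); clear => u v w; lia.
    by rewrite !natrD mE; lra.
- move=> t t11; have /andP[t1 t2] := t11.
  have u0 : 0 <= 1 - t by lra.
  have -> : Phit d k n r t = K.[t] * P.[t].
    by rewrite /Phit -KE /P hornerM hornerC /jacobi -/al -/be -/p [_ / _]mulrC.
  apply: le_trans (am_gm_weight R K.[t] P.[t] _ eta eta0 (powR_ge0 _ _)) _.
  have -> : (1 - t) `^ (s / 2) ^+ 2 = (1 - t) `^ s.
    by rewrite -powR_mulrn ?powR_ge0 // -powRrM; congr (_ `^ _); field.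
  have ws : (1 - t) `^ s <= Q ^+ 2 * (1 + T * (1 - t) `^ r).
    have v0 : 0 <= n ^+ 2 * (1 - t) by rewrite mulr_ge0 // sqr_ge0.
    have := powR_le1D R _ s r v0 s0 sr.
    have n2 z : (n ^+ 2) `^ z = n `^ (2 * z) by rewrite -powR_mulrn ?(ltW n0) // -powRrM.
    rewrite !(@powRM _ (n ^+ 2) (1 - t)) ?sqr_ge0 // !n2 -/T => h.
    have := ler_wpM2l (sqr_ge0 Q) h.
    have -> : Q ^+ 2 * (n `^ (2 * s) * (1 - t) `^ s) = (1 - t) `^ s; last by [].
    rewrite mulrA -powR_mulrn ?(ltW Qpos) // /Q -powRrM -powRD ?nn0 ?implybT //.
    by rewrite (_ : _ + _ = 0) ?powRr0 ?mul1r //; ring.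
  rewrite !big_cons big_map /= !expr0 !mul1r.
  have -> : \sum_(c <- ms) eta^-1 / 2 * Q ^+ 2 * T * c.1 * ((1 - t) ^+ c.2.1 * (P * c.2.2).[t] ^+ 2) =
     eta^-1 / 2 * Q ^+ 2 * T * P.[t] ^+ 2 * \sum_(c <- ms) c.1 * ((1 - t) ^+ c.2.1 * c.2.2.[t] ^+ 2).
    by rewrite mulr_sumr; apply: eq_bigr => c _; rewrite hornerM exprMn; ring.
  rewrite lerD2l.
  have c0' : 0 <= eta^-1 / 2 * P.[t] ^+ 2 by rewrite mulr_ge0 ?sqr_ge0 // divr_ge0 // ltW.
  have h1 := ler_wpM2l c0' ws.
  have c1' : 0 <= eta^-1 / 2 * Q ^+ 2 * T * P.[t] ^+ 2.
    apply: mulr_ge0 (sqr_ge0 _); apply: mulr_ge0 (ltW T0).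
    by apply: mulr_ge0 (sqr_ge0 _); rewrite divr_ge0 // ltW.
  have h2 := ler_wpM2l c1' (ms2 t t11).
  move: h1 h2; clear.
  move: (eta^-1) (P.[t] ^+ 2) ((1 - t) `^ s) ((1 - t) `^ r) (Q ^+ 2) (\sum_(c <- ms) _) => x1 x2 x3 x4 x5 x6 h1 h2.
  lra.
- rewrite !big_cons big_map /= !expr0 !mul1r.
  have PP : P ^+ 2 = N%:P * (p * p).
    have -> : N = p.[1]^-1 * p.[1]^-1 by rewrite -[N]invrK -NE expr2 invfM.
    by rewrite /P polyCM expr2; ring.
  have -> : wint a a (P ^+ 2) = N * W by rewrite PP wintC.
  have -> : \sum_(c <- ms) eta^-1 / 2 * Q ^+ 2 * T * c.1 *
       wint a a ((1 - 'X) ^+ c.2.1 * (P * c.2.2) ^+ 2) / Z =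
     eta^-1 / 2 * Q ^+ 2 * T * N * wint a a (G * (p * p)) / Z.
    rewrite /G mulr_suml wint_sum // mulr_sumr mulr_suml; apply: eq_bigr => c _.
    rewrite exprMn PP.
    have -> : (1 - 'X) ^+ c.2.1 * (N%:P * (p * p) * c.2.2 ^+ 2) =
       N%:P * ((1 - 'X) ^+ c.2.1 * c.2.2 ^+ 2 * (p * p)) by ring.
    rewrite wintC // -[c.1%:P * _ * _]mulrA wintC //.
    by move: (wint a a _) => w; ring.
  apply: le_trans etaB.
  have -> : eta / 2 * wint a a (K ^+ 2) / Z = eta / 2 * (wint a a (K ^+ 2) / Z) by rewrite mulrA.
  apply: lerD.
    by apply: ler_wpM2l AA; rewrite divr_ge0 // ltW.
  have -> : eta^-1 / 2 * Q ^+ 2 * (N * W) / Z + eta^-1 / 2 * Q ^+ 2 * T * N * wint a a (G * (p * p)) / Z =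
     eta^-1 / 2 * (Q ^+ 2 * (N / Z) * (W + T * wint a a (G * (p * p)))) by ring.
  rewrite /B'; apply: ler_wpM2l; first by rewrite divr_ge0 // ltW.
  apply: ler_wpM2l; first by rewrite mulr_ge0 ?sqr_ge0 // divr_ge0 // ltW.
  have g1 := ler_wpM2l (ltW T0) WG.
  have g2 := ler_wpM2l (mulr_ge0 (ltW T0) (ltW Cm0)) X1.
  have g3 := ler_wpM2l (ltW Cm0) W0.
  have g4 : T * (Cm * X + Cm * T' * W) = T * Cm * X + Cm * W.
    by rewrite -[in RHS](mul1r (Cm * W)) -TT; ring.
  rewrite /C1; move: g1 g2 g3 W0; rewrite g4.
  move: (wint a a (G * _)); clear => w; lra.
Qed.
End ZonalMajorant.

(** * Measurability, comparison of the two integrands, and the theorem *)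

Lemma measurable_fun_horner_dotv (R : realType) (d : nat) (F : {poly R}) (x : Rd R d) :
  measurable_fun [set: Rd R d] (fun y : Rd R d => F.[dotv x y]).
Proof. by have [] := spherefun_horner R d F _ (spherefun_dotv R d x). Qed.

Lemma measurable_fun_Phit_dotv (R : realType) (d k : nat) (n r : R) (x : Rd R d) :
  measurable_fun [set: Rd R d] (fun y : Rd R d => Phit d k n r (dotv x y)).
Proof.
suff [] : spherefun R d (fun y : Rd R d => Phit d k n r (dotv x y)) by [].
have sf F : spherefun R d (fun y : Rd R d => F.[dotv x y]).
  by apply: spherefun_horner; exact: spherefun_dotv.
apply: spherefunM; last by apply: spherefunM; [exact: sf|exact: spherefun_cst].
by apply: spherefunZ; apply: spherefun_sum => l; apply: spherefunZ; exact: sf.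
Qed.

Lemma measurable_fun_powR_dotv (R : realType) (d : nat) (F : {poly R}) (c : R) (x : Rd R d) :
  measurable_fun [set: Rd R d] (fun y : Rd R d => F.[dotv x y] `^ c).
Proof.
apply: (measurableT_comp (f := fun t => t `^ c)); first exact: measurable_powR.
exact: measurable_fun_horner_dotv.
Qed.

Section FinalBound.
Variables (R : realType) (d k : nat) (n r s : R) (x : Rd R d).
Local Notation E := (Rd R d).
Local Notation S := (Ssphere R d).

Let phit (y : E) := `|Phit d k n r (dotv x y)| * (1 - dotv x y) `^ (s / 2).
Let phi (y : E) := `|Phi d k n r (dotv x y)| * (1 - dotv x y) `^ (s / 2) *
  ((1 + dotv x y) / 2) `^ (- n).

Lemma measurable_phit : measurable_fun S (fun y : E => (phit y)%:E).
Proof.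
apply/measurable_EFinP; apply: measurable_funTS; apply: measurable_funM.
  by apply: measurableT_comp => //; exact: measurable_fun_Phit_dotv.
have := measurable_fun_powR_dotv R d (1 - 'X) (s / 2) x.
by under eq_fun do rewrite hornerD hornerN hornerX hornerC.
Qed.

Lemma measurable_phi : measurable_fun S (fun y : E => (phi y)%:E).
Proof.
have h c : measurable_fun [set: E] (fun y : E => ((1 + dotv x y) / 2) `^ c).
  have := measurable_fun_powR_dotv R d ((1 + 'X) * (2^-1)%:P) c x.
  by under eq_fun do rewrite hornerM hornerD hornerX !hornerC.
apply/measurable_EFinP; apply: measurable_funM; last exact: measurable_funTS.
rewrite (_ : (fun y => _) = fun y => phit y * ((1 + dotv x y) / 2) `^ n).
  apply: measurable_funM; last exact: measurable_funTS.
  by apply/measurable_EFinP; exact: measurable_phit.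
by apply/funext => y; rewrite /phi /Phi normrM [`|_ `^ n|]ger0_norm ?powR_ge0 // [_ * _ * (1 - _) `^ _]mulrAC.
Qed.

(** The powers with exponents [n] and [- n] cancel except where [1 + x.y = 0]. There, for nonzero
    [n], [powR] gives [0] and the product is [0], so only an inequality is claimed. *)
Lemma phi_le_phit y : 0 <= phi y <= phit y.
Proof.
rewrite /phi /phit !mulr_ge0 ?powR_ge0 //= /Phi normrM.
rewrite [`|_ `^ n|]ger0_norm ?powR_ge0 // [_ * _ * (1 - _) `^ _]mulrAC -[leLHS]mulrA.
rewrite -[leRHS]mulr1; apply: ler_wpM2l; first by rewrite mulr_ge0 ?powR_ge0.
have [->|b0] := eqVneq ((1 + dotv x y) / 2) 0; last first.
  by rewrite -powRD ?b0 ?implybT // subrr powRr0.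
have [->|n0] := eqVneq n 0; first by rewrite oppr0 powRr0 mulr1.
by rewrite powR0 // mul0r.
Qed.

End FinalBound.

(** The infimum need not be attained, so the bound is asked for every admissible [c]; one such [c]
    already forces [v] to be finite, and [v / b] is then a lower bound of the set. *)
Lemma MZ_norm_ge (R : realType) (d : nat) (mu nuv : {measure set (Rd R d) -> \bar R})
    (m b : R) (v : \bar R) : 0 < b -> is_MZ mu nuv m -> (0 <= v)%E ->
  (forall c, 0 < c -> MZ_ineq mu nuv m c -> (v <= (c * b)%:E)%E) ->
  (v <= (MZ_norm mu nuv m * b)%:E)%E.
Proof.
move=> b0 [c0 [c00 hc0]] v0 h.
have := h c0 c00 hc0; case: v v0 h => [v| |] //= _ h _.
rewrite lee_fin -ler_pdivrMr //; apply: lb_le_inf; first by exists c0.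
by move=> c [c1 hc]; rewrite ler_pdivrMr // -lee_fin; exact: h.
Qed.

Theorem theorem7p2 (R : realType) (r s : R) :
  0 <= s -> s <= r ->
  exists C : R, 0 < C /\
  forall (d k : nat) (n : R),
    (3 <= d)%N ->
    d%:R * n = k%:R ->
    (d%:R + r + 1) ^+ 2 <= n * d%:R ->
    forall mu : {measure set (Rd R d) -> \bar R},
    is_normalized_surface_measure mu ->
    forall (nu : {charge set (Rd R d) -> \bar R}) (P N : set (Rd R d))
      (nuPN : hahn_decomposition nu P N),
    charge_variation nuPN (~` Ssphere R d) = 0%E ->
    is_MZ mu (charge_variation nuPN) (2 * (d%:R + 2) * n) ->
    let bound := (C * d%:R `^ (1 / 6) / n `^ s *
                  MZ_norm mu (charge_variation nuPN) (2 * (d%:R + 2) * n))%:E in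
    (ereal_sup [set \int[charge_variation nuPN]_(y in Ssphere R d)
                 (`| Phit d k n r (dotv x y) | *
                  (1 - dotv x y) `^ (s / 2))%:E
               | x in Ssphere R d] <= bound)%E /\
    (ereal_sup [set \int[charge_variation nuPN]_(y in Ssphere R d)
                 (`| Phi d k n r (dotv x y) | *
                  (1 - dotv x y) `^ (s / 2) *
                  ((1 + dotv x y) / 2) `^ (- n))%:E
               | x in Ssphere R d] <= bound)%E.
Proof.
move=> s0 sr; have [kappa [kappa0 hk]] := zonal_majorant R r s s0 sr.
exists kappa; split=> // d k n d3 dn nd mu hmu nu P N nuPN nuS MZ bound.
set nuv := charge_variation nuPN in MZ bound *.
have d0 : (0 < d)%N by exact: leq_trans d3.
have n0 : 0 < n.
  have dp : 0 < d%:R :> R by rewrite ltr0n.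
  rewrite -(pmulr_lgt0 _ dp); apply: lt_le_trans nd; apply: exprn_gt0.
  have := le_trans s0 sr; move: dp; clear; lra.
have [L [L1 L2 L3]] := hk d k n d3 dn nd.
have first_le x : Ssphere R d x ->
    (\int[nuv]_(y in Ssphere R d) (`|Phit d k n r (dotv x y)| * (1 - dotv x y) `^ (s / 2))%:E
      <= bound)%E.
  move=> Sx; have Q0 : 0 < n `^ (- s) by exact: powR_gt0.
  have mS := measurable_Ssphere R d.
  have ge0 y : 0 <= `|Phit d k n r (dotv x y)| * (1 - dotv x y) `^ (s / 2).
    by rewrite mulr_ge0 ?powR_ge0.
  set v := integral _ _ _.
  have v0 : (0 <= v)%E by apply: integral_ge0 => y _; rewrite lee_fin.
  have h : (v <= (MZ_norm mu nuv (2 * (d%:R + 2) * n) * (kappa * n `^ (- s)))%:E)%E.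
    apply: MZ_norm_ge => //; first exact: mulr_gt0.
    move=> c c0 hc.
    have L1' e : e \in L -> 0 <= e.1 /\ (e.2.1 + (size e.2.2).-1)%:R < 2 * (d%:R + 2) * n / 2.
      by move=> /L1; rewrite (_ : 2 * (d%:R + 2) * n / 2 = (d%:R + 2) * n) //; field.
    have := MZ_zonal_sum R d mu nuv _ c x L hmu d0 (ltW c0) hc Sx L1'.
    have cL := ler_wpM2l (ltW c0) L3; rewrite -lee_fin in cL.
    move/le_trans => /(_ _ cL); apply: le_trans.
    apply: ge0_le_integral => //.
    - by move=> y _; rewrite lee_fin.
    - exact: (measurable_phit R d k n r s x).
    - apply/measurable_EFinP; apply: measurable_funTS.
      pose F : {poly R} := \sum_(e <- L) e.1%:P * ((1 - 'X) ^+ e.2.1 * e.2.2 ^+ 2).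
      have := measurable_fun_horner_dotv R d F x; congr (measurable_fun _ _).
      apply/funext => y; rewrite /F horner_sum; apply: eq_bigr => e _.
      by rewrite !(hornerE, horner_exp).
    - by move=> y Sy; rewrite lee_fin; apply: L2; exact: dotv_le1.
  apply: le_trans h _; rewrite /bound lee_fin.
  have M0 : 0 <= MZ_norm mu nuv (2 * (d%:R + 2) * n).
    by have [c0 hc0] := MZ; apply: lb_le_inf; [exists c0|move=> c [/ltW]].
  have D1 : 1 <= d%:R `^ (1 / 6) :> R.
    apply: (@le_trans _ _ (1 `^ (1 / 6))); first by rewrite powR1.
    by apply: ge0_ler_powR; rewrite ?nnegrE ?divr_ge0 // ler1n.
  have := ler_wpM2l (mulr_ge0 (mulr_ge0 M0 (ltW kappa0)) (ltW Q0)) D1.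
  rewrite mulr1 -powRN mulrA => /le_trans; apply.
  by rewrite le_eqVlt; apply/orP; left; apply/eqP; ring.
split; apply: ub_ereal_sup => _ [x Sx <-]; first exact: first_le.
apply: le_trans (first_le x Sx); apply: ge0_le_integral.
- exact: measurable_Ssphere.
- by move=> y _; rewrite lee_fin; have /andP[] := phi_le_phit R d k n r s x y.
- exact: (measurable_phi R d k n r s x).
- exact: (measurable_phit R d k n r s x).
- by move=> y _; rewrite lee_fin; have /andP[] := phi_le_phit R d k n r s x y.
Qed.
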